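(* Let $m\ge2$ and let $\mathscr{H}(\widetilde K)\subset\mathcal{H}(\mathbb{B}_m)$ be a reproducing kernel Hilbert space with reproducing kernel $\widetilde K$ such that: there exists a non-decreasing sub-exponential function $\Lambda:\mathbb{N}\to\mathbb{R}^+$ with $$\int_{\{x\in\mathbb{B}_m:\,k\le d_h(x,0)<k+1\}}\widetilde K(x,x)\,d\mu_{\mathbb{B}_m}(x)\le\Lambda(k)e^{2(m-1)k}\quad\text{for any }k\in\mathbb{N},$$ and $$\lim_{\alpha\to0^+}\alpha^2\int_{\mathbb{B}_m}\widetilde K(x,x)(1-|x|^2)^{\alpha+m-2}dV_m(x)=0.$$ Fix $a\in\mathbb{B}_m$ and a sequence $(s_n)_{n\ge1}$ in $(m-1,\infty)$ converging to $m-1$ with $$\sum_{n=1}^\infty(s_n-m+1)^2\int_{\mathbb{B}_m}\widetilde K(x,x)(1-|x|^2)^{s_n-1}dV_m(x)<\infty.$$ If $\Pi$ is a point process on $\mathbb{B}_m$ satisfying the small variance assumption and having first intensity measure $\lambda\mu_{\mathbb{B}_m}$ with $\lambda>0$ a constant, then $\Pi$-almost any $X\in\mathrm{Conf}(\mathbb{B}_m)$ satisfies: (1) For any $n$, $$\sum_{k=0}^\infty\Big\|\sum_{x\in X,\ k\le d_h(a,x)<k+1}e^{-s_nd_h(a,x)}\widetilde K_x\Big\|_{\mathscr{H}(\widetilde K)}<\infty.$$ (2) $$\lim_{n\to\infty}\left\|\frac{\sum_{k=0}^\infty\sum_{x\in X,\ k\le d_h(a,x)<k+1}e^{-s_nd_h(a,x)}\widetilde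 K_x}{\sum_{x\in X}e^{-s_nd_h(a,x)}}-\widetilde K_a\right\|_{\mathscr{H}(\widetilde K)}=0.$$ (3) The limit equality $$f(a)=\lim_{n\to\infty}\frac{\sum_{k=0}^\infty\sum_{x\in X,\ k\le d_h(a,x)<k+1}e^{-s_nd_h(a,x)}f(x)}{\sum_{x\in X}e^{-s_nd_h(a,x)}}$$ holds simultaneously for all $f\in\mathscr{H}(\widetilde K)$.
   Context: $\mathbb{B}_m\subset\mathbb{R}^m$ is the open unit ball, $V_m$ is Lebesgue measure normalized so that $V_m(\mathbb{B}_m)=1$. For $a\in\mathbb{B}_m$, $$\psi_a(x)=\frac{a|x-a|^2+(1-|a|^2)(a-x)}{|x-a|^2+(1-|a|^2)(1-|x|^2)},$$ the hyperbolic distance is $d_h(a,b)=\log\frac{1+|\psi_a(b)|}{1-|\psi_a(b)|}$, and $d\mu_{\mathbb{B}_m}(x)=\frac{dV_m(x)}{(1-|x|^2)^m}$. $\mathcal{H}(\mathbb{B}_m)$ is the space of complex-valued $\mathcal{H}$-harmonic functions: $f\in C^2(\mathbb{B}_m)$ with $\Delta_hf\equiv0$, $\Delta_h=(1-|x|^2)^2\sum_i\frac{\partial^2}{\partial x_i^2}+2(m-2)(1-|x|^2)\sum_ix_i\frac{\partial}{\partial x_i}$. $\widetilde K_x(y)=\widetilde K(y,x)$. A non-negative function $\Lambda$ on $\mathbb{N}$ is sub-exponential if $\lim_{t\to\infty}\Lambda(t)e^{-\alpha t}=0$ for every $\alpha>0$. A configuration on a locally compact complete separable metric space $E$ is a collection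 of points of $E$ (possibly with multiplicities) with finitely many points in each relatively compact set; $\mathrm{Conf}(E)$ is the space of configurations with the usual Borel structure. Sums over $x\in X$ are taken with multiplicity. A point process on $E$ is a Borel probability measure $\Pi$ on $\mathrm{Conf}(E)$; its first intensity measure is $B\mapsto\mathbb{E}_\Pi(\#_B(\mathscr{X}))$, with $\mathscr{X}$ the random configuration and $\#_B$ the number of points in $B$. Small variance assumption: there is a constant $C>0$ depending only on $\Pi$ such that for every $f:E\to\mathbb{C}$ with $\mathbb{E}_\Pi[\sum_{x\in\mathscr{X}}(|f(x)|+|f(x)|^2)]<\infty$, $$\mathrm{Var}_\Pi\Big(\sum_{x\in\mathscr{X}}f(x)\Big)\le C\,\mathbb{E}_\Pi\Big(\sum_{x\in\mathscr{X}}|f(x)|^2\Big).$$ *)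

(* Defs.v *)
From HB Require Import structures.
From mathcomp Require Import all_boot all_order all_algebra.
From mathcomp Require Import all_classical all_reals all_analysis.
From mathcomp Require Import measurable_realfun complex.

Set Implicit Arguments.
Unset Strict Implicit.
Unset Printing Implicit Defensive.

Import Order.TTheory GRing.Theory Num.Theory numFieldNormedType.Exports.

Local Open Scope classical_set_scope.
Local Open Scope ring_scope.
Local Open Scope complex_scope.

Notation borel E := (g_sigma_algebraType (@open E)).
Definition modulus {R : realType} (z : R[i]) : R := ComplexField.Normc.normc z.

(* The library norm on 'rV[R]_m is the sup norm (same topology, different unit
   ball), hence the explicit Euclidean norm below. *)
Section euclidean_geometry.
Context {R : realType} {m : nat}.
Implicit Types a b x : 'rV[R]_m.

Definition sqnorm x : R := \sum_i x 0 i ^+ 2.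
Definition enorm x : R := Num.sqrt (sqnorm x).

Definition psi a x : 'rV[R]_m :=
  (sqnorm (x - a) + (1 - sqnorm a) * (1 - sqnorm x))^-1 *:
    (sqnorm (x - a) *: a + (1 - sqnorm a) *: (a - x)).

Definition dh a b : R := ln ((1 + enorm (psi a b)) / (1 - enorm (psi a b))).

Definition unit_ball : set 'rV[R]_m := [set x | enorm x < 1].

End euclidean_geometry.

Definition uball (R : realType) (m : nat) : Type := set_type (@unit_ball R m).

Section uball_instances.
Context (R : realType) (m : nat).

Lemma unit_ball0 : (0 : 'rV[R]_m) \in unit_ball.
Proof.
rewrite inE /unit_ball /= /enorm /sqnorm big1 ?sqrtr0// => i _.
by rewrite mxE expr0n.
Qed.

HB.instance Definition _ := SubType.on (uball R m).
HB.instance Definition _ := Topological.on (uball R m).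
HB.instance Definition _ :=
  isPointed.Build (uball R m) (exist _ 0 unit_ball0 : set_type unit_ball).

End uball_instances.

(* Local tool: view a measure with a sigma-finiteness proof as an element of
   {sigma_finite_measure set T -> \bar R}. *)
Section sigma_finite_package.
Context {R : realType} d (T : measurableType d).
Variables (mu : {measure set T -> \bar R}) (smu : sigma_finite setT mu).

Definition sigma_finite_package (_ : sigma_finite setT mu) : set T -> \bar R :=
  mu.

HB.instance Definition _ := Measure.on (sigma_finite_package smu).
HB.instance Definition _ :=
  Measure_isSigmaFinite.Build _ _ _ (sigma_finite_package smu) smu.

End sigma_finite_package.

(* n-fold product measure on n-tuples. *)
Section product_power.
Context {R : realType} d (T : measurableType d).
Variable nu : {sigma_finite_measure set T -> \bar R}.

Fixpoint product_power (n : nat) : set (n.-tuple T) -> \bar R :=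
  match n with
  | 0 => \d_ [tuple]
  | n'.+1 => pushforward (nu \x @product_power n')%E
      (fun p => [tuple of p.1 :: p.2])
  end.

Arguments product_power n : clear implicits.

Let product_power_prop n : {mu : {measure set (n.-tuple T) -> \bar R} |
  mu = product_power n :> (set (n.-tuple T) -> \bar R) &
  sigma_finite setT mu}.
Proof.
elim: n => [|n [mu0 mu0E smu0]] /=.
  exists (\d_ [tuple] : {measure set (0.-tuple T) -> \bar R}) => //.
  exact: sigma_finiteT.
pose mu : {sigma_finite_measure set (n.-tuple T) -> \bar R} :=
  sigma_finite_package smu0.
pose f (p : T * n.-tuple T) : n.+1.-tuple T := [tuple of p.1 :: p.2].
have mf : measurable_fun setT f by exact: measurable_cons.
pose pm : {measure set _ -> \bar R} := (nu \x mu)%E.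
exists (measure_function_pushforward__canonical__measure_function_Measure pm mf).
  by rewrite /= -mu0E.
have /sigma_finiteP[F [FT ndF Foo]] := sigma_finiteT nu.
have /sigma_finiteP[G [GT ndG Goo]] := sigma_finiteT mu.
pose g (t : n.+1.-tuple T) : T * n.-tuple T := (thead t, [tuple of behead t]).
have fK : cancel f g.
  by move=> [x t]; rewrite /f /g /= theadE; congr pair; exact/val_inj.
have mg : measurable_fun setT g.
  apply/measurable_fun_pairP; split; first exact: measurable_tnth.
  exact: measurable_behead.
exists (fun i => g @^-1` (F i `*` G i)).
  rewrite -preimage_bigcup [X in g @^-1` X](_ : _ = setT) ?preimage_setT//.
  apply/esym; rewrite -setXTT FT GT predeqE => -[x y]; split.
    move=> [/= [k _ Fkx] [l _ Gly]]; exists (maxn k l) => //; split.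
      by move: x Fkx; exact/subsetPset/ndF/leq_maxl.
    by move: y Gly; exact/subsetPset/ndG/leq_maxr.
  by move=> [k _ []/= ? ?]; split; exists k.
move=> i; have [mF Fi] := Foo i; have [mG Gi] := Goo i; split.
  by rewrite -[X in measurable X]setTI; apply: mg => //; exact: measurableX.
rewrite /= /pushforward -comp_preimage (_ : g \o f = id).
  by rewrite preimage_id product_measure1E// lte_mul_pinfty// ge0_fin_numE.
by apply/funext => x; exact: fK.
Qed.

Let product_power0 n : product_power n set0 = 0%E.
Proof. by have [mu <- _] := product_power_prop n; exact: measure0. Qed.

Let product_power_ge0 n A : (0 <= product_power n A)%E.
Proof. by have [mu <- _] := product_power_prop n; exact: measure_ge0. Qed.

Let product_power_sigma_additive n : semi_sigma_additive (product_power n).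
Proof.
have [mu <- _] := product_power_prop n; exact: measure_semi_sigma_additive.
Qed.

HB.instance Definition _ n := isMeasure.Build _ _ _ (product_power n)
  (product_power0 n) (@product_power_ge0 n) (@product_power_sigma_additive n).

Let product_power_sigma_finite n : sigma_finite setT (product_power n).
Proof. by have [mu <- smu] := product_power_prop n. Qed.

HB.instance Definition _ n := Measure_isSigmaFinite.Build _ _ _
  (product_power n) (@product_power_sigma_finite n).

End product_power.

Arguments product_power {R d T} nu n _%_classical_set_scope.

Section normalized_lebesgue_measure.
Context {R : realType} {m : nat}.
Notation mtuple := (m.-tuple (measurableTypeR R)).

Definition row_of_tuple (t : mtuple) : borel 'rV[R]_m := \row_i tnth t i.

Definition lebesgue_rV : set (borel 'rV[R]_m) -> \bar R :=
  pushforward (product_power (@lebesgue_measure R) m) row_of_tuple.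

(* Lebesgue measure restricted to the ball, scaled so that the ball has measure
   1; \val @` A is A seen as a subset of R^m. *)
Definition Vm (A : set (borel (uball R m))) : \bar R :=
  ((fine (lebesgue_rV unit_ball))^-1)%:E * lebesgue_rV (\val @` A).

Lemma measurable_row_of_tuple :
  measurable_fun [set: mtuple] (row_of_tuple : mtuple -> borel 'rV[R]_m).
Proof.
apply: (@measurability _ _ _ (borel 'rV[R]_m) _ _ open) => // _ [W oW <-]; rewrite setTI.
pose B (p : 'rV[rat]_m * nat) : set 'rV[R]_m :=
  ball (map_mx ratr p.1 : 'rV[R]_m) p.2.+1%:R^-1.
have -> : W = \bigcup_p (if `[< B p `<=` W >] then B p else set0).
  apply/seteqP; split=> [v Wv|v [p _]]; last by case: asboolP => // + ?; exact.
  have /nbhs_ballP[e /= e0 eW] : nbhs v W by exact: open_nbhs_nbhs.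
  have [k] := ltr_add_invr (divr_gt0 e0 (@ltr0n R 2)); rewrite add0r => ke.
  have k0 : 0 < k.+1%:R^-1 :> R by rewrite invr_gt0.
  have /choice[q qv] (i : 'I_m) : exists r : rat,
      `|ratr r - v ord0 i| < k.+1%:R^-1.
    have [|r] := @rat_in_itvoo R (v ord0 i - k.+1%:R^-1) (v ord0 i + k.+1%:R^-1).
      by rewrite ltrD2l gtrN.
    by rewrite in_itv /= => rv; exists r; rewrite ltr_distl.
  have Bv : B (\row_i q i, k) v.
    by split=> // i j; rewrite !mxE (ord1 i) -ball_normE /=; exact: qv.
  exists (\row_i q i, k) => //; case: asboolP => // -[].
  apply: subset_trans eW => w Bw; rewrite (splitr e).
  apply: ball_triangle (_ : ball v _ (map_mx ratr (\row_i q i))) _.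
    by apply: ball_sym; apply: le_ball Bv; exact: ltW.
  by apply: le_ball Bw; exact: ltW.
rewrite preimage_bigcup; apply: countable_bigcupT_measurable => // p.
case: asboolP => _; last by rewrite preimage_set0.
rewrite (_ : _ @^-1` _ = \bigcap_(i in [set: 'I_m])
    (fun t : mtuple => tnth t i) @^-1` ball (ratr (p.1 ord0 i) : R) p.2.+1%:R^-1).
  apply: fin_bigcap_measurable => // i _; rewrite -[X in measurable X]setTI.
  by apply: measurable_tnth => //; exact: measurable_ball.
apply/seteqP; split=> [t [_ Bt] i _|t Bt].
  by have := Bt ord0 i; rewrite !mxE.
split=> [|i j]; first by rewrite invr_gt0.
by rewrite !mxE (ord1 i); exact: Bt.
Qed.

Let lebesgue_rV_measure : {mu : {measure set (borel 'rV[R]_m) -> \bar R} |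
  mu = lebesgue_rV :> (set _ -> \bar R)}.
Proof.
by exists (measure_function_pushforward__canonical__measure_function_Measure
  (product_power (@lebesgue_measure R) m) measurable_row_of_tuple).
Qed.

Let lebesgue_rV0 : lebesgue_rV set0 = 0%E.
Proof. by have [mu <-] := lebesgue_rV_measure; exact: measure0. Qed.

Let lebesgue_rV_ge0 A : (0 <= lebesgue_rV A)%E.
Proof. by have [mu <-] := lebesgue_rV_measure; exact: measure_ge0. Qed.

Let lebesgue_rV_sigma_additive : semi_sigma_additive lebesgue_rV.
Proof.
by have [mu <-] := lebesgue_rV_measure; exact: measure_semi_sigma_additive.
Qed.

HB.instance Definition _ := isMeasure.Build _ _ _ lebesgue_rV
  lebesgue_rV0 lebesgue_rV_ge0 lebesgue_rV_sigma_additive.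

Lemma continuous_sqnorm : continuous (@sqnorm R m).
Proof.
move=> v; apply: (@cvg_big _ _ _ _ _ _ _ (nbhs v)) => [|i _].
  exact: add_continuous.
apply: (@continuous_comp _ _ _ (fun x : 'rV[R]_m => x ord0 i) (fun y => y ^+ 2)).
  exact: coord_continuous.
exact: exprn_continuous.
Qed.

Lemma open_unit_ball : open (@unit_ball R m).
Proof.
rewrite (_ : unit_ball = @enorm R m @^-1` [set x | x < 1])//.
apply: open_comp => [v _|]; last exact: open_lt.
apply: (@continuous_comp _ _ _ (@sqnorm R m) Num.sqrt).
  exact: continuous_sqnorm.
exact: sqrt_continuous.
Qed.

Lemma measurable_val_image (A : set (borel (uball R m))) : measurable A ->
  measurable (\val @` A : set (borel 'rV[R]_m)).
Proof.
have valI : injective (val : uball R m -> 'rV[R]_m) by exact: val_inj.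
have mB : measurable (@unit_ball R m : set (borel 'rV[R]_m)).
  by apply: sub_sigma_algebra; exact: open_unit_ball.
pose G : set (set (uball R m)) :=
  [set A | measurable (\val @` A : set (borel 'rV[R]_m))].
suff GT : measurable `<=` (G : set (set (borel (uball R m)))) by move/GT.
apply: smallest_sub; rewrite /G; last first.
  move=> _ [W oW <-] /=; apply: sub_sigma_algebra.
  rewrite (_ : _ @` _ = W `&` unit_ball).
    by apply: openI => //; exact: open_unit_ball.
  apply/seteqP; split=> [_ [x Wx <-]|x [Wx xB]].
    by split=> //; case: x {Wx} => x xB; exact/set_mem.
  by exists (exist _ x (mem_set xB)).
split=> [|C mC|F mF] /=.
- by rewrite image_set0.
- rewrite setTD (_ : _ @` _ = unit_ball `\` (\val @` C)).
    exact: measurableD.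
  apply/seteqP; split=> [_ [x Ax <-]|x [xB Ax]].
    split; first by case: x {Ax} => x xB; exact/set_mem.
    by move=> [y Ay /valI yx]; apply: Ax; rewrite -yx.
  exists (exist _ x (mem_set xB)) => // Ax'; apply: Ax.
  by exists (exist _ x (mem_set xB)).
- by rewrite image_bigcup; exact: bigcupT_measurable.
Qed.

Let Vm0 : Vm set0 = 0%E.
Proof. by rewrite /Vm image_set0 measure0 mule0. Qed.

Let Vm_ge0 A : (0 <= Vm A)%E.
Proof.
by rewrite /Vm mule_ge0// lee_fin invr_ge0 fine_ge0//; exact: measure_ge0.
Qed.

Let Vm_sigma_additive : semi_sigma_additive Vm.
Proof.
move=> F mF tF mUF; rewrite /Vm image_bigcup.
under eq_fun do rewrite -ge0_sume_distrr//.
apply: cvgeZl => //; apply: measure_semi_sigma_additive.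
- by move=> i; exact: measurable_val_image.
- move=> i j _ _ [v [[x Fix <-] [y Fjy /val_inj yx]]].
  by apply: tF => //; exists x; split=> //; rewrite -yx.
- by apply: bigcupT_measurable => i; exact: measurable_val_image.
Qed.

HB.instance Definition _ := isMeasure.Build _ _ _ Vm
  Vm0 Vm_ge0 Vm_sigma_additive.

End normalized_lebesgue_measure.

Section hyperbolic_measure.
Context {R : realType} {m : nat}.

Definition mu_ball (A : set (borel (uball R m))) : \bar R :=
  (\int[Vm]_(x in A) ((1 - sqnorm (\val x)) ^- m)%:E)%E.

Let sqnorm_lt1 (x : uball R m) : sqnorm (\val x) < 1.
Proof.
case: x => x /= /set_mem; rewrite /unit_ball /= /enorm.
have x0 : 0 <= sqnorm x by rewrite sumr_ge0// => i _; exact: sqr_ge0.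
by rewrite -{1}sqrtr1 ltr_sqrt.
Qed.

Let measurable_density : measurable_fun [set: borel (uball R m)]
  (fun x : borel (uball R m) => ((1 - sqnorm (\val x)) ^- m)%:E).
Proof.
apply/measurable_EFinP; apply: (measurability _ (RGenOpens.measurableE R)).
move=> _ [_ [p [q ->]] <-]; have oW : open `]p, q[%classic by [].
rewrite setTI; apply: sub_sigma_algebra; apply: open_comp oW => x _.
have d0 : (1 - sqnorm (\val x)) ^+ m != 0.
  by rewrite expf_neq0// subr_eq0 gt_eqF.
suff c : {for x, continuous (fun x : uball R m => (1 - sqnorm (\val x)) ^+ m)}.
  exact: (cvgV d0 c).
apply: (@continuous_comp _ _ _
  (fun x : uball R m => 1 - sqnorm (\val x)) (fun y => y ^+ m)).
  apply: (@continuous_comp _ _ _ (fun x : uball R m => sqnorm (\val x))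
    (fun y => 1 - y)); last first.
    by apply: continuousB => ?; [exact: cst_continuous|exact: cvg_id].
  apply: (@continuous_comp (uball R m) _ _ \val (@sqnorm R m)).
    exact: initial_continuous.
  exact: continuous_sqnorm.
exact: exprn_continuous.
Qed.

Let density_ge0 (x : borel (uball R m)) :
  (0 <= ((1 - sqnorm (\val x)) ^- m)%:E)%E.
Proof. by rewrite lee_fin invr_ge0 exprn_ge0// subr_ge0 ltW. Qed.

Let mu_ball0 : mu_ball set0 = 0%E. Proof. exact: integral_set0. Qed.

Let mu_ball_ge0 A : (0 <= mu_ball A)%E.
Proof. by apply: integral_ge0 => x _; exact: density_ge0. Qed.

Let mu_ball_sigma_additive : semi_sigma_additive mu_ball.
Proof. exact: semi_sigma_additive_nng_induced. Qed.

HB.instance Definition _ := isMeasure.Build _ _ _ mu_ball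
  mu_ball0 mu_ball_ge0 mu_ball_sigma_additive.

End hyperbolic_measure.

Section H_harmonic.
Context {R : realType} {m : nat}.
Implicit Types (u : 'rV[R]_m -> R) (f : uball R m -> R[i]).

Definition partial (i : 'I_m) u : 'rV[R]_m -> R :=
  fun x => 'D_(delta_mx 0 i) u x.

Definition C2_on (U : set 'rV[R]_m) u :=
  forall x, U x -> [/\ {for x, continuous u},
    forall i, derivable u x (delta_mx 0 i) /\ {for x, continuous (partial i u)}
  & forall i j, derivable (partial i u) x (delta_mx 0 j) /\
      {for x, continuous (partial j (partial i u))}].

Definition hyp_laplacian u : 'rV[R]_m -> R := fun x =>
  (1 - sqnorm x) ^+ 2 * \sum_i partial i (partial i u) x +
  2 * (m%:R - 2) * (1 - sqnorm x) * \sum_i x 0 i * partial i u x.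

(* A function on the ball is differentiated through its extension by 0, which
   is harmless as the ball is open. *)
Definition re_ext f : 'rV[R]_m -> R := fun x => complex.Re (valL_ 0 f x).
Definition im_ext f : 'rV[R]_m -> R := fun x => complex.Im (valL_ 0 f x).

Definition H_harmonic : set (uball R m -> R[i]) :=
  [set f | [/\ C2_on unit_ball (re_ext f), C2_on unit_ball (im_ext f),
    forall x, unit_ball x -> hyp_laplacian (re_ext f) x = 0
  & forall x, unit_ball x -> hyp_laplacian (im_ext f) x = 0]].

End H_harmonic.

Section reproducing_kernel_hilbert_space.
Context {R : realType} {T : Type}.
Implicit Types (H : set (T -> R[i])) (f g : T -> R[i]) (K : T -> T -> R[i])
  (dot : (T -> R[i]) -> (T -> R[i]) -> R[i]).

Definition hnorm dot f : R := Num.sqrt (complex.Re (dot f f)).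

Definition hcvg dot (u : nat -> T -> R[i]) f :=
  hnorm dot (u n - f) @[n --> \oo] --> (0 : R).

(* A Hilbert space of functions is a carrier H together with an inner product
   dot, only meaningful on H, linear in its first argument. *)
Record is_hilbert_space H dot : Prop := {
  hilbert0 : H (fun=> 0);
  hilbertD : forall (c : R[i]) f g, H f -> H g -> H (fun x => c * f x + g x);
  hilbert_linear : forall (c : R[i]) f g h, H f -> H g -> H h ->
    dot (fun x => c * f x + g x) h = c * dot f h + dot g h;
  hilbert_conj : forall f g, H f -> H g -> dot g f = (dot f g)^*;
  hilbert_ge0 : forall f, H f -> 0 <= dot f f;
  hilbert_eq0 : forall f, H f -> dot f f = 0 -> f = fun=> 0;
  hilbert_complete : forall u : nat -> T -> R[i], (forall n, H (u n)) ->
    (forall e : R, 0 < e -> exists N, forall p q, (N <= p)%N -> (N <= q)%N ->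
       hnorm dot (u p - u q) < e) ->
    exists2 f, H f & hcvg dot u f }.

(* The kernel function at x, y |-> K(y, x). *)
Definition ksection K x : T -> R[i] := fun y => K y x.

Record is_rkhs H dot K : Prop := {
  rkhs_hilbert : is_hilbert_space H dot;
  rkhs_section : forall x, H (ksection K x);
  rkhs_reproducing : forall f x, H f -> f x = dot f (ksection K x) }.

Definition hseries dot (t : nat -> T -> R[i]) f :=
  hcvg dot (fun n => \sum_(0 <= k < n) t k) f.

End reproducing_kernel_hilbert_space.

Definition subexponential (R : realType) (L : nat -> R) :=
  forall alpha : R, 0 < alpha -> L t * expR (- alpha * t%:R) @[t --> \oo] --> (0 : R).

Definition locally_finite (E : topologicalType) (X : E -> nat) :=
  forall A : set E, precompact A -> finite_set (A `&` [set x | X x != 0%N]).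

(* A configuration is encoded by its multiplicity function. *)
Record Conf (E : topologicalType) := MkConf {
  mult :> E -> nat;
  mult_locally_finite : locally_finite mult }.

Section configurations.
Context (E : ptopologicalType).

Lemma locally_finite0 : locally_finite (fun _ : E => 0%N).
Proof.
by move=> A _; rewrite (_ : _ `&` _ = set0)// -subset0 => x [_ /eqP].
Qed.

HB.instance Definition _ := gen_eqMixin (Conf E).
HB.instance Definition _ := gen_choiceMixin (Conf E).
HB.instance Definition _ := isPointed.Build (Conf E) (MkConf locally_finite0).

(* The Borel structure of Conf E is generated by the numbers of points in
   relatively compact Borel sets; these are finite, so that the sum below is a
   genuine finite sum with multiplicities. *)
Definition count_cylinders : set (set (Conf E)) :=
  [set A | exists B : set (borel E), exists n : nat,
    [/\ measurable B, precompact (B : set E)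
      & A = [set X : Conf E | \sum_(x \in B) X x = n]]].

HB.instance Definition _ :=
  Measurable.copy (Conf E) (g_sigma_algebraType count_cylinders).

End configurations.

Section point_process.
Context {R : realType} {E : ptopologicalType}.
Implicit Types (Pi : probability (Conf E) R) (X : Conf E) (f : E -> R[i]).

(* Sum of h over the points of X with multiplicity, for h >= 0. *)
Definition nnsum X (h : E -> R) : \bar R :=
  (\esum_(x in [set: E]) ((X x)%:R * h x)%:E)%E.

Definition num_points (B : set E) X : \bar R := (\esum_(x in B) ((X x)%:R)%:E)%E.

Definition first_intensity Pi (B : set (borel E)) : \bar R :=
  (\int[Pi]_X num_points B X)%E.

(* Sums over X of real and complex functions; meaningful when the sum of the
   moduli is finite. *)
Definition rsum X (h : E -> R) : R :=
  fine (nnsum X h^\+) - fine (nnsum X h^\-).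

Definition csum X f : R[i] :=
  rsum X (fun x => complex.Re (f x)) +i* rsum X (fun x => complex.Im (f x)).

Definition cexpectation Pi (Z : Conf E -> R[i]) : R[i] :=
  fine ('E_Pi[fun X => complex.Re (Z X)]) +i*
  fine ('E_Pi[fun X => complex.Im (Z X)]).

Definition cvariance Pi (Z : Conf E -> R[i]) : \bar R :=
  'E_Pi[fun X => modulus (Z X - cexpectation Pi Z) ^+ 2].

(* As usual, the test functions f are Borel. *)
Definition small_variance Pi :=
  exists2 C : R, 0 < C & forall f,
    measurable_fun [set: borel E] (fun x : borel E => complex.Re (f x)) ->
    measurable_fun [set: borel E] (fun x : borel E => complex.Im (f x)) ->
    (\int[Pi]_X nnsum X (fun x => (modulus (f x) + modulus (f x) ^+ 2)%R) < +oo)%E ->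
    (cvariance Pi (csum^~ f) <=
       C%:E * \int[Pi]_X nnsum X (fun x => (modulus (f x) ^+ 2)%R))%E.

End point_process.

Section patterson_sullivan.
Context {R : realType} {m : nat}.
Implicit Types (X : Conf (uball R m)) (a x : uball R m) (s : R).

Definition shell a (k : nat) : set (uball R m) :=
  [set x | k%:R <= dh (\val a) (\val x) < k.+1%:R].

Definition weight s a x : R := expR (- s * dh (\val a) (\val x)).

(* X has finitely many points in each shell, so this is a finite sum. *)
Definition shell_sum s a X k (f : uball R m -> R[i]) : R[i] :=
  \sum_(x \in shell a k) (X x)%:R * (weight s a x)%:C * f x.

Definition kernel_shell_sum (K : uball R m -> uball R m -> R[i]) s a X k :
    uball R m -> R[i] :=
  fun y => shell_sum s a X k (fun x => ksection K x y).

Definition poincare s a X : \bar R := nnsum X (weight s a).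

End patterson_sullivan.

(* Main.v *)
Require Import Defs.
From HB Require Import structures.
From mathcomp Require Import all_boot all_order all_algebra.
From mathcomp Require Import all_classical all_reals all_analysis.
From mathcomp Require Import measurable_realfun complex.
From mathcomp Require Import ring lra.

Set Implicit Arguments.
Unset Strict Implicit.
Unset Printing Implicit Defensive.

Import Order.TTheory GRing.Theory Num.Theory numFieldNormedType.Exports.

Local Open Scope classical_set_scope.
Local Open Scope ring_scope.
Local Open Scope complex_scope.


(** The Poincare series P_n of a point process with intensity lambda mu and
    exponent s_n has a mean L_n = lambda G_n, where G_n is the integral of
    exp(- s_n d(a, x)) against the invariant measure. Functions of the Hilbert
    space are harmonic for the hyperbolic Laplacian, hence they have the mean
    value property over hyperbolic shells around a: the weighted sum F_n of the
    kernel functions has mean L_n K_a. So F_n / P_n is close to K_a as soon as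
    both F_n and P_n are concentrated around their means with respect to L_n.

    The mean value property is obtained without polar coordinates. Green's
    identity for a harmonic function u and a radial function U(p), where
    p(x) = |x - a|^2 / ((1 - |a|^2)(1 - |x|^2)) is the square of sinh(d / 2),
    says that u is orthogonal to the hyperbolic Laplacian of U(p)
    (green_identity). In the variable p that Laplacian is an ordinary
    differential operator, so u is orthogonal to all the radial weights of mean
    zero for a suitable density (integral_test_fun_eq0); the integrals of u
    against radial weights are therefore proportional to the integrals of 1,
    and weights concentrated at a give the factor u(a) (mean_value_test_fun,
    mean_value_shell). With u = 1 the same argument computes the volume of
    shells, hence the finiteness of G_n and its lower bound of order
    1 / (s_n - m + 1) (integral_weight_lty, integral_weight_ge).

    Concentration comes from the small variance inequality, applied to the
    coordinates of the statistics in an orthonormal basis and summed by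
    Parseval's identity (parseval, centered_variance): the expected squared
    distance of F_n to L_n K_a is at most a constant times the integral of
    exp(- 2 s_n d(a, x)) K(x, x), which the integral of
    K(x, x) (1 - |x|^2)^(s_n - 1) dominates (integral_weight_kernel). After
    division by L_n^2, which is at least of order (s_n - m + 1)^(-2), the
    summability hypothesis on s_n is exactly what makes these expectations
    summable, so that the normalised deviations tend to 0 almost surely. The
    same applies to P_n, whose variance is bounded (poincare_variance,
    relative_variance): unless the kernel vanishes, the summability hypothesis
    implies that the sum of (s_n - m + 1)^2 is finite (ae_ratio_summable).

    For a fixed n, the norms of the shell sums are summable almost surely, as
    the gap between s_n and m - 1 leaves a geometric factor that converts the
    second moments into first moments (ae_shell_norms_summable). The statement
    on functions follows from the one on kernels by the reproducing property. *)

(** * Iterated Lebesgue integrals *)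

Section product_power_theory.
Context {R : realType}.
Notation leb := (@lebesgue_measure R).
Notation mtuple n := (n.-tuple (measurableTypeR R)).

Lemma measurable_cons_pair n : measurable_fun setT
  (fun p : measurableTypeR R * mtuple n => [tuple of p.1 :: p.2]).
Proof. exact: measurable_cons. Qed.

Lemma measurable_cons_section n (x : measurableTypeR R) :
  measurable_fun setT (fun t : mtuple n => [tuple of x :: t]).
Proof. exact: measurable_cons. Qed.

Definition box n (A : 'I_n -> set R) : set (mtuple n) :=
  [set t | forall j, A j (tnth t j)].

Lemma measurable_box n (A : 'I_n -> set (measurableTypeR R)) :
  (forall j, measurable (A j)) -> measurable (box A).
Proof.
move=> mA; have -> : box A = \bigcap_(i in [set: 'I_n])
    (fun t : mtuple n => tnth t i) @^-1` A i.
  by apply/seteqP; split=> t /= h i; [move=> _; exact: h|exact: h].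
apply: fin_bigcap_measurable => // i _.
by rewrite -[X in measurable X]setTI; exact: measurable_tnth.
Qed.

Lemma product_power_box n (A : 'I_n -> set (measurableTypeR R)) :
  (forall j, measurable (A j)) ->
  product_power leb n (box A) = (\big[*%E/1%E]_(j < n) leb (A j))%E.
Proof.
elim: n A => [|n IH] A mA.
  rewrite big_ord0 /= /dirac indicE mem_set//=.
  by case=> j /[dup] + j0; rewrite ltn0.
rewrite big_ord_recl /= /pushforward.
rewrite -IH// -product_measure1E//; last exact: measurable_box.
congr ((_ \x _)%E _); apply/seteqP; split => -[x t] /=.
  move=> h; split => [|j]; first by have := h ord0; rewrite tnth0.
  by have := h (lift ord0 j); rewrite tnthS.
move=> [h0 hS] j; have [->|j0] := eqVneq j ord0; first by rewrite tnth0.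
by case: (unliftP ord0 j) j0 => [k ->|-> /eqP//] _; rewrite tnthS.
Qed.

Definition cube n (r : R) : set (mtuple n) := [set t | forall j, `|tnth t j| <= r].
Arguments cube : clear implicits.

Lemma cubeE n r : cube n r = box (fun=> `[-r, r]%classic).
Proof.
by apply/seteqP; split=> t h j; have := h j; rewrite /= in_itv/= ler_norml.
Qed.

Lemma measurable_cube n r : measurable (cube n r).
Proof. by rewrite cubeE; exact: measurable_box. Qed.

Lemma product_power_cube_lty n r : (product_power leb n (cube n r) < +oo)%E.
Proof.
rewrite cubeE product_power_box//.
suff /andP[] : (0 <= \big[*%E/1%E]_(j < n) leb `[(- r)%R, r] < +oo)%E by [].
elim/big_ind : _ => [|x y /andP[x0 xoo] /andP[y0 yoo]|i _].
- by rewrite lee01 ltry.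
- by rewrite mule_ge0//= lte_mul_pinfty// ge0_fin_numE.
- rewrite measure_ge0/= lebesgue_measure_itv/=.
  by case: ifP => // _; rewrite -?EFinB ltry.
Qed.

End product_power_theory.
Arguments cube {R} n r.

Section divergence.
Context {R : realType}.
Notation leb := (@lebesgue_measure R).
Notation mtuple n := (n.-tuple (measurableTypeR R)).

Lemma integral_derive_compact_support (f g : R -> R) (r : R) : 0 <= r ->
  (forall y : R, is_derive y 1 f (g y)) -> continuous g ->
  (forall y, r < `|y| -> f y = 0 /\ g y = 0) ->
  (\int[leb]_y (g y)%:E = 0)%E.
Proof.
move=> r0 fg cg fg0; pose s := r + 1.
have rs : r < s by rewrite ltrDl.
have s0 : 0 < s by rewrite (le_lt_trans r0).
have fc y : {for y, continuous f}.
  by apply: differentiable_continuous; apply/derivable1_diffP; case: (fg y).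
transitivity (\int[leb]_(y in `[(- s)%R, s]) (g y)%:E)%E.
  rewrite [RHS]integral_mkcond; apply: eq_integral => y _.
  rewrite patchE; case: ifPn => //; rewrite notin_setE/= in_itv/= -ler_norml.
  by move/negP; rewrite -ltNge => sy; have [|_ ->] := fg0 y; first exact: lt_trans sy.
rewrite (@continuous_FTC2 _ g f).
- have [|-> _] := fg0 s; first by rewrite gtr0_norm.
  have [|-> _] := fg0 (- s); first by rewrite normrN gtr0_norm.
  by rewrite -EFinB subrr.
- by rewrite gtrN.
- exact: continuous_subspaceT.
- split=> [y _||]; first by case: (fg y).
  + by apply: cvg_at_right_filter; exact: fc.
  + by apply: cvg_at_left_filter; exact: fc.
- by move=> y _; rewrite derive1E; case: (fg y).
Qed.

Lemma integral_product_power_cons n (G : mtuple n.+1 -> R) :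
  measurable_fun setT G ->
  (product_power leb n.+1).-integrable setT (EFin \o G) ->
  (leb \x product_power leb n)%E.-integrable setT
    (fun p => (G [tuple of p.1 :: p.2])%:E) /\
  (\int[product_power leb n.+1]_t (G t)%:E =
   \int[leb \x product_power leb n]_p (G [tuple of p.1 :: p.2])%:E)%E.
Proof.
move=> mG /integrableP[_ iG].
have mGE : measurable_fun setT (EFin \o G) by exact/measurable_EFinP.
have mf := @measurable_cons_pair R n.
have iGf : (leb \x product_power leb n)%E.-integrable setT
    (fun p => (G [tuple of p.1 :: p.2])%:E).
  apply/integrableP; split.
    by apply/measurable_EFinP; exact: measurableT_comp.
  apply: le_lt_trans iG.
  rewrite (@ge0_integral_pushforward _ _ _ _ R _ mf
    (leb \x product_power leb n)%E setT (fun t => `|(G t)%:E|)%E)//.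
  by apply: measurableT_comp mGE => //; exact: abse_measurable.
split=> //.
by rewrite (@integral_pushforward _ _ _ _ R _ mf
    (leb \x product_power leb n)%E setT (EFin \o G)).
Qed.

Definition tset n (t : mtuple n) (i : 'I_n) (y : R) : mtuple n :=
  [tuple (if j == i then y else tnth t j) | j < n].

Lemma tset0 n (x y : R) (t : mtuple n) :
  tset [tuple of x :: t] ord0 y = [tuple of y :: t].
Proof.
apply: eq_from_tnth => j; rewrite tnth_mktuple.
by case: (unliftP ord0 j) => [k ->|->]; rewrite ?tnthS ?tnth0.
Qed.

Lemma tsetS n (x y : R) (t : mtuple n) i :
  tset [tuple of x :: t] (lift ord0 i) y = [tuple of x :: tset t i y].
Proof.
apply: eq_from_tnth => j; rewrite tnth_mktuple.
case: (unliftP ord0 j) => [k ->|->]; rewrite ?tnthS ?tnth0 ?tnth_mktuple//.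
Qed.

Lemma bounded_cube_integrable n (G : mtuple n -> R) (M r : R) :
  measurable_fun setT G -> (forall t, `|G t| <= M) ->
  (forall t, ~ cube n r t -> G t = 0) ->
  (product_power leb n).-integrable setT (EFin \o G).
Proof.
move=> mG GM G0.
have -> : EFin \o G = (EFin \o G) \_ (cube n r).
  apply/funext => t; rewrite patchE/=; case: ifPn => //.
  by rewrite notin_setE => /G0 ->.
rewrite -integrable_mkcond; last exact: measurable_cube.
apply: measurable_bounded_integrable.
- exact: measurable_cube.
- exact: product_power_cube_lty.
- exact: measurable_funTS.
- exists M; split; first by rewrite num_real.
  by move=> y My t _ /=; rewrite (le_trans (GM t))// ltW.
Qed.

(** Fubini reduces to one variable: if the differentiated coordinate is the
    first one, integrate it out first, otherwise freeze the first coordinate. *)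
Lemma integral_partial_compact_support n (i : 'I_n) (F G : mtuple n -> R) (M r : R) :
  0 <= r -> measurable_fun setT G -> (forall t, `|G t| <= M) ->
  (forall t, ~ cube n r t -> F t = 0 /\ G t = 0) ->
  (forall t (y : R), is_derive y 1 (fun z => F (tset t i z)) (G (tset t i y))) ->
  (forall t, continuous (fun z => G (tset t i z))) ->
  (\int[product_power leb n]_t (G t)%:E = 0)%E.
Proof.
elim: n i F G => [[]//|n IH] i F G r0 mG GM FG0 dF cG.
have [iG ->] := integral_product_power_cons mG
  (bounded_cube_integrable mG GM (fun t h => (FG0 t h).2)).
have ncube (x : R) (t : mtuple n) : ~ cube n r t -> ~ cube n.+1 r [tuple of x :: t].
  by apply: contra_not => h j; have := h (lift ord0 j); rewrite tnthS.
case: (unliftP ord0 i) => [k ik|i0].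
  rewrite -(integral12_prod_meas1 iG) /fubini_F/=.
  rewrite integral0_eq// => x _.
  apply: (IH k (fun t => F [tuple of x :: t]) (fun t => G [tuple of x :: t])) => //.
  - by apply: measurableT_comp => //; exact: measurable_cons_section.
  - by move=> t /(ncube x); exact: FG0.
  - move=> t y; have := dF [tuple of x :: t] y; rewrite ik tsetS.
    by under eq_fun do rewrite tsetS.
  - move=> t; have := cG [tuple of x :: t]; rewrite ik.
    by under eq_fun do rewrite tsetS.
rewrite -(integral21_prod_meas1 iG) /fubini_G/=.
rewrite integral0_eq// => t _.
apply: (@integral_derive_compact_support (fun x => F [tuple of x :: t])
  (fun x => G [tuple of x :: t]) r) => //.
- move=> y; have := dF [tuple of y :: t] y; rewrite i0 tset0.
  by under eq_fun do rewrite tset0.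
- have := cG [tuple of 0 :: t]; rewrite i0.
  by under eq_fun do rewrite tset0.
- move=> y ry; apply: FG0 => /(_ ord0); rewrite tnth0.
  by rewrite leNgt ry.
Qed.

End divergence.

Section standard_machine.
Context {R : realType} d (T : measurableType d).
Import HBNNSimple.
Local Open Scope ereal_scope.

(** Indicators generate all non-negative measurable functions under positive
    linear combinations and increasing limits. *)
Lemma ge0_measurable_fun_ind (P : (T -> \bar R) -> Prop) :
  (forall A, measurable A -> P (fun x => (\1_A x)%:E)) ->
  (forall (k : R) f, (0 <= k)%R -> measurable_fun setT f ->
    (forall x, 0 <= f x) -> P f -> P (fun x => k%:E * f x)) ->
  (forall f g, measurable_fun setT f -> measurable_fun setT g ->
    (forall x, 0 <= f x) -> (forall x, 0 <= g x) ->
    P f -> P g -> P (fun x => f x + g x)) ->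
  (forall (f : (T -> \bar R)^nat), (forall n, measurable_fun setT (f n)) ->
    (forall n x, 0 <= f n x) ->
    (forall x, {homo f^~ x : n m / (n <= m)%N >-> n <= m}) ->
    (forall n, P (f n)) -> P (fun x => limn (f^~ x))) ->
  forall f, measurable_fun setT f -> (forall x, 0 <= f x) -> P f.
Proof.
move=> Pind PZ PD Plim f mf f0.
have m1 A (y : R) : measurable A -> measurable_fun setT (fun x : T => (y * \1_A x)%:E).
  by move=> mA; apply/measurable_EFinP; apply: measurable_funM => //; exact: measurable_indic.
have P1 A (y : R) : measurable A -> (0 <= y)%R -> P (fun x => (y * \1_A x)%:E).
  move=> mA y0; under eq_fun do rewrite EFinM.
  apply: PZ => //; last exact: Pind.
  by apply/measurable_EFinP; exact: measurable_indic.
have Psum (s : seq R) (A : R -> set T) : (forall y, measurable (A y)) ->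
    (forall y, y \in s -> 0 <= y)%R ->
    P (fun x => \sum_(y <- s) (y * \1_(A y) x)%:E).
  move=> mA; elim: s => [|y s IH] s0.
    under eq_fun do rewrite big_nil.
    have := Pind _ (@measurable0 _ T).
    by under eq_fun do rewrite indicE in_set0.
  have y0 : (0 <= y)%R by apply: s0; rewrite mem_head.
  have s'0 z : z \in s -> (0 <= z)%R by move=> zs; apply: s0; rewrite inE zs orbT.
  under eq_fun do rewrite big_cons.
  apply: PD.
  - exact: m1.
  - by apply: emeasurable_sum => z; exact: m1.
  - by move=> x; rewrite lee_fin mulr_ge0.
  - move=> x; rewrite big_seq sume_ge0// => z /s'0 z0.
    by rewrite lee_fin mulr_ge0.
  - exact: P1.
  - exact: IH.
have Psf (g : {nnsfun T >-> R}) : P (EFin \o g).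
  have -> : EFin \o g = fun x => \sum_(y <- finmap.enum_fset (fset_set (range g)))
      (y * \1_(g @^-1` [set y]) x)%:E.
    apply/funext => x /=; rewrite [in LHS]fimfunE fsbig_finite//=.
    by rewrite sumEFin.
  by apply: Psum => // y; rewrite in_fset_set// inE => -[x _ <-].
pose f_ := nnsfun_approx measurableT mf.
have -> : f = fun x => limn (fun n => EFin (f_ n x)).
  apply/funext => x; apply/esym/cvg_lim => //=.
  exact: cvg_nnsfun_approx.
apply: (Plim (fun n => EFin \o f_ n)) => //.
- by move=> n; exact/measurable_EFinP.
- by move=> n x; rewrite lee_fin.
- by move=> x m n mn; rewrite lee_fin; exact/lefP/nd_nnsfun_approx.
Qed.

Lemma ge0_functional_eq_integral (mu : {measure set T -> \bar R})
    (I : (T -> \bar R) -> \bar R) :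
  (forall A, measurable A -> I (fun x => (\1_A x)%:E) = mu A) ->
  (forall (k : R) f, (0 <= k)%R -> measurable_fun setT f ->
    (forall x, 0 <= f x) -> I (fun x => k%:E * f x) = k%:E * I f) ->
  (forall f g, measurable_fun setT f -> measurable_fun setT g ->
    (forall x, 0 <= f x) -> (forall x, 0 <= g x) ->
    I (fun x => f x + g x) = I f + I g) ->
  (forall (f : (T -> \bar R)^nat), (forall n, measurable_fun setT (f n)) ->
    (forall n x, 0 <= f n x) ->
    (forall x, {homo f^~ x : n m / (n <= m)%N >-> n <= m}) ->
    I (fun x => limn (f^~ x)) = limn (fun n => I (f n))) ->
  forall f, measurable_fun setT f -> (forall x, 0 <= f x) ->
  I f = \int[mu]_x f x.
Proof.
move=> Iind IZ ID Ilim.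
apply: (ge0_measurable_fun_ind (P := fun f => I f = \int[mu]_x f x)).
- by move=> A mA; rewrite Iind// integral_indic// setIT.
- by move=> k f k0 mf f0 If; rewrite IZ// If ge0_integralZl.
- by move=> f g mf mg f0 g0 If Ig; rewrite ID// If Ig ge0_integralD.
- move=> f mf f0 ndf If; rewrite Ilim// monotone_convergence//.
  by congr (limn _); apply/funext => n; exact: If.
Qed.

Lemma ge0_integral_density (mu nu : {measure set T -> \bar R}) (h : T -> R) :
  measurable_fun setT h -> (forall x, 0 <= h x)%R ->
  (forall A, measurable A -> nu A = \int[mu]_(x in A) (h x)%:E) ->
  forall f, measurable_fun setT f -> (forall x, 0 <= f x) ->
  \int[nu]_x f x = \int[mu]_x (f x * (h x)%:E).
Proof.
move=> mh' h0 nuE f mf f0; have mh : measurable_fun setT (EFin \o h) by exact/measurable_EFinP.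
apply/esym.
apply: (ge0_functional_eq_integral (I := fun f => \int[mu]_x (f x * (h x)%:E))) => //.
- move=> A mA; rewrite nuE// [RHS]integral_mkcond; apply: eq_integral => x _.
  by rewrite patchE indicE; case: ifPn; rewrite ?mul1e ?mul0e.
- move=> k g k0 mg g0; under eq_integral do rewrite -muleA.
  rewrite ge0_integralZl//; first exact: emeasurable_funM.
  by move=> x _; rewrite mule_ge0// lee_fin.
- move=> g1 g2 mg1 mg2 g10 g20.
  under eq_integral do rewrite ge0_muleDl//.
  rewrite ge0_integralD//; try exact: emeasurable_funM.
  + by move=> x _; rewrite mule_ge0// lee_fin.
  + by move=> x _; rewrite mule_ge0// lee_fin.
- move=> g mg g0 ndg; rewrite -monotone_convergence//.
  + apply: eq_integral => x _; apply/esym/cvg_lim => //.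
    apply: cvgeZr => //; apply: ereal_nondecreasing_is_cvgn; exact: ndg.
  + by move=> n; exact: emeasurable_funM.
  + by move=> n x _; rewrite mule_ge0// lee_fin.
  + by move=> x _ m n mn; rewrite lee_wpmul2r ?lee_fin// ndg.
Qed.
End standard_machine.
(** * Lebesgue measure on row vectors *)

Section borel_continuity.
Context {R : realType} {E : ptopologicalType}.

Lemma open_borel_measurable (U : set E) : open U -> measurable (U : set (borel E)).
Proof. exact: sub_sigma_algebra. Qed.

Lemma closed_borel_measurable (U : set E) : closed U -> measurable (U : set (borel E)).
Proof.
by move=> cU; rewrite -(setCK U); apply: measurableC; apply: open_borel_measurable; rewrite openC.
Qed.

Lemma within_open_borel_measurable (U : set E) (f : E -> R) : open U ->
  {in U, continuous f} -> measurable_fun (U : set (borel E)) (f : borel E -> R).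
Proof.
move=> oU cf; apply: (measurability _ (RGenOpens.measurableE R)).
move=> _ [_ [p [q ->]] <-]; apply: open_borel_measurable.
rewrite openE => x [Ux fx].
apply: filterI; first by apply: open_nbhs_nbhs; split.
by apply: (cf x); [exact: mem_set|apply: open_nbhs_nbhs; split => //].
Qed.

Lemma continuous_borel_measurable (f : E -> R) :
  continuous f -> measurable_fun setT (f : borel E -> R).
Proof.
move=> cf; apply: within_open_borel_measurable; first exact: openT.
by move=> x _; exact: cf.
Qed.

End borel_continuity.

Lemma is_derive_line (R : realType) (V : normedModType R) (f : V -> R) (c v : V)
    (y df : R) :
  is_derive (y *: v + c) v f df ->
  is_derive y (1 : R) (fun z => f (z *: v + c)) df.
Proof.
set g := (fun z => _).
have E : (fun h : R => h^-1 *: ((g \o shift y) (h *: (1 : R)) - g y)) =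
    (fun h => h^-1 *: ((f \o shift (y *: v + c)) (h *: v) - f (y *: v + c))).
  apply/funext => h; rewrite /g /= /shift/=; congr (_ *: (f _ - _)).
  by rewrite addrA -scalerDl /GRing.scale/= mulr1.
case=> df1 df2; split; first by rewrite /derivable E.
by rewrite -df2 /derive E.
Qed.

Section lebesgue_rV_theory.
Context {R : realType} {m : nat}.
Notation leb := (@lebesgue_measure R).
Notation mtuple n := (n.-tuple (measurableTypeR R)).

Definition rcube (r : R) : set 'rV[R]_m := [set v | forall j, `|v ord0 j| <= r].

Lemma compact_rcube r : compact (rcube r).
Proof.
have -> : rcube r = [set v | forall j, `[- r, r]%classic (v ord0 j)].
  by apply/seteqP; split=> v h j; have := h j; rewrite /= in_itv/= ler_norml.
apply: (@rV_compact R^o m (fun=> `[- r, r]%classic)) => _; exact: segment_compact.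
Qed.

Lemma row_of_tuple_cube r : row_of_tuple @^-1` (rcube r) = cube m r.
Proof.
by apply/seteqP; split=> t h j; have := h j; rewrite !mxE.
Qed.

Lemma lebesgue_rV_rcube_lty r : (lebesgue_rV (rcube r) < +oo)%E.
Proof.
by rewrite /lebesgue_rV /pushforward row_of_tuple_cube product_power_cube_lty.
Qed.

Lemma measurable_rcube r : measurable (rcube r : set (borel 'rV[R]_m)).
Proof.
apply: closed_borel_measurable; apply: compact_closed; last exact: compact_rcube.
exact: norm_hausdorff.
Qed.

(** The divergence theorem has no boundary term as F vanishes outside a cube. *)
Lemma integral_partial_eq0 (i : 'I_m) (F : 'rV[R]_m -> R) (r : R) : 0 <= r ->
  (forall x, derivable F x (delta_mx ord0 i)) -> continuous (partial i F) ->
  (forall x, ~ rcube r x -> F x = 0 /\ partial i F x = 0) ->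
  lebesgue_rV.-integrable setT (EFin \o partial i F : borel 'rV[R]_m -> \bar R) /\
  (\int[lebesgue_rV]_x (partial i F x)%:E = 0)%E.
Proof.
move=> r0 dF cF F0.
have [M FM] : exists M, forall x, `|partial i F x| <= M.
  have := continuous_compact (continuous_subspaceT cF) (@compact_rcube r).
  move=> /compact_bounded[M [_ /(_ (M + 1))]]; rewrite ltrDl ltr01 => /(_ isT) h.
  exists `|M + 1| => x; have [xr|/F0[_ ->]] := pselect (rcube r x).
    by apply: (le_trans _ (ler_norm _)); apply: h; exists x.
  by rewrite normr0.
pose G t := partial i F (row_of_tuple t).
have mP : measurable_fun setT (partial i F : borel 'rV[R]_m -> R).
  exact: continuous_borel_measurable.
have mG : measurable_fun setT G.
  exact: measurableT_comp mP (@measurable_row_of_tuple R m).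
have rowt (t : mtuple m) y : row_of_tuple (tset t i y) =
    y *: delta_mx ord0 i + row_of_tuple (tset t i 0).
  apply/rowP => j; rewrite !mxE !tnth_mktuple eqxx/=.
  by case: eqP => _; rewrite ?mulr1 ?addr0 ?mulr0 ?add0r.
have G0 t : ~ cube m r t -> F (row_of_tuple t) = 0 /\ G t = 0.
  by rewrite -row_of_tuple_cube => /F0.
have iG : (product_power leb m).-integrable setT (EFin \o G).
  apply: (bounded_cube_integrable (M := M) (r := r)) => //.
  - by move=> t; exact: FM.
  - by move=> t /G0[].
have mPE : measurable_fun setT (EFin \o partial i F : borel 'rV[R]_m -> \bar R).
  exact/measurable_EFinP.
split.
  apply: (@integrable_pushforward _ _ _ _ R _ (@measurable_row_of_tuple R m)
    (product_power leb m)) => //.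
rewrite (@integral_pushforward _ _ _ _ R _ (@measurable_row_of_tuple R m)
    (product_power leb m) setT (EFin \o partial i F)) ?preimage_setT//.
apply: (@integral_partial_compact_support R m i (F \o row_of_tuple) G M r) => //.
- by move=> t; exact: FM.
- move=> t y /=.
  have /derivableP := dF (row_of_tuple (tset t i y)).
  rewrite /G /partial rowt => /is_derive_line.
  by under eq_fun do rewrite -rowt.
- move=> t; have -> : (fun z => G (tset t i z)) = partial i F \o
      (fun z : R => z *: delta_mx ord0 i + row_of_tuple (tset t i 0)).
    by apply/funext => z; rewrite /G rowt.
  move=> y; apply: continuous_comp; last exact: cF.
  apply: cvgD; last exact: cvg_cst.
  by apply: cvgZr_tmp; exact: cvg_id.
Qed.
End lebesgue_rV_theory.

Section lebesgue_rV_sets.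
Context {R : realType} {m : nat}.
Notation leb := (@lebesgue_measure R).

Lemma lebesgue_rV_open_gt0 (U : set 'rV[R]_m) : open U -> U !=set0 ->
  (0 < lebesgue_rV U)%E.
Proof.
move=> oU [v Uv]; have /nbhs_ballP[e /= e0 eU] : nbhs v U by exact: open_nbhs_nbhs.
pose A (j : 'I_m) : set R := `]v ord0 j - e, v ord0 j + e[%classic.
have : (0 < product_power leb m (box A))%E.
  rewrite product_power_box// => [|j]; last exact: measurable_itv.
  apply: (big_ind (fun x : \bar R => 0 < x)%E) => [|x y x0 y0|j _].
  - by rewrite lte01.
  - by rewrite mule_gt0.
  - rewrite lebesgue_measure_itv/= lte_fin ler_ltD// ?gtrN//.
    by rewrite -EFinB lte_fin opprD addrACA subrr add0r opprK addr_gt0.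
move/lt_le_trans; apply.
rewrite /lebesgue_rV /pushforward le_measure// ?inE.
- by apply: measurable_box => j; exact: measurable_itv.
- rewrite -[X in measurable X]setTI; apply: measurable_row_of_tuple => //.
  exact: open_borel_measurable.
move=> t At; apply: eU; split=> // i j; rewrite (ord1 i) mxE -ball_normE/=.
have := At j; rewrite /A/= in_itv/= => /andP[].
by rewrite ltr_distlC => -> ->.
Qed.

Lemma lebesgue_rV_set1 (v : 'rV[R]_m) : (0 < m)%N -> lebesgue_rV [set v] = 0%E.
Proof.
move=> m0; rewrite /lebesgue_rV /pushforward.
have -> : row_of_tuple @^-1` [set v] = box (fun j => [set v ord0 j]).
  apply/seteqP; split=> t /=.
    by move=> <- j /=; rewrite mxE.
  by move=> h; apply/rowP => j; rewrite mxE h.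
rewrite product_power_box => [|j]; last exact: measurable_set1.
case: m m0 v => // n _ v.
by rewrite big_ord_recl /= lebesgue_measure_set1 mul0e.
Qed.

Lemma sqnorm_ge0 (x : 'rV[R]_m) : 0 <= sqnorm x.
Proof. by rewrite sumr_ge0// => i _; exact: sqr_ge0. Qed.

Lemma unit_ballE (x : 'rV[R]_m) : unit_ball x = (sqnorm x < 1) :> Prop.
Proof.
by rewrite /unit_ball/= /enorm -{1}sqrtr1 ltr_sqrt.
Qed.

Lemma coord_le_sqnorm (x : 'rV[R]_m) i : x ord0 i ^+ 2 <= sqnorm x.
Proof.
by rewrite /sqnorm (bigD1 i)//= lerDl sumr_ge0// => j _; exact: sqr_ge0.
Qed.

Lemma unit_ball_rcube : @unit_ball R m `<=` rcube 1.
Proof.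
move=> x; rewrite unit_ballE => x1 i; rewrite -(@ler_sqr R) ?nnegrE// real_normK ?num_real//.
by rewrite expr1n (le_trans (coord_le_sqnorm x i))// ltW.
Qed.

Lemma measurable_unit_ball : measurable (@unit_ball R m : set (borel 'rV[R]_m)).
Proof. by apply: open_borel_measurable; exact: open_unit_ball. Qed.

Lemma lebesgue_rV_unit_ball_lty : (lebesgue_rV (@unit_ball R m) < +oo)%E.
Proof.
apply: (@le_lt_trans _ _ (lebesgue_rV (@rcube R m 1))); last exact: lebesgue_rV_rcube_lty.
apply: le_measure; rewrite ?inE.
- exact: measurable_unit_ball.
- exact: measurable_rcube.
- exact: unit_ball_rcube.
Qed.

Definition ball_scale : R := (fine (lebesgue_rV (@unit_ball R m)))^-1.

Lemma ball_scale_gt0 : 0 < ball_scale.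
Proof.
rewrite /ball_scale invr_gt0 fine_gt0// lebesgue_rV_unit_ball_lty andbT.
apply: lebesgue_rV_open_gt0; first exact: open_unit_ball.
by exists 0; have := @unit_ball0 R m; rewrite inE.
Qed.

Lemma sqnorm_uball (x : uball R m) : sqnorm (\val x) < 1.
Proof. by case: x => x /= /set_mem; rewrite unit_ballE. Qed.

Lemma continuous_uball_val : continuous (\val : uball R m -> 'rV[R]_m).
Proof. exact: initial_continuous. Qed.

Lemma measurable_uball_val :
  measurable_fun setT (\val : borel (uball R m) -> borel 'rV[R]_m).
Proof.
apply: (@measurability _ _ _ (borel 'rV[R]_m) _ _ open) => // _ [W oW <-].
rewrite setTI; apply: open_borel_measurable; apply: open_comp oW => x _.
exact: continuous_uball_val.
Qed.

Lemma uball_val_image (A : set 'rV[R]_m) :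
  \val @` (\val @^-1` A : set (uball R m)) = A `&` unit_ball.
Proof.
apply/seteqP; split=> [_ [x Ax <-]|x [Ax xB]].
  by split=> //; rewrite unit_ballE; exact: sqnorm_uball.
by exists (exist _ x (mem_set xB)).
Qed.

Notation rball := (@unit_ball R m : set (borel 'rV[R]_m)).

Lemma ge0_integral_Vm (h : borel 'rV[R]_m -> \bar R) :
  measurable_fun rball h -> (forall v, unit_ball v -> 0 <= h v)%E ->
  (\int[Vm]_x h (\val x) = ball_scale%:E * \int[lebesgue_rV]_(v in rball) h v)%E.
Proof.
move=> mh h0; have mB := measurable_unit_ball.
have BT : \val @^-1` (@unit_ball R m) = [set: uball R m].
  by apply/seteqP; split=> // x _; rewrite /preimage/= unit_ballE; exact: sqnorm_uball.
have := @ge0_integral_pushforward _ _ _ _ R _ measurable_uball_val Vm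
  rball h mB mh.
rewrite BT => <-; last by move=> v; rewrite inE; exact: h0.
have c0 : 0 <= ball_scale by rewrite ltW// ball_scale_gt0.
rewrite -[RHS](@ge0_integral_mscale _ _ _ lebesgue_rV rball mB (NngNum c0))//.
apply: (@eq_measure_integral _ _ _ _ _
  (measure_function_pushforward__canonical__measure_function_Measure
    Vm measurable_uball_val)) => A mA AB.
by rewrite /= /pushforward /Vm uball_val_image (setIidl AB).
Qed.

End lebesgue_rV_sets.

Section mu_ball_integral.
Context {R : realType} {m : nat}.
Notation rball := (@unit_ball R m : set (borel 'rV[R]_m)).

Lemma continuous_1Bsqnorm : continuous (fun x : 'rV[R]_m => 1 - sqnorm x).
Proof.
move=> x; apply: (@continuous_comp _ _ _ (@sqnorm R m) (fun y => 1 - y)).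
  exact: continuous_sqnorm.
by apply: continuousB => ?; [exact: cst_continuous|exact: cvg_id].
Qed.

Lemma uball_1Bsqnorm_gt0 (x : uball R m) : 0 < 1 - sqnorm (\val x).
Proof. by rewrite subr_gt0; exact: sqnorm_uball. Qed.

Lemma uball_continuous_measurable (g : 'rV[R]_m -> R) :
  (forall v, unit_ball v -> {for v, continuous g}) ->
  measurable_fun setT (fun x : borel (uball R m) => g (\val x)).
Proof.
move=> cg; apply: (@continuous_borel_measurable R (uball R m) (fun x => g (\val x))) => x.
apply: continuous_comp; first exact: continuous_uball_val.
by apply: cg; rewrite unit_ballE; exact: sqnorm_uball.
Qed.

Lemma continuous_density (v : 'rV[R]_m) : unit_ball v ->
  {for v, continuous (fun x => (1 - sqnorm x) ^- m)}.
Proof.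
rewrite unit_ballE => v1; apply: (@cvgV _ _ (nbhs v) _ (fun x => (1 - sqnorm x) ^+ m)).
  by rewrite expf_neq0// subr_eq0 gt_eqF.
apply: (@continuous_comp _ _ _ (fun x : 'rV[R]_m => 1 - sqnorm x) (fun y => y ^+ m)).
  exact: continuous_1Bsqnorm.
exact: exprn_continuous.
Qed.

Lemma ge0_integral_mu_ball (g : borel (uball R m) -> \bar R) :
  measurable_fun setT g -> (forall x, 0 <= g x)%E ->
  (\int[mu_ball]_x g x = \int[Vm]_x (g x * ((1 - sqnorm (\val x)) ^- m)%:E))%E.
Proof.
move=> mg g0; apply: (ge0_integral_density (nu := mu_ball)) => //.
  by apply: (uball_continuous_measurable (g := fun x => (1 - sqnorm x) ^- m)) => v; exact: continuous_density.
by move=> x; rewrite invr_ge0 exprn_ge0// ltW// uball_1Bsqnorm_gt0.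
Qed.

Lemma measurable_comp_uball_val d' (T' : sigmaRingType d') (h : borel 'rV[R]_m -> T') :
  measurable_fun rball h -> measurable_fun setT (fun x : borel (uball R m) => h (\val x)).
Proof.
move=> mh; apply: (@measurable_comp _ _ _ _ _ _ rball h _ (\val : borel (uball R m) -> borel 'rV[R]_m)) => //.
- exact: measurable_unit_ball.
- by move=> _ [x _ <-]; rewrite unit_ballE; exact: sqnorm_uball.
- exact: measurable_uball_val.
Qed.

Lemma measurable_density_rV : measurable_fun rball (fun v => (1 - sqnorm v) ^- m).
Proof.
apply: (@within_open_borel_measurable R 'rV[R]_m); first exact: open_unit_ball.
by move=> v; rewrite inE; exact: continuous_density.
Qed.

Lemma density_rV_ge0 (v : 'rV[R]_m) : unit_ball v -> 0 <= (1 - sqnorm v) ^- m.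
Proof. by rewrite unit_ballE => v1; rewrite invr_ge0 exprn_ge0// subr_ge0 ltW. Qed.

Lemma ge0_integral_mu_ball_rV (h : borel 'rV[R]_m -> \bar R) :
  measurable_fun rball h -> (forall v, unit_ball v -> 0 <= h v)%E ->
  (\int[mu_ball]_x h (\val x) = (@ball_scale R m)%:E *
    \int[lebesgue_rV]_(v in rball) (h v * ((1 - sqnorm v) ^- m)%:E))%E.
Proof.
move=> mh h0; rewrite ge0_integral_mu_ball.
- rewrite (@ge0_integral_Vm R m (fun v => h v * ((1 - sqnorm v) ^- m)%:E)%E)//.
    by apply: emeasurable_funM => //; apply/measurable_EFinP; exact: measurable_density_rV.
  by move=> v vB; rewrite mule_ge0 ?h0// lee_fin density_rV_ge0.
- exact: measurable_comp_uball_val.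
- by move=> x; apply: h0; rewrite unit_ballE; exact: sqnorm_uball.
Qed.

Lemma integral_mu_ball_rV (h : borel 'rV[R]_m -> R) : measurable_fun rball h ->
  lebesgue_rV.-integrable rball (fun v => (h v * (1 - sqnorm v) ^- m)%:E) ->
  mu_ball.-integrable setT (fun x : borel (uball R m) => (h (\val x))%:E) /\
  (\int[mu_ball]_x (h (\val x))%:E = (@ball_scale R m)%:E *
    \int[lebesgue_rV]_(v in rball) (h v * (1 - sqnorm v) ^- m)%:E)%E.
Proof.
move=> mh /integrableP[mi hi]; have mB := @measurable_unit_ball R m.
have mhE : measurable_fun rball (EFin \o h) by exact/measurable_EFinP.
have ih : mu_ball.-integrable setT (fun x : borel (uball R m) => (h (\val x))%:E).
  apply/integrableP; split.
    apply/measurable_EFinP; exact: measurable_comp_uball_val.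
  rewrite (ge0_integral_mu_ball_rV (h := fun v => `|(h v)%:E|%E))//; last first.
    by apply: measurableT_comp mhE; exact: abse_measurable.
  rewrite lte_mul_pinfty ?lee_fin ?ltW ?ball_scale_gt0//.
  apply: le_lt_trans hi; rewrite le_eqVlt; apply/orP; left; apply/eqP.
  apply: eq_integral => v; rewrite inE => vB.
  by rewrite EFinM abseM [in RHS](gee0_abs (x := ((1 - sqnorm v) ^- m)%:E))// lee_fin density_rV_ge0.
split=> //; rewrite [LHS]integralE [in RHS]integralE.
have pE (v : 'rV[R]_m) : unit_ball v -> ((fun v => (h v * (1 - sqnorm v) ^- m)%:E)^\+ v =
    (EFin \o h)^\+ v * ((1 - sqnorm v) ^- m)%:E)%E.
  move=> vB; rewrite !funeposE/= EFinM maxe_pMl ?mul0e// lee_fin density_rV_ge0//.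
have nE (v : 'rV[R]_m) : unit_ball v -> ((fun v => (h v * (1 - sqnorm v) ^- m)%:E)^\- v =
    (EFin \o h)^\- v * ((1 - sqnorm v) ^- m)%:E)%E.
  by move=> vB; rewrite !funenegE/= -mulNr EFinM maxe_pMl ?mul0e// lee_fin density_rV_ge0.
have -> : ((fun x : borel (uball R m) => (h (\val x))%:E)^\+ =
    (fun x => (EFin \o h)^\+ (\val x)))%E.
  by apply/funext => x; rewrite !funeposE.
have -> : ((fun x : borel (uball R m) => (h (\val x))%:E)^\- =
    (fun x => (EFin \o h)^\- (\val x)))%E.
  by apply/funext => x; rewrite !funenegE.
rewrite (ge0_integral_mu_ball_rV (h := ((EFin \o h)^\+)%E))//; last exact: measurable_funepos.
rewrite (ge0_integral_mu_ball_rV (h := ((EFin \o h)^\-)%E))//; last exact: measurable_funeneg.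
have hI : lebesgue_rV.-integrable rball (fun v => (h v * (1 - sqnorm v) ^- m)%:E).
  exact/integrableP.
have := integrable_pos_fin_num mB hI; have := integrable_neg_fin_num mB hI.
have -> : (\int[lebesgue_rV]_(v in rball) ((EFin \o h)^\+ v * ((1 - sqnorm v) ^- m)%:E)
    = \int[lebesgue_rV]_(v in rball) (fun v => (h v * (1 - sqnorm v) ^- m)%:E)^\+ v)%E.
  by apply: eq_integral => v; rewrite inE => vB; rewrite pE.
have -> : (\int[lebesgue_rV]_(v in rball) ((EFin \o h)^\- v * ((1 - sqnorm v) ^- m)%:E)
    = \int[lebesgue_rV]_(v in rball) (fun v => (h v * (1 - sqnorm v) ^- m)%:E)^\- v)%E.
  by apply: eq_integral => v; rewrite inE => vB; rewrite nE.
move: (\int[_]_(_ in _) _)%E (\int[_]_(_ in _) _)%E => [n||] [p||]// _ _.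
exact: (congr1 EFin (esym (mulrBr _ _ _))).
Qed.

End mu_ball_integral.
(** * Green's identity for radial test functions *)

Section directional_derivatives.
Context {R : realType} {V : normedModType R}.

Lemma is_derive_lineE (f : V -> R) (c v : V) (y df : R) :
  is_derive y (1 : R) (fun z => f (z *: v + c)) df -> is_derive (y *: v + c) v f df.
Proof.
set g := (fun z => _).
have E : (fun h : R => h^-1 *: ((g \o shift y) (h *: (1 : R)) - g y)) =
    (fun h => h^-1 *: ((f \o shift (y *: v + c)) (h *: v) - f (y *: v + c))).
  apply/funext => h; rewrite /g /= /shift/=; congr (_ *: (f _ - _)).
  by rewrite addrA -scalerDl /GRing.scale/= mulr1.
case=> df1 df2; split; first by rewrite /derivable -E.
by rewrite -df2 /derive -E.
Qed.

Lemma is_derive_line0 (f : V -> R) (x v : V) (df : R) :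
  is_derive (0 : R) (1 : R) (fun z => f (z *: v + x)) df <-> is_derive x v f df.
Proof.
split=> h; last by apply: is_derive_line; rewrite scale0r add0r.
by rewrite -[x]add0r -(scale0r v); exact: is_derive_lineE.
Qed.

Lemma is_derive_chain (g : R -> R) (f : V -> R) (x v : V) (dg df : R) :
  is_derive (f x) (1 : R) g dg -> is_derive x v f df ->
  is_derive x v (fun y => g (f y)) (dg * df).
Proof.
move=> dgx /is_derive_line0 dfx; apply/is_derive_line0.
have := @is_derive1_comp R g (fun z => f (z *: v + x)) 0 dg df.
rewrite scale0r add0r; exact.
Qed.

Lemma is_derive_mul (f g : V -> R) (x v : V) (df dg : R) :
  is_derive x v f df -> is_derive x v g dg ->
  is_derive x v (fun y => f y * g y) (f x * dg + g x * df).
Proof. by move=> hf hg; exact: (is_deriveM hf hg). Qed.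

Lemma is_derive_addf (f g : V -> R) (x v : V) (df dg : R) :
  is_derive x v f df -> is_derive x v g dg ->
  is_derive x v (fun y => f y + g y) (df + dg).
Proof. by move=> hf hg; exact: (is_deriveD hf hg). Qed.

Lemma is_derive_subf (f g : V -> R) (x v : V) (df dg : R) :
  is_derive x v f df -> is_derive x v g dg ->
  is_derive x v (fun y => f y - g y) (df - dg).
Proof. by move=> hf hg; exact: (is_deriveB hf hg). Qed.

Lemma is_derive_inv (f : V -> R) (x v : V) (df : R) : f x != 0 ->
  is_derive x v f df -> is_derive x v (fun y => (f y)^-1) (- (f x)^-1 ^+ 2 * df).
Proof.
move=> fx0 hf; apply: is_derive_chain => //.
apply: is_derive_eq; first exact: (is_deriveV (f := id)).
by rewrite /GRing.scale/= mulr1 exprVn.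
Qed.

Lemma is_derive_exp (f : V -> R) n (x v : V) (df : R) :
  is_derive x v f df -> is_derive x v (fun y => f y ^+ n) (n%:R * f x ^+ n.-1 * df).
Proof.
move=> hf; have -> : (fun y => f y ^+ n) = f ^+ n by rewrite exprfctE.
exact: is_deriveX.
Qed.

End directional_derivatives.

Section hyperbolic_calculus.
Context {R : realType} {k : nat}.
Notation m := k.+2.
Variable a : 'rV[R]_m.
Hypothesis a1 : sqnorm a < 1.
Implicit Types x : 'rV[R]_m.

(** The square of sinh (d / 2), where d is the hyperbolic distance from a to x.
    Unlike d it is smooth at a. *)
Definition pdist x : R :=
  sqnorm (x - a) / ((1 - sqnorm a) * (1 - sqnorm x)).

Let A : R := 1 - sqnorm a.
Let B x : R := 1 - sqnorm x.
Let N x : R := sqnorm (x - a).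
Let b x : R := (B x)^-1.
Notation e_ i := (delta_mx ord0 i : 'rV[R]_m).

Let A0 : A != 0. Proof. by rewrite subr_eq0 gt_eqF. Qed.

Lemma sqnorm_line x i (z : R) :
  sqnorm (z *: e_ i + x) = z ^+ 2 + 2 * x ord0 i * z + sqnorm x.
Proof.
rewrite /sqnorm (bigD1 i)//= [in RHS](bigD1 i)//= !mxE !eqxx/= mulr1.
rewrite sqrrD -!addrA; congr (_ + _); rewrite !addrA; congr (_ + _ + _).
  by rewrite -mulr_natl; ring.
by apply: eq_bigr => j ji; rewrite !mxE (negbTE ji) mulr0 add0r.
Qed.

Lemma is_derive_sqnormB x i : is_derive x (e_ i) (fun x => sqnorm (x - a))
  (2 * (x ord0 i - a ord0 i)).
Proof.
apply/is_derive_line0.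
have -> : (fun z : R => sqnorm (z *: e_ i + x - a)) =
    (fun z => z ^+ 2 + (2 * (x ord0 i - a ord0 i) * z + sqnorm (x - a))).
  by apply/funext => z; rewrite -addrA sqnorm_line !mxE addrA.
apply: is_derive_eq.
by rewrite /GRing.scale/= ?expr1 ?mulr0 ?addr0 ?mulr1 ?add0r ?mul0r.
Qed.

Lemma is_derive_sqnorm x i : is_derive x (e_ i) (@sqnorm R m) (2 * x ord0 i).
Proof.
apply/is_derive_line0.
under eq_fun do rewrite sqnorm_line -addrA.
apply: is_derive_eq.
by rewrite /GRing.scale/= ?expr1 ?mulr0 ?addr0 ?mulr1 ?add0r ?mul0r.
Qed.

Lemma is_derive_1Bsqnorm_inv x i : B x != 0 ->
  is_derive x (e_ i) b (2 * x ord0 i * b x ^+ 2).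
Proof.
move=> B0; apply: is_derive_eq.
  apply: (is_derive_inv (f := B)) => //.
  apply: (is_derive_subf (f := cst 1)).
  exact: is_derive_sqnorm.
by rewrite /b sub0r mulrNN mulrC.
Qed.

Lemma is_derive_coordB x i : is_derive x (e_ i) (fun x => x ord0 i - a ord0 i) 1.
Proof.
apply/is_derive_line0; under eq_fun do rewrite !mxE !eqxx mulr1 -addrA.
by apply: is_derive_eq; rewrite addr0.
Qed.

Lemma is_derive_coord x i : is_derive x (e_ i) (fun x => x ord0 i) 1.
Proof.
apply/is_derive_line0; under eq_fun do rewrite !mxE !eqxx mulr1.
by apply: is_derive_eq; rewrite addr0.
Qed.

Lemma pdistE x : pdist x = A^-1 * (N x * b x).
Proof. by rewrite /pdist invfM mulrCA. Qed.

Definition dpdist x i : R :=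
  A^-1 * (2 * (x ord0 i - a ord0 i) * b x + 2 * x ord0 i * N x * b x ^+ 2).

Lemma is_derive_pdist x i : B x != 0 -> is_derive x (e_ i) pdist (dpdist x i).
Proof.
move=> B0; rewrite (_ : pdist = fun x => cst A^-1 x * (N x * b x)); last first.
  by apply/funext => y; rewrite pdistE.
apply: is_derive_eq.
  apply: (is_derive_mul (f := cst A^-1) (g := fun x => N x * b x)).
  apply: (is_derive_mul (f := N)); first exact: is_derive_sqnormB.
  exact: is_derive_1Bsqnorm_inv.
by rewrite /dpdist /cst /=; ring.
Qed.

(** The flux b^k times the gradient of pdist, where b^k is the coefficient of
    the divergence form of the hyperbolic Laplacian in dimension k + 2. *)
Definition flux x i : R := b x ^+ k * dpdist x i.

Definition dflux x i : R :=
  k%:R * b x ^+ k.+1 * (2 * x ord0 i) * dpdist x i +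
  A^-1 * b x ^+ k * (2 * b x + 8 * (x ord0 i - a ord0 i) * x ord0 i * b x ^+ 2
    + 2 * N x * b x ^+ 2 + 8 * x ord0 i ^+ 2 * N x * b x ^+ 3).

Lemma is_derive_coef x i : B x != 0 ->
  is_derive x (e_ i) (fun x => b x ^+ k) (k%:R * b x ^+ k.+1 * (2 * x ord0 i)).
Proof.
move=> B0; apply: is_derive_eq.
  by apply: is_derive_exp; exact: is_derive_1Bsqnorm_inv.
move: (b x) (x ord0 i) => y z; case: {+}k => [|j]; rewrite ?mul0r//= !exprS; ring.
Qed.

Lemma is_derive_flux x i : B x != 0 ->
  is_derive x (e_ i) (fun x => flux x i) (dflux x i).
Proof.
move=> B0; apply: is_derive_eq.
  apply: (is_derive_mul (f := fun x => b x ^+ k)); first exact: is_derive_coef.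
  apply: (is_derive_mul (f := cst A^-1)).
  apply: is_derive_addf.
    apply: (is_derive_mul (f := fun x => 2 * (x ord0 i - a ord0 i))).
      apply: (is_derive_mul (f := cst 2)).
      exact: is_derive_coordB.
    exact: is_derive_1Bsqnorm_inv.
  apply: (is_derive_mul (f := fun x => 2 * x ord0 i * N x)).
    apply: (is_derive_mul (f := fun x => 2 * x ord0 i)).
      apply: (is_derive_mul (f := cst 2)).
      exact: is_derive_coord.
    exact: is_derive_sqnormB.
  by apply: is_derive_exp; exact: is_derive_1Bsqnorm_inv.
rewrite /dflux /dpdist /cst /=; ring.
Qed.

End hyperbolic_calculus.

Section green.
Context {R : realType} {k : nat}.
Notation m := k.+2.
Notation rball := (@unit_ball R m : set (borel 'rV[R]_m)).
Variables (a : 'rV[R]_m) (u : 'rV[R]_m -> R) (U U1 U2 : R -> R).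
Hypotheses (a1 : sqnorm a < 1) (Cu : C2_on unit_ball u)
  (hu : forall x, unit_ball x -> hyp_laplacian u x = 0)
  (dU : forall y : R, is_derive y (1 : R) U (U1 y))
  (dU1 : forall y : R, is_derive y (1 : R) U1 (U2 y)).
Implicit Types x : 'rV[R]_m.
Notation e_ i := (delta_mx ord0 i : 'rV[R]_m).
Notation p := (pdist a).

Let A : R := 1 - sqnorm a.
Let B x : R := 1 - sqnorm x.
Let N x : R := sqnorm (x - a).
Let b x : R := (B x)^-1.
Let A0 : A != 0. Proof. by rewrite subr_eq0 gt_eqF. Qed.

Let Bn0 x : unit_ball x -> B x != 0.
Proof. by rewrite unit_ballE => x1; rewrite subr_eq0 gt_eqF. Qed.

(** Green's field U grad u - u grad U for the radial function U (pdist a), times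
    the coefficient b^k of the divergence form of the Laplacian. *)
Definition green_field i x : R :=
  b x ^+ k * (U (p x) * partial i u x) - u x * (U1 (p x) * flux a x i).

Definition green_term i x : R :=
  k%:R * b x ^+ k.+1 * (2 * x ord0 i) * (U (p x) * partial i u x) +
  b x ^+ k * (U (p x) * partial i (partial i u) x)
  - u x * (U2 (p x) * dpdist a x i * flux a x i + U1 (p x) * dflux a x i).

Lemma is_derive_green i x : unit_ball x ->
  is_derive x (e_ i) (green_field i) (green_term i x).
Proof.
move=> xB; have B0 := Bn0 xB; have [_ /(_ i)[du _] /(_ i i)[ddu _]] := Cu xB.
have Du := DeriveDef du erefl; have DDu := DeriveDef ddu erefl.
have Dp := is_derive_pdist a i B0.
apply: is_derive_eq.
  apply: (is_derive_subf (f := fun x => b x ^+ k * (U (p x) * partial i u x))).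
    apply: (is_derive_mul (f := fun x => b x ^+ k)); first exact: is_derive_coef.
    apply: (is_derive_mul (f := fun x => U (p x))); first exact: (is_derive_chain (dU _) Dp).
  apply: (is_derive_mul (f := u)).
  apply: (is_derive_mul (f := fun x => U1 (p x))); first exact: (is_derive_chain (dU1 _) Dp).
  exact: is_derive_flux.
by rewrite /green_term /flux /partial /= -/(B x) -/(b x); ring.
Qed.

Lemma sum_coordB_coord x :
  2 * \sum_i (x ord0 i - a ord0 i) * x ord0 i = N x + A - B x.
Proof.
rewrite /N /A /B /sqnorm -[RHS]addrA opprB [1 - _ + _]addrC subrKA.
rewrite -sumrB -big_split/= mulr_sumr; apply: eq_bigr => i _.
by rewrite !mxE; ring.
Qed.

(** Harmonicity cancels the terms in U. The other ones depend on pdist only,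
    because |grad pdist|^2 = 4 pdist (1 + pdist) b^2 and the hyperbolic Laplacian
    of pdist is affine in pdist. *)
Lemma sum_green_term x : unit_ball x -> \sum_i green_term i x =
  - (u x * (4 * p x * (1 + p x) * U2 (p x) + 2 * m%:R * (1 + 2 * p x) * U1 (p x)))
  * b x ^+ m.
Proof.
move=> xB; have B0 := Bn0 xB; have := hu xB.
rewrite /hyp_laplacian -/(B x).
have -> : m%:R - 2 = k%:R :> R by rewrite -addn2 natrD addrK.
set D := \sum_i partial i _ x; set E := \sum_i _ * _ => h.
have h1 : \sum_i green_term i x =
   U (p x) * (2 * k%:R * b x ^+ k.+1 * E + b x ^+ k * D)
   - u x * (U2 (p x) * \sum_i dpdist a x i * flux a x i + U1 (p x) * \sum_i dflux a x i).
  rewrite /green_term sumrB; congr (_ - _).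
    rewrite big_split/= mulrDr /E /D !mulr_sumr.
    by congr (_ + _); apply: eq_bigr => i _; ring.
  rewrite -mulr_sumr; congr (_ * _); rewrite big_split/= !mulr_sumr.
  by congr (_ + _); apply: eq_bigr => i _; rewrite ?mulrA.
have sB : \sum_i (x ord0 i - a ord0 i) ^+ 2 = N x.
  by apply: eq_bigr => i _; rewrite !mxE.
set c := \sum_i (x ord0 i - a ord0 i) * x ord0 i.
have cE : 2 * c = N x + A - B x := sum_coordB_coord x.
have sx : \sum_i x ord0 i ^+ 2 = 1 - B x by rewrite /B opprB addrC subrK.
(* Dummy variables n and y for N x and b x keep the sums over i from being
   found inside N x. *)
pose dp (n y : R) i := A^-1 * (2 * (x ord0 i - a ord0 i) * y + 2 * x ord0 i * n * y ^+ 2).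
have h2 : \sum_i dpdist a x i * flux a x i = 4 * p x * (1 + p x) * b x ^+ m.
  have gen n y : \sum_i dp n y i * (y ^+ k * dp n y i) =
      4 * A^-1 ^+ 2 * y ^+ k * ((\sum_i (x ord0 i - a ord0 i) ^+ 2) * y ^+ 2
      + n * y ^+ 3 * (2 * c) + n ^+ 2 * y ^+ 4 * \sum_i x ord0 i ^+ 2).
    rewrite /c !(mulr_sumr, mulr_suml, =^~ big_split)/=.
    by apply: eq_bigr => i _; rewrite /dp; ring.
  have := gen (N x) (b x); rewrite sB sx cE => gen1; rewrite [LHS]gen1.
  by rewrite (pdistE a) -/A -/(B x) -/(b x) -/(N x) /b !exprS; field; rewrite A0 B0.
have h3 : \sum_i dflux a x i = 2 * m%:R * (1 + 2 * p x) * b x ^+ m.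
  have gen n y : \sum_i (k%:R * y ^+ k.+1 * (2 * x ord0 i) * dp n y i +
      A^-1 * y ^+ k * (2 * y + 8 * (x ord0 i - a ord0 i) * x ord0 i * y ^+ 2
      + 2 * n * y ^+ 2 + 8 * x ord0 i ^+ 2 * n * y ^+ 3)) =
      A^-1 * (2 * k%:R * y ^+ k.+1 * ((2 * c) * y
          + (\sum_i x ord0 i ^+ 2) * (2 * n * y ^+ 2))
     + y ^+ k * (m%:R * (2 * y + 2 * n * y ^+ 2) + 4 * y ^+ 2 * (2 * c)
        + 8 * n * y ^+ 3 * \sum_i x ord0 i ^+ 2)).
    have -> : m%:R * (2 * y + 2 * n * y ^+ 2) = \sum_(i < m) (2 * y + 2 * n * y ^+ 2).
      by rewrite sumr_const card_ord mulr_natl.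
    rewrite /c !(mulr_sumr, mulr_suml, =^~ big_split)/=.
    by apply: eq_bigr => i _; rewrite /dp; ring.
  have := gen (N x) (b x); rewrite sx cE => gen1; rewrite [LHS]gen1.
  rewrite (pdistE a) -/A -/(B x) -/(b x) -/(N x) /b -addn2 natrD !exprS.
  by field; rewrite A0 B0.
rewrite h1 h2 h3.
have -> : 2 * k%:R * b x ^+ k.+1 * E + b x ^+ k * D = 0.
  rewrite -[RHS](mulr0 (b x ^+ m)) -h /b !exprS; field.
  by rewrite B0.
by rewrite mulr0 sub0r; ring.
Qed.

End green.

Section pointwise_continuity.
Context {R : realType} {T : topologicalType}.
Implicit Types (f g : T -> R) (x : T).

Lemma for_continuousD f g x : {for x, continuous f} -> {for x, continuous g} ->
  {for x, continuous (fun y => f y + g y)}.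
Proof. by move=> cf cg; exact: (@continuousD _ _ _ f g x cf cg). Qed.

Lemma for_continuousB f g x : {for x, continuous f} -> {for x, continuous g} ->
  {for x, continuous (fun y => f y - g y)}.
Proof. by move=> cf cg; exact: (@continuousB _ _ _ f g x cf cg). Qed.

Lemma for_continuousM f g x : {for x, continuous f} -> {for x, continuous g} ->
  {for x, continuous (fun y => f y * g y)}.
Proof. by move=> cf cg; exact: (@continuousM _ _ f g x cf cg). Qed.

Lemma for_continuousX f n x : {for x, continuous f} ->
  {for x, continuous (fun y => f y ^+ n)}.
Proof.
move=> cf; apply: (@continuous_comp _ _ _ f (fun y => y ^+ n)) => //.
exact: exprn_continuous.
Qed.

Lemma for_continuous_max f g x : {for x, continuous f} -> {for x, continuous g} ->
  {for x, continuous (fun y => Num.max (f y) (g y))}.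
Proof. by move=> cf cg; exact: (@continuous_max _ _ f g x cf cg). Qed.

Lemma for_continuous_min f g x : {for x, continuous f} -> {for x, continuous g} ->
  {for x, continuous (fun y => Num.min (f y) (g y))}.
Proof. by move=> cf cg; exact: (@continuous_min _ _ f g x cf cg). Qed.

Lemma for_continuous_near f g x : (\near x, f x = g x) ->
  {for x, continuous f} -> {for x, continuous g}.
Proof.
move=> fg cf; have fgx : f x = g x := nbhs_singleton fg.
rewrite /prop_for /continuous_at -fgx; apply: cvg_trans cf.
by apply: near_eq_cvg; apply: filterS fg => y ->.
Qed.

Lemma for_continuous_cst (r : R) x : {for x, continuous (fun _ : T => r)}.
Proof. exact: cst_continuous. Qed.

End pointwise_continuity.

Ltac continuity_step := lazymatch goal with
  | |- context [continuous (fun y => (@?f y - @?g y)%R)] =>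
      refine (@for_continuousB _ _ f g _ _ _)
  | |- context [continuous (fun y => (@?f y + @?g y)%R)] =>
      refine (@for_continuousD _ _ f g _ _ _)
  | |- context [continuous (fun y => (@?f y * @?g y)%R)] =>
      refine (@for_continuousM _ _ f g _ _ _)
  | |- context [continuous (fun y => Num.max (@?f y) (@?g y))] =>
      refine (@for_continuous_max _ _ f g _ _ _)
  | |- context [continuous (fun y => Num.min (@?f y) (@?g y))] =>
      refine (@for_continuous_min _ _ f g _ _ _)
  | |- context [continuous (fun y => (@?f y ^+ ?n)%R)] =>
      refine (@for_continuousX _ _ f n _ _)
  end.

Section green_integral.
Context {R : realType} {k : nat}.
Notation m := k.+2.
Notation rball := (@unit_ball R m : set (borel 'rV[R]_m)).
Variables (a : 'rV[R]_m) (u : 'rV[R]_m -> R) (U U1 U2 : R -> R) (M : R).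
Hypotheses (a1 : sqnorm a < 1) (Cu : C2_on unit_ball u)
  (hu : forall x, unit_ball x -> hyp_laplacian u x = 0)
  (dU : forall y : R, is_derive y (1 : R) U (U1 y))
  (dU1 : forall y : R, is_derive y (1 : R) U1 (U2 y))
  (cU2 : continuous U2) (M0 : 0 <= M)
  (UM : forall y, M < y -> U y = 0 /\ U1 y = 0).
Implicit Types x : 'rV[R]_m.
Notation e_ i := (delta_mx ord0 i : 'rV[R]_m).
Notation p := (pdist a).

Lemma continuous_1Bsqnorm_inv x : unit_ball x ->
  {for x, continuous (fun x : 'rV[R]_m => (1 - sqnorm x)^-1)}.
Proof.
rewrite unit_ballE => x1; apply: (@cvgV _ _ (nbhs x) _ (fun x => 1 - sqnorm x)).
  by rewrite subr_eq0 gt_eqF.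
exact: continuous_1Bsqnorm.
Qed.

Lemma continuous_sqnormB : continuous (fun x : 'rV[R]_m => sqnorm (x - a)).
Proof.
move=> x; apply: (@continuous_comp _ _ _ (fun x => x - a) (@sqnorm R m)).
  by apply: (@continuousB _ _ _ id (cst a)); [exact: cvg_id|exact: cst_continuous].
exact: continuous_sqnorm.
Qed.

Lemma continuous_pdist x : unit_ball x -> {for x, continuous p}.
Proof.
move=> xB; rewrite (_ : p = fun x => (1 - sqnorm a)^-1 * (sqnorm (x - a) * (1 - sqnorm x)^-1)).
  apply: for_continuousM; first exact: for_continuous_cst.
  by apply: for_continuousM; [exact: continuous_sqnormB|exact: continuous_1Bsqnorm_inv].
by apply/funext => y; rewrite pdistE.
Qed.

Lemma continuous_green_term i x : unit_ball x ->
  {for x, continuous (green_term a u U U1 U2 i)}.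
Proof.
move=> xB; have [cu /(_ i)[_ cdu] /(_ i i)[_ cddu]] := Cu xB.
have cb := continuous_1Bsqnorm_inv xB.
have cp := continuous_pdist xB.
have cN : {for x, continuous (fun x => sqnorm (x - a))} by exact: continuous_sqnormB.
have cx : {for x, continuous (fun x : 'rV[R]_m => x ord0 i)} by exact: coord_continuous.
have cc (r : R) : {for x, continuous (fun _ : 'rV[R]_m => r)} by exact: for_continuous_cst.
have cg (f g : R -> R) : (forall y : R, is_derive y (1 : R) f (g y)) ->
    {for x, continuous (fun x => f (p x))}.
  move=> df; apply: continuous_comp => //.
  by apply: differentiable_continuous; apply/derivable1_diffP; case: (df (p x)).
have cU := cg _ _ dU; have cU1 := cg _ _ dU1.
have cU2p : {for x, continuous (fun x => U2 (p x))}.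
  by apply: continuous_comp => //; exact: cU2.
have cxa : {for x, continuous (fun x : 'rV[R]_m => x ord0 i - a ord0 i)} by apply: for_continuousB.
have cdp : {for x, continuous (fun x => dpdist a x i)}.
  by rewrite /dpdist; repeat continuity_step; try exact: cc.
have cfl : {for x, continuous (fun x => flux a x i)}.
  by apply: for_continuousM => //; exact: for_continuousX.
have cdf : {for x, continuous (fun x => dflux a x i)}.
  by rewrite /dflux; repeat continuity_step; try exact: cc.
apply: for_continuousB; last by repeat continuity_step.
by repeat continuity_step.
Qed.

(** The test functions have compact support in the ball: this set is closed
    in the whole space, and a boundary point of the ball cannot belong to it. *)
Definition hyp_closed_ball : set 'rV[R]_m :=
  [set x | sqnorm (x - a) <= M * (1 - sqnorm a) * (1 - sqnorm x)].

Lemma hyp_closed_ball_sub : hyp_closed_ball `<=` unit_ball.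
Proof.
move=> x; rewrite unit_ballE /hyp_closed_ball/= => h.
rewrite ltNge; apply/negP => x1.
have xa : sqnorm (x - a) <= 0.
  by rewrite (le_trans h)// mulr_ge0_le0 ?subr_le0// mulr_ge0// subr_ge0 ltW.
suff xE : x = a by move: x1; rewrite xE leNgt a1.
apply/rowP => j; apply/eqP; rewrite -subr_eq0 -[_ == 0]sqrf_eq0.
rewrite eq_le sqr_ge0 andbT (le_trans _ xa)//.
by have := coord_le_sqnorm (x - a) j; rewrite !mxE.
Qed.

Lemma closed_hyp_closed_ball : closed hyp_closed_ball.
Proof.
pose f x := M * (1 - sqnorm a) * (1 - sqnorm x) - sqnorm (x - a).
have -> : hyp_closed_ball = f @^-1` [set y | 0 <= y].
  by apply/seteqP; split => x; rewrite /hyp_closed_ball /f/= subr_ge0.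
apply: preimage_closed; last exact: closed_ge.
move=> x _; apply: (@for_continuousB _ _ (fun x => M * (1 - sqnorm a) * (1 - sqnorm x))
  (fun x => sqnorm (x - a))); last exact: continuous_sqnormB.
by apply: for_continuousM; [exact: for_continuous_cst|exact: continuous_1Bsqnorm].
Qed.

Lemma pdist_gt x : unit_ball x -> ~ hyp_closed_ball x -> M < p x.
Proof.
rewrite unit_ballE => x1 /negP; rewrite -ltNge /pdist => h.
by rewrite ltr_pdivlMr ?mulr_gt0 ?subr_gt0// mulrA.
Qed.

End green_integral.

Section green_identity_section.
Context {R : realType} {k : nat}.
Notation m := k.+2.
Notation rball := (@unit_ball R m : set (borel 'rV[R]_m)).
Variables (a : 'rV[R]_m) (u : 'rV[R]_m -> R) (U U1 U2 : R -> R) (M : R).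
Hypotheses (a1 : sqnorm a < 1) (Cu : C2_on unit_ball u)
  (hu : forall x, unit_ball x -> hyp_laplacian u x = 0)
  (dU : forall y : R, is_derive y (1 : R) U (U1 y))
  (dU1 : forall y : R, is_derive y (1 : R) U1 (U2 y))
  (cU2 : continuous U2) (M0 : 0 <= M)
  (UM : forall y, M < y -> U y = 0 /\ U1 y = 0).
Implicit Types x : 'rV[R]_m.
Notation e_ i := (delta_mx ord0 i : 'rV[R]_m).
Notation p := (pdist a).

(** As U (pdist a) vanishes near the sphere, the field extended by zero is
    differentiable on the whole space. *)
Definition green_ext i x : R := if x \in unit_ball then green_field a u U U1 i x else 0.

Lemma green_ext_eq0 i x : ~ hyp_closed_ball a M x -> green_ext i x = 0.
Proof.
move=> xZ; rewrite /green_ext; case: ifPn => //; rewrite inE => xB.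
rewrite /green_field; have [-> ->] := UM (pdist_gt a1 xB xZ).
by rewrite !mul0r !mulr0 subrr.
Qed.

Lemma is_derive_green_ext i x : unit_ball x ->
  is_derive x (e_ i) (green_ext i) (green_term a u U U1 U2 i x).
Proof.
move=> xB; apply: (near_eq_is_derive (f := green_field a u U U1 i)); last first.
  by apply: is_derive_green.
near=> y; rewrite /green_ext ifT// inE; near: y.
by apply: open_nbhs_nbhs; split => //; exact: open_unit_ball.
Unshelve. all: by end_near. Qed.

Lemma near_green_ext_eq0 i x : ~ hyp_closed_ball a M x -> \near x, green_ext i x = 0.
Proof.
move=> xZ; near=> y; apply: green_ext_eq0; near: y.
apply: open_nbhs_nbhs; split => //; apply: closed_openC.
exact: closed_hyp_closed_ball.
Unshelve. all: by end_near. Qed.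

Lemma is_derive_green_ext0 i x : ~ hyp_closed_ball a M x ->
  is_derive x (e_ i) (green_ext i) 0.
Proof.
move=> xZ; apply: (near_eq_is_derive (f := cst 0)).
by apply: filterS (near_green_ext_eq0 i xZ) => y ->.
Qed.

Lemma partial_green_ext i x : unit_ball x ->
  partial i (green_ext i) x = green_term a u U U1 U2 i x.
Proof. by move=> /is_derive_green_ext -/(_ i)[]. Qed.

Lemma partial_green_ext0 i x : ~ hyp_closed_ball a M x -> partial i (green_ext i) x = 0.
Proof. by move=> /is_derive_green_ext0 -/(_ i)[]. Qed.

Lemma continuous_partial_green_ext i : continuous (partial i (green_ext i)).
Proof.
move=> x; have [xB|xB] := pselect (unit_ball x).
  apply: (for_continuous_near (f := green_term a u U U1 U2 i)).
    near=> y; rewrite partial_green_ext//; near: y.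
    by apply: open_nbhs_nbhs; split => //; exact: open_unit_ball.
  exact: (continuous_green_term (U := U)).
apply: (for_continuous_near (f := cst 0)); last exact: cst_continuous.
near=> y; rewrite partial_green_ext0//; near: y.
apply: open_nbhs_nbhs; split; last by move/(hyp_closed_ball_sub a1 M0).
by apply: closed_openC; exact: closed_hyp_closed_ball.
Unshelve. all: by end_near. Qed.

Lemma derivable_green_ext i x : derivable (green_ext i) x (e_ i).
Proof.
have [xB|xB] := pselect (unit_ball x); first by case: (is_derive_green_ext i xB).
have xZ : ~ hyp_closed_ball a M x by move/(hyp_closed_ball_sub a1 M0).
by case: (is_derive_green_ext0 i xZ).
Qed.

(** The hyperbolic Laplacian of U (pdist a), as a function of pdist. *)
Definition radial_laplacian (y : R) : R :=
  4 * y * (1 + y) * U2 y + 2 * m%:R * (1 + 2 * y) * U1 y.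

Lemma continuous_radial_laplacian : continuous radial_laplacian.
Proof.
move=> y; have cid : {for y, continuous (fun z : R => z)} by exact: cvg_id.
have cc (r : R) : {for y, continuous (fun _ : R => r)} by exact: for_continuous_cst.
have cU1 : {for y, continuous U1}.
  by apply: differentiable_continuous; apply/derivable1_diffP; case: (dU1 y).
have cU2y : {for y, continuous U2} by exact: cU2.
suff : {for y, continuous (fun z : R =>
    4 * z * (1 + z) * U2 z + 2 * m%:R * (1 + 2 * z) * U1 z)} by [].
by repeat continuity_step; try exact: cc.
Qed.

(** The integral of a divergence with compact support is zero. *)
Lemma green_identity :
  mu_ball.-integrable setT
    (fun x : borel (uball R m) => (u (\val x) * radial_laplacian (p (\val x)))%:E) /\
  (\int[mu_ball]_x (u (\val x) * radial_laplacian (p (\val x)))%:E = 0)%E.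
Proof.
have out x i : ~ unit_ball x -> partial i (green_ext i) x = 0.
  by move=> xB; apply: partial_green_ext0 => /(hyp_closed_ball_sub a1 M0).
have PW i : lebesgue_rV.-integrable setT
      (EFin \o partial i (green_ext i) : borel 'rV[R]_m -> \bar R) /\
    (\int[lebesgue_rV]_x (partial i (green_ext i) x)%:E = 0)%E.
  apply: (integral_partial_eq0 (r := 1)) => //.
  - by move=> x; exact: derivable_green_ext.
  - exact: continuous_partial_green_ext.
  - move=> x xr; have xB : ~ unit_ball x by move/unit_ball_rcube.
    by split; [rewrite green_ext_eq0// => /(hyp_closed_ball_sub a1 M0)|exact: out].
pose h x := u x * radial_laplacian (p x).
pose S x : \bar R := (\sum_i (partial i (green_ext i) x)%:E)%E.
have iS : lebesgue_rV.-integrable setT (S : borel 'rV[R]_m -> \bar R).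
  by apply: integrable_sum => // i _; case: (PW i).
have S0 : (\int[lebesgue_rV]_x S x = 0)%E.
  rewrite integral_sum//; last by move=> i; case: (PW i).
  by rewrite big1// => i _; case: (PW i).
have hS x : unit_ball x -> (h x * (1 - sqnorm x) ^- m)%:E = (- S x)%E.
  move=> xB; rewrite /S; under eq_bigr do rewrite partial_green_ext//.
  by rewrite sumEFin sum_green_term// -EFinN mulNr opprK exprVn.
have mB := @measurable_unit_ball R m.
have mh : measurable_fun rball (h : borel 'rV[R]_m -> R).
  apply: (@within_open_borel_measurable R 'rV[R]_m); first exact: open_unit_ball.
  move=> x; rewrite inE => xB; have [cu _ _] := Cu xB.
  apply: (@for_continuousM _ _ u (fun x => radial_laplacian (p x))) => //.
  apply: (@continuous_comp _ _ _ p radial_laplacian); first exact: continuous_pdist.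
  exact: continuous_radial_laplacian.
have [|ih hE] := @integral_mu_ball_rV R m h mh.
  apply: (@eq_integrable _ _ _ _ _ mB (fun x => - S x)%E).
    by move=> x; rewrite inE => /hS ->.
  by apply: integrableN => //; apply: integrableS iS.
split=> //; rewrite hE.
have SB : (\int[lebesgue_rV]_(x in rball) S x = 0)%E.
  rewrite -[RHS]S0 [LHS]integral_mkcond; apply: eq_integral => x _; rewrite patchE.
  case: ifPn => //; rewrite notin_setE => xB.
  by rewrite /S big1// => i _; rewrite out.
have iSB : lebesgue_rV.-integrable rball (S : borel 'rV[R]_m -> \bar R).
  exact: integrableS iS.
rewrite (@eq_integral _ _ _ _ rball (fun x => - S x)%E); last first.
  by move=> x; rewrite inE => xB; rewrite hS.
rewrite integralN ?SB ?oppe0 ?mule0//.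
exact: integrable_add_def.
Qed.

End green_identity_section.
(** * The mean value property *)

Section test_functions.
Context {R : realType}.
Notation leb := (@lebesgue_measure R).

(** The support stays away from 0, where the radial Laplacian degenerates. *)
Definition test_fun (e M : R) (tau : R -> R) :=
  [/\ continuous tau, 0 < e, e <= M & forall y, y <= e \/ M <= y -> tau y = 0].

Lemma integrable_test_fun e M tau : test_fun e M tau ->
  leb.-integrable setT (EFin \o tau).
Proof.
move=> [ct e0 eM t0].
have -> : EFin \o tau = (EFin \o tau) \_ `[e, M]%classic.
  apply/funext => y; rewrite patchE/=; case: ifPn => //.
  rewrite notin_setE/= in_itv/= => /negP; rewrite negb_and -!ltNge => /orP[ye|My].
    by rewrite t0//; left; exact: ltW.
  by rewrite t0//; right; exact: ltW.
rewrite -integrable_mkcond//.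
apply: continuous_compact_integrable; first exact: segment_compact.
exact: continuous_subspaceT.
Qed.

Lemma antiderivative_test_fun e M tau : test_fun e M tau ->
  exists G : R -> R, [/\ forall y : R, is_derive y (1 : R) G (tau y),
    forall y, M <= y -> G y = 0 &
    forall y, y <= e -> G y = - (\int[leb]_x tau x)%R].
Proof.
move=> tt; have it := integrable_test_fun tt; have [ct e0 eM t0] := tt.
pose F x := (\int[leb]_(t in `]-oo, x]) (tau t))%R.
exists (fun y => F y - \int[leb]_x tau x)%R; split.
- move=> y; have [] := @continuous_FTC1 R tau -oo%O y (y + 1).
  + by rewrite ltrDl.
  + by apply: integrableS it.
  + by rewrite /= ltNyr.
  + exact: ct.
  rewrite derive1E => dF FE; apply: is_derive_eq.
    apply: (is_derive_subf (f := F) (g := cst (\int[leb]_x tau x)%R)).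
    exact: (DeriveDef dF FE).
  by rewrite subr0.
- move=> y My; apply/eqP; rewrite subr_eq0; apply/eqP.
  rewrite /F Rintegral_mkcond; apply: eq_Rintegral => x _.
  rewrite patchE; case: ifPn => //; rewrite notin_setE/= in_itv/= => /negP.
  by rewrite -ltNge => yx; rewrite t0//; right; exact: le_trans (ltW yx).
- move=> y ye; rewrite /F Rintegral_mkcond.
  suff -> : (\int[leb]_x (tau \_ `]-oo, y]) x)%R = 0 by rewrite sub0r.
  rewrite (@eq_Rintegral _ _ _ _ setT (cst 0)); last first.
    move=> x _; rewrite patchE; case: ifPn => //; rewrite inE/= in_itv/= => xy.
    by rewrite t0//; left; rewrite (le_trans xy).
  by rewrite Rintegral_cst// mul0r.
Qed.
End test_functions.

Section mean_zero.
Context {R : realType} {k : nat}.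
Notation m := k.+2.
Notation leb := (@lebesgue_measure R).

(** Up to a constant factor, vpow (pdist a) times the invariant measure has
    constant density with respect to the variable pdist a. *)
Definition vpow (y : R) : R := (y * (1 + y)) `^ (- (k%:R / 2)).

(** The integrating factor of the radial Laplacian: if U' = chi winv, then the
    radial Laplacian of U is chi' vpow. *)
Let winv (y : R) : R := 4^-1 * (y * (1 + y)) `^ (- (k%:R / 2) - 1).
Let dwinv (y : R) : R :=
  4^-1 * ((- (k%:R / 2) - 1) * (y * (1 + y)) `^ (- (k%:R / 2) - 1 - 1) * (1 + 2 * y)).

Let yy0 (y : R) : 0 < y -> 0 < y * (1 + y).
Proof. by move=> y0; rewrite mulr_gt0// addr_gt0. Qed.

Let is_derive_yy (y : R) : is_derive y (1 : R) (fun y => y * (1 + y)) (1 + 2 * y).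
Proof.
apply: is_derive_eq.
by rewrite /GRing.scale/= add0r !mulr1 addrCA mulr_natl mulr2n.
Qed.

Let is_derive_winv (y : R) : 0 < y -> is_derive y (1 : R) winv (dwinv y).
Proof.
move=> y0; pose r := - (k%:R / 2) - 1 : R.
have D1 := @is_derive_chain R R (fun t : R => t `^ r) (fun y => y * (1 + y)) y 1 _ _
  (is_derive1_powR r (yy0 y0)) (is_derive_yy y).
have D2 := @is_derive_mul R R (cst 4^-1) _ y 1 _ _ (is_derive_cst _ _ _) D1.
suff -> : dwinv y = cst 4^-1 y * (r * (y * (1 + y)) `^ (r - 1) * (1 + 2 * y)) +
  (y * (1 + y)) `^ r * 0 by exact: D2.
by rewrite mulr0 addr0.
Qed.

Let continuous_dwinv (y : R) : 0 < y -> {for y, continuous dwinv}.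
Proof.
move=> y0; have cc (r : R) : {for y, continuous (fun _ : R => r)}.
  exact: for_continuous_cst.
have cid : {for y, continuous (fun z : R => z)} by exact: cvg_id.
have cyy : {for y, continuous (fun z : R => z * (1 + z))}.
  by repeat continuity_step; try exact: cc.
have cp : {for y, continuous (fun z : R => (z * (1 + z)) `^ (- (k%:R / 2) - 1 - 1))}.
  apply: (@continuous_comp _ _ _ (fun z : R => z * (1 + z)) (fun t : R => t `^ (- (k%:R / 2) - 1 - 1))) => //.
  apply: differentiable_continuous; apply/derivable1_diffP.
  by case: (is_derive1_powR (- (k%:R / 2) - 1 - 1) (yy0 y0)).
rewrite (_ : dwinv = fun z : R => 4^-1 * ((- (k%:R / 2) - 1) *
  (z * (1 + z)) `^ (- (k%:R / 2) - 1 - 1) * (1 + 2 * z)))//.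
by repeat continuity_step; try exact: cc.
Qed.

Variables (a : 'rV[R]_m) (u : 'rV[R]_m -> R).
Hypotheses (a1 : sqnorm a < 1) (Cu : C2_on unit_ball u)
  (hu : forall x, unit_ball x -> hyp_laplacian u x = 0).

(** A test function tau of mean zero is the derivative of a test function chi,
    and chi winv is the derivative of a function U vanishing at infinity, to which
    Green's identity applies. *)
Lemma integral_test_fun_eq0 e M tau : test_fun e M tau ->
  (\int[leb]_y tau y = 0)%R ->
  (\int[mu_ball]_x (u (\val x) * (tau (pdist a (\val x)) * vpow (pdist a (\val x))))%:E = 0)%E.
Proof.
move=> tt it0; have [ct e0 eM t0] := tt.
have [chi [dchi chiM chie]] := antiderivative_test_fun tt.
have {}chie y : y <= e -> chi y = 0 by move=> ye; rewrite chie// it0 oppr0.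
pose U1 y := chi y * winv y.
pose U2 y := chi y * dwinv y + winv y * tau y.
have small y (P : R -> Prop) : (forall z, z < e -> P z) -> y < e -> \near y, P y.
  move=> Pz ye; near=> z; apply: Pz; near: z.
  by apply: open_nbhs_nbhs; split => //; exact: open_lt.
have U2e z : z < e -> U2 z = 0.
  by move=> /ltW ze; rewrite /U2 chie// t0; [rewrite mul0r mulr0 addr0|left].
have dU1 (y : R) : is_derive y (1 : R) U1 (U2 y).
  have [y0|y0] := ltP 0 y.
    apply: (is_derive_mul (f := chi) (g := winv)).
    exact: is_derive_winv.
  have ye : y < e by exact: le_lt_trans e0.
  rewrite (U2e _ ye).
  apply: (near_eq_is_derive (f := cst 0)).
  by apply: small ye => z ze; rewrite /U1 chie ?mul0r// ltW.
have cU2 : continuous U2.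
  move=> y; have [y0|y0] := ltP 0 y.
    have cd := continuous_dwinv y0.
    have cw : {for y, continuous winv}.
      apply: differentiable_continuous; apply/derivable1_diffP.
      by case: (is_derive_winv y0).
    have cchi : {for y, continuous chi}.
      apply: differentiable_continuous; apply/derivable1_diffP.
      by case: (dchi y).
    apply: (@for_continuousD _ _ (fun y => chi y * dwinv y) (fun y => winv y * tau y)).
      exact: for_continuousM.
    apply: for_continuousM => //; exact: ct.
  have ye : y < e by exact: le_lt_trans e0.
  apply: (for_continuous_near (f := cst 0)); last exact: cst_continuous.
  by apply: small ye => z ze; rewrite U2e.
have tU1 : test_fun e M U1.
  split => //; last first.
    by move=> y [ye|My]; rewrite /U1; [rewrite chie|rewrite chiM]; rewrite ?mul0r.
  move=> y; apply: differentiable_continuous; apply/derivable1_diffP.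
  by case: (dU1 y).
have [U [dU UM _]] := antiderivative_test_fun tU1.
have M0 : 0 <= M by rewrite (le_trans _ eM)// ltW.
have UM' y : M < y -> U y = 0 /\ U1 y = 0.
  by move=> My; rewrite UM ?ltW// /U1 chiM ?mul0r// ltW.
have [_] := green_identity a1 Cu hu dU dU1 cU2 M0 UM'.
apply: etrans; apply: eq_integral => x _; congr (_ * _)%:E.
move: (pdist a _) => y; rewrite /radial_laplacian /U1 /U2.
have [ye|ey] := leP y e.
  by rewrite chie// t0; [rewrite !(mul0r, mulr0, addr0)|left].
have y0 : 0 < y := lt_trans e0 ey.
rewrite /winv /dwinv /vpow; set z := y * (1 + y).
have z0 : 0 < z := yy0 y0.
have zn0 : z != 0 by rewrite gt_eqF.
have Er r : z `^ r = z * z `^ (r - 1).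
  transitivity (z `^ (r - 1 + 1)); first by rewrite subrK.
  rewrite powRD; last by rewrite zn0 implybT.
  by rewrite powRr1 ?ltW// mulrC.
rewrite (Er (- (k%:R / 2))) (Er (- (k%:R / 2) - 1)) -(addn2 k) natrD /z; move: (_ `^ _) => t.
by field.
Unshelve. all: by end_near. Qed.

End mean_zero.
Arguments vpow {R} k y.

Section radial_integrals.
Context {R : realType} {k : nat}.
Notation m := k.+2.
Notation leb := (@lebesgue_measure R).
Notation rball := (@unit_ball R m : set (borel 'rV[R]_m)).
Variables (a : 'rV[R]_m).
Hypotheses (a1 : sqnorm a < 1).

Lemma compact_hyp_closed_ball M : 0 <= M -> compact (hyp_closed_ball a M).
Proof.
move=> M0; apply: (subclosed_compact (B := rcube 1)).
- exact: closed_hyp_closed_ball.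
- exact: compact_rcube.
- by apply: (subset_trans (hyp_closed_ball_sub a1 M0)); exact: unit_ball_rcube.
Qed.

Lemma integrable_compact (M : R) (g : 'rV[R]_m -> R) : 0 <= M ->
  (forall x, unit_ball x -> {for x, continuous g}) ->
  mu_ball.-integrable setT (fun x : borel (uball R m) =>
    (g (\val x) * \1_(hyp_closed_ball a M) (\val x))%:E).
Proof.
move=> M0 cg; set Z := hyp_closed_ball a M.
have mB := @measurable_unit_ball R m.
have ZB : Z `<=` unit_ball := hyp_closed_ball_sub a1 M0.
have mZ : measurable (Z : set (borel 'rV[R]_m)).
  by apply: closed_borel_measurable; exact: closed_hyp_closed_ball.
have mg : measurable_fun rball (g : borel 'rV[R]_m -> R).
  apply: (@within_open_borel_measurable R 'rV[R]_m); first exact: open_unit_ball.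
  by move=> x; rewrite inE; exact: cg.
pose h x := g x * \1_Z x.
have mh : measurable_fun rball (h : borel 'rV[R]_m -> R).
  by apply: measurable_funM => //; exact: measurable_indic.
suff ih : lebesgue_rV.-integrable rball (fun v => (h v * (1 - sqnorm v) ^- m)%:E).
  by have [] := @integral_mu_ball_rV R m h mh ih.
pose f v := g v * (1 - sqnorm v) ^- m.
have cf : {within Z, continuous f}.
  apply: continuous_in_subspaceT => x; rewrite inE => /ZB xB.
  apply: (@for_continuousM _ _ g (fun v => (1 - sqnorm v) ^- m)); first exact: cg.
  exact: continuous_density.
have [N fN] : exists N, forall x, Z x -> `|f x| <= N.
  have := continuous_compact cf (compact_hyp_closed_ball M0).
  move=> /compact_bounded[N [_ /(_ (N + 1))]]; rewrite ltrDl ltr01 => /(_ isT) hN.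
  by exists (N + 1) => x xZ; apply: hN; exists x.
have : lebesgue_rV.-integrable (Z : set (borel 'rV[R]_m)) (EFin \o f).
  apply: measurable_bounded_integrable => //.
  - apply: (@le_lt_trans _ _ (lebesgue_rV (@unit_ball R m))).
      by apply: le_measure; rewrite ?inE.
    exact: lebesgue_rV_unit_ball_lty.
  - apply: (@measurable_funS _ _ _ _ rball) => //.
    by apply: measurable_funM => //; exact: measurable_density_rV.
  - exists N; split; first exact: num_real.
    by move=> y Ny x /= xZ; rewrite (le_trans (fN x xZ))// ltW.
rewrite integrable_mkcond// => iZ.
rewrite (_ : (fun v => _) = (EFin \o f) \_ Z); last first.
  apply/funext => x; rewrite patchE /h /f indicE.
  by case: ifPn => xZ; rewrite /= ?mulr1 ?mulr0 ?mul0r.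
exact: integrableS iZ.
Qed.

Lemma indic_hyp_closed_ball M (x : uball R m) :
  \1_(hyp_closed_ball a M) (\val x) = (pdist a (\val x) <= M)%R%:R :> R.
Proof.
rewrite indicE; congr (_ : bool)%:R; apply/idP/idP; rewrite inE /hyp_closed_ball/= /pdist => h.
  by rewrite ler_pdivrMr ?mulr_gt0 ?subr_gt0 ?sqnorm_uball// mulrA.
by move: h; rewrite ler_pdivrMr ?mulr_gt0 ?subr_gt0 ?sqnorm_uball// mulrA.
Qed.

Lemma integrable_radial (M : R) (u : 'rV[R]_m -> R) (phi : R -> R) : 0 <= M ->
  (forall x, unit_ball x -> {for x, continuous u}) -> continuous phi ->
  (forall y, M < y -> phi y = 0) ->
  mu_ball.-integrable setT (fun x : borel (uball R m) =>
    (u (\val x) * phi (pdist a (\val x)))%:E).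
Proof.
move=> M0 cu cphi phiM.
have cg x : unit_ball x -> {for x, continuous (fun x => u x * phi (pdist a x))}.
  move=> xB; apply: for_continuousM; first exact: cu.
  by apply: continuous_comp; [exact: continuous_pdist|exact: cphi].
have := integrable_compact M0 cg.
congr (mu_ball.-integrable _ _); apply/funext => x; congr EFin.
rewrite indic_hyp_closed_ball; case: leP => [_|/phiM ->]; first by rewrite mulr1.
by rewrite !mulr0.
Qed.

Lemma test_funM e M tau (w : R -> R) : test_fun e M tau ->
  (forall y : R, 0 < y -> {for y, continuous w}) ->
  test_fun e M (fun y => tau y * w y).
Proof.
move=> [ct e0 eM t0] cw; split => //; last first.
  by move=> y /t0 ->; rewrite mul0r.
move=> y; have [y0|y0] := ltP 0 y.
  by apply: for_continuousM; [exact: ct|exact: cw].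
apply: (for_continuous_near (f := cst 0)); last exact: cst_continuous.
near=> z; rewrite t0 ?mul0r//; left; apply: ltW; near: z.
apply: open_nbhs_nbhs; split; first exact: open_lt.
exact: le_lt_trans y0 e0.
Unshelve. all: by end_near. Qed.

Lemma test_funZB e M tau e' M' tau' (c : R) : test_fun e M tau -> test_fun e' M' tau' ->
  test_fun (Num.min e e') (Num.max M M') (fun y => tau y - c * tau' y).
Proof.
move=> [ct e0 eM t0] [ct' e0' eM' t0']; split.
- move=> y; apply: (@for_continuousB _ _ tau (fun y => c * tau' y)); first exact: ct.
  by apply: (@for_continuousM _ _ (cst c) tau'); [exact: cvg_cst|exact: ct'].
- by rewrite lt_min e0.
- by rewrite ge_min !le_max eM.
- move=> y; rewrite le_min ge_max => -[/andP[ye ye']|/andP[My My']].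
    by rewrite t0 ?t0' ?mulr0 ?subr0//; left.
  by rewrite t0 ?t0' ?mulr0 ?subr0//; right.
Qed.

Lemma continuous_powR_yy (r y : R) : 0 < y ->
  {for y, continuous (fun z : R => (z * (1 + z)) `^ r)}.
Proof.
move=> y0; have cc (c : R) : {for y, continuous (fun _ : R => c)}.
  exact: for_continuous_cst.
have cid : {for y, continuous (fun z : R => z)} by exact: cvg_id.
apply: (@continuous_comp _ _ _ (fun z : R => z * (1 + z)) (fun z : R => z `^ r)).
  by repeat continuity_step; try exact: cc.
apply: differentiable_continuous; apply/derivable1_diffP.
by case: (is_derive1_powR r (_ : 0 < y * (1 + y))) => //; rewrite mulr_gt0// addr_gt0.
Qed.

Section proportionality.
Variable u : 'rV[R]_m -> R.
Hypotheses (Cu : C2_on unit_ball u)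
  (hu : forall x, unit_ball x -> hyp_laplacian u x = 0).
Notation radial_int f tau :=
  (\int[mu_ball]_x (f (\val x) * (tau (pdist a (\val x)) * vpow k (pdist a (\val x))))%R)%R.

Lemma continuous_of_C2 x : unit_ball x -> {for x, continuous u}.
Proof. by move=> xB; have [] := Cu xB. Qed.

Lemma integrable_test_fun_radial e M tau : test_fun e M tau ->
  mu_ball.-integrable setT (fun x : borel (uball R m) =>
    (u (\val x) * (tau (pdist a (\val x)) * vpow k (pdist a (\val x))))%:E).
Proof.
move=> tt; have [ct e0 eM t0] := test_funM tt (fun y => @continuous_powR_yy (- (k%:R / 2)) y).
apply: (integrable_radial (M := M) (phi := fun y => tau y * vpow k y)) => //.
- by rewrite (le_trans _ eM)// ltW.
- by move=> x xB; exact: continuous_of_C2.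
- by move=> y My; rewrite t0//; right; exact: ltW.
Qed.

(** A linear functional that kills the functions of mean zero is a multiple of
    the integral. *)
Lemma radial_int_proportional e M tau e' M' tau' :
  test_fun e M tau -> test_fun e' M' tau' ->
  (\int[leb]_y tau' y)%R != 0 ->
  radial_int u tau =
    (\int[leb]_y tau y / \int[leb]_y tau' y)%R * radial_int u tau'.
Proof.
move=> tt tt' I0; set c := (_ / _)%R.
have ts := test_funZB c tt tt'.
have it := integrable_test_fun tt; have it' := integrable_test_fun tt'.
have Is : (\int[leb]_y (tau y - c * tau' y))%R = 0.
  rewrite RintegralB//; last by have := integrableZl measurableT c it'.
  by rewrite RintegralZl// /c mulfVK// subrr.
have := integral_test_fun_eq0 a1 Cu hu ts Is.
have J := integrable_test_fun_radial tt; have J' := integrable_test_fun_radial tt'.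
move=> /(congr1 fine)/= E; apply/eqP; rewrite -subr_eq0 -RintegralZl//.
rewrite -RintegralB//; last by have := integrableZl measurableT c J'.
rewrite -[X in _ == X]E /Rintegral; apply/eqP; congr fine.
by apply: eq_integral => x _; congr EFin; rewrite mulrBl mulrBr; ring.
Qed.

End proportionality.

End radial_integrals.

Section positive_integrals.
Context {R : realType}.
Local Open Scope ereal_scope.

Lemma integral_gt0 d (T : measurableType d) (mu : {measure set T -> \bar R})
    (g : T -> R) (D : set T) (c : R) :
  measurable_fun setT g -> (forall x, 0 <= g x)%R -> measurable D -> (0 < c)%R ->
  (forall x, D x -> c <= g x)%R -> 0 < mu D -> 0 < \int[mu]_x (g x)%:E.
Proof.
move=> mg g0 mD c0 gc muD.
have mgE : measurable_fun setT (EFin \o g) by exact/measurable_EFinP.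
apply: (@lt_le_trans _ _ (\int[mu]_(x in D) (g x)%:E)); last first.
  by apply: ge0_subset_integral => // x _; rewrite lee_fin.
apply: (@lt_le_trans _ _ (\int[mu]_(x in D) (cst c%:E x))).
  by rewrite integral_cst// mule_gt0.
apply: ge0_le_integral => //.
- by move=> x _; rewrite lee_fin ltW.
- exact: measurable_funTS.
Qed.

Lemma mu_ball_open_gt0 m (D : set (uball R m)) : open D -> D !=set0 ->
  0 < mu_ball (D : set (borel (uball R m))).
Proof.
move=> oD [x0 Dx0]; have [W oW WD] := oD; move: (WD) => <-.
have mD : measurable (D : set (borel (uball R m))) by exact: open_borel_measurable.
apply: (@lt_le_trans _ _ (Vm (D : set (borel (uball R m))))).
  rewrite /Vm -WD uball_val_image mule_gt0 ?lte_fin ?ball_scale_gt0//.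
  apply: lebesgue_rV_open_gt0; first by apply: openI => //; exact: open_unit_ball.
  exists (\val x0); split; last by rewrite unit_ballE; exact: sqnorm_uball.
  by move: Dx0; rewrite -WD.
rewrite WD /mu_ball -(mul1e (Vm _)) -integral_cst//.
have md : measurable_fun setT (fun x : borel (uball R m) => ((1 - sqnorm (\val x)) ^- m)%:E).
  apply/measurable_EFinP.
  by apply: (uball_continuous_measurable (g := fun x => (1 - sqnorm x) ^- m)) => v; exact: continuous_density.
apply: ge0_le_integral => //.
  exact: measurable_funTS.
move=> x _; rewrite lee_fin invf_ge1 ?exprn_gt0 ?uball_1Bsqnorm_gt0//.
apply: exprn_ile1; last by rewrite gerBl sqnorm_ge0.
by rewrite ltW// uball_1Bsqnorm_gt0.
Qed.

End positive_integrals.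

Section tent.
Context {R : realType}.
Notation leb := (@lebesgue_measure R).

Definition tent (e M y : R) : R := Num.max 0 (Num.min (y - e) (M - y)).

Lemma test_fun_tent (e M : R) : 0 < e -> e <= M -> test_fun e M (tent e M).
Proof.
move=> e0 eM; split => //.
  move=> y; have cc (r : R) : {for y, continuous (fun _ : R => r)}.
    exact: for_continuous_cst.
  have cid : {for y, continuous (fun z : R => z)} by exact: cvg_id.
  suff : {for y, continuous (fun z : R => Num.max 0 (Num.min (z - e) (M - z)))} by [].
  by repeat continuity_step; try exact: cc.
move=> y yeM; apply/max_idPl; rewrite ge_min !subr_le0.
by apply/orP; case: yeM; [left|right].
Qed.

Lemma tent_ge0 e M y : 0 <= tent e M y.
Proof. by rewrite le_max lexx. Qed.

Lemma tent_gt0 e M y : e < y < M -> 0 < tent e M y.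
Proof. by move=> /andP[ey yM]; rewrite lt_max lt_min !subr_gt0 ey yM orbT. Qed.

Lemma integral_tent_gt0 (e M : R) : 0 < e -> e < M -> 0 < (\int[leb]_y tent e M y)%R.
Proof.
move=> e0 eM; have tt := test_fun_tent e0 (ltW eM).
have it := integrable_test_fun tt; have [ct _ _ _] := tt.
rewrite /Rintegral fine_gt0//; apply/andP; split; last first.
  exact: integrable_lty it.
pose d := (M - e) / 4; have d0 : 0 < d by rewrite divr_gt0// subr_gt0.
apply: (@integral_gt0 R _ _ lebesgue_measure (tent e M) `[e + d, M - d]%classic d) => //.
- exact: continuous_measurable_fun.
- by move=> y; exact: tent_ge0.
- move=> y /=; rewrite in_itv/= => /andP[y1 y2].
  by rewrite le_max le_min lerBrDl y1 lerBrDr -lerBrDl y2 orbT.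
- rewrite /= lebesgue_measure_itv/= lte_fin ifT -?EFinB ?lte_fin; rewrite /d; lra.
Qed.

End tent.

Section volume_constant.
Context {R : realType} {k : nat}.
Notation m := k.+2.
Notation leb := (@lebesgue_measure R).
Variables (a : 'rV[R]_m).
Hypotheses (a1 : sqnorm a < 1).
Notation radial_int f tau :=
  (\int[mu_ball]_x (f (\val x) * (tau (pdist a (\val x)) * vpow k (pdist a (\val x))))%R)%R.

Lemma partial_cst i (c : R) : partial i (fun _ : 'rV[R]_m => c) = fun=> 0.
Proof. by apply/funext => x; rewrite /partial; exact: derive_cst. Qed.

Lemma C2_cst (U : set 'rV[R]_m) (c : R) : C2_on U (fun=> c).
Proof.
move=> x Ux; split.
- exact: cst_continuous.
- move=> i; rewrite partial_cst; split; last exact: cst_continuous.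
  exact: derivable_cst.
- move=> i j; rewrite !partial_cst; split; last exact: cst_continuous.
  exact: derivable_cst.
Qed.

Lemma hyp_laplacian_cst (c : R) (x : 'rV[R]_m) : hyp_laplacian (fun=> c) x = 0.
Proof.
rewrite /hyp_laplacian; rewrite !big1 ?mulr0 ?addr0// => i _.
  by rewrite partial_cst mulr0.
by rewrite partial_cst partial_cst.
Qed.

Lemma pdist_ge0 (x : uball R m) : 0 <= pdist a (\val x).
Proof.
by rewrite divr_ge0 ?sqnorm_ge0// mulr_ge0// ltW// ?uball_1Bsqnorm_gt0// subr_gt0.
Qed.

Lemma measurable_radial (phi : R -> R) : measurable_fun setT phi ->
  measurable_fun setT (fun x : borel (uball R m) => phi (pdist a (\val x))).
Proof.
move=> mphi; apply: measurableT_comp => //.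
by apply: (uball_continuous_measurable (g := pdist a)) => v; exact: continuous_pdist.
Qed.

Lemma vpow_ge0 (y : R) : 0 <= vpow k y.
Proof. exact: powR_ge0. Qed.

Lemma vpow_gt0 (y : R) : 0 < y -> 0 < vpow k y.
Proof. by move=> y0; rewrite powR_gt0// mulr_gt0// addr_gt0. Qed.

(** With constant integrand the proportionality factor is the volume constant
    of hyperbolic polar coordinates. *)
Lemma volume_constant : exists2 c : R, 0 < c &
  forall e M tau, test_fun e M tau ->
    radial_int (fun=> 1) tau = c * (\int[leb]_y tau y)%R.
Proof.
have [x0 xB xa] : exists2 x0 : 'rV[R]_m, unit_ball x0 & x0 != a.
  have [->|a0] := eqVneq a 0; last first.
    exists 0; last by rewrite eq_sym.
    by have := @unit_ball0 R m; rewrite inE.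
  exists (2^-1 *: delta_mx ord0 ord0).
    rewrite unit_ballE /sqnorm (bigD1 ord0)//= big1 => [|i /negbTE i0].
      by rewrite !mxE !eqxx/=; lra.
    by rewrite !mxE i0 mulr0 expr0n.
  apply/eqP => /rowP/(_ ord0); rewrite !mxE eqxx/= mulr1 => /eqP.
  by rewrite invr_eq0 pnatr_eq0.
pose z0 : uball R m := exist _ x0 (mem_set xB).
pose y0 := pdist a x0.
have y00 : 0 < y0.
  rewrite /y0 /pdist divr_gt0//.
    rewrite lt_neqAle sqnorm_ge0 andbT eq_sym.
    apply: contra xa => /eqP s0; apply/eqP/rowP => j.
    apply/eqP; rewrite -subr_eq0 -[_ == 0]sqrf_eq0 eq_le sqr_ge0 andbT -s0.
    by have := coord_le_sqnorm (x0 - a) j; rewrite !mxE.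
  by rewrite mulr_gt0 ?subr_gt0// -unit_ballE.
pose t0 := tent (y0 / 2) (2 * y0).
have t1 : 0 < y0 / 2 by rewrite divr_gt0.
have t2 : y0 / 2 < 2 * y0 by lra.
have tt : test_fun (y0 / 2) (2 * y0) t0 by apply: test_fun_tent => //; exact: ltW.
have I0 : 0 < (\int[leb]_y t0 y)%R by exact: integral_tent_gt0.
have J0 : 0 < radial_int (fun=> 1) t0.
  pose g (x : uball R m) := 1 * (t0 (pdist a (\val x)) * vpow k (pdist a (\val x))).
  have ig : mu_ball.-integrable setT (EFin \o g : borel (uball R m) -> \bar R).
    exact: (integrable_test_fun_radial a1 (@C2_cst _ 1) tt).
  have mg : measurable_fun setT (g : borel (uball R m) -> R).
    by apply/measurable_EFinP; exact: measurable_int ig.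
  have g0 x : 0 <= g x by rewrite /g mul1r mulr_ge0 ?vpow_ge0 ?tent_ge0.
  have gz0 : 0 < g z0.
    rewrite /g mul1r mulr_gt0 ?vpow_gt0//.
    by apply: tent_gt0; rewrite /= -/y0; lra.
  have cg : continuous g.
    move=> x; have [ct _ _ _] := test_funM tt (fun y => @continuous_powR_yy R (- (k%:R / 2)) y).
    rewrite (_ : g = (fun y => t0 y * (y * (1 + y)) `^ (- (k%:R / 2))) \o (fun x : uball R m => pdist a (\val x))).
      apply: continuous_comp; last exact: ct.
      apply: continuous_comp; first exact: continuous_uball_val.
      by apply: continuous_pdist; rewrite unit_ballE; exact: sqnorm_uball.
    by apply/funext => y; rewrite /g mul1r.
  rewrite /Rintegral fine_gt0// (integrable_lty _ ig)// andbT.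
  have oD : open [set x | g z0 / 2 < g x].
    rewrite (_ : [set x | _] = g @^-1` [set y | g z0 / 2 < y])//.
    by apply: open_comp => [x _|]; [exact: cg|exact: open_gt].
  apply: (@integral_gt0 R _ _ mu_ball g [set x | g z0 / 2 < g x] (g z0 / 2)) => //.
  - exact: open_borel_measurable.
  - by rewrite divr_gt0.
  - by move=> x /= /ltW.
  - apply: mu_ball_open_gt0 => //; exists z0 => /=; lra.
exists (radial_int (fun=> 1) t0 / (\int[leb]_y t0 y)%R); first by rewrite divr_gt0.
move=> e M tau ttau.
rewrite (radial_int_proportional a1 (@C2_cst _ 1) (fun x _ => hyp_laplacian_cst 1 x) ttau tt) ?gt_eqF//.
by rewrite mulrAC [RHS]mulrC mulrA.
Qed.

End volume_constant.

Section mean_value_test.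
Context {R : realType} {k : nat}.
Notation m := k.+2.
Notation leb := (@lebesgue_measure R).
Variables (a : 'rV[R]_m) (u : 'rV[R]_m -> R).
Hypotheses (a1 : sqnorm a < 1) (Cu : C2_on unit_ball u)
  (hu : forall x, unit_ball x -> hyp_laplacian u x = 0).
Notation radial_int f tau :=
  (\int[mu_ball]_x (f (\val x) * (tau (pdist a (\val x)) * vpow k (pdist a (\val x))))%R)%R.

Lemma pdist_small (eta : R) : 0 < eta -> exists2 del, 0 < del &
  forall x : uball R m, pdist a (\val x) < del -> `|u (\val x) - u a| <= eta.
Proof.
move=> eta0; have aB : unit_ball a by rewrite unit_ballE.
have [cu _ _] := Cu aB.
have /nbhs_ballP[e /= e0 eu] : \forall x \near a, `|u a - u x| <= eta.
  by move/cvgrPdist_le : cu => /(_ _ eta0).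
exists (e ^+ 2); first by rewrite exprn_gt0.
move=> x; rewrite /pdist ltr_pdivrMr ?mulr_gt0 ?subr_gt0 ?sqnorm_uball// => h.
rewrite distrC; apply: eu; split => // i j; rewrite (ord1 i) -ball_normE /=.
rewrite -(@ltr_pXn2r _ 2)// ?nnegrE ?(ltW e0)// distrC real_normK ?num_real//.
apply: le_lt_trans (_ : sqnorm (\val x - a) < _).
  by have := coord_le_sqnorm (\val x - a) j; rewrite !mxE.
apply: (lt_le_trans h); rewrite ger_pMr ?exprn_gt0//.
rewrite mulr_ile1 ?gerBl ?sqnorm_ge0 ?subr_ge0//; first exact: ltW.
by rewrite ltW// sqnorm_uball.
Qed.

(** The proportionality factor is found with test functions concentrated near 0,
    where x is close to a and u is almost constant. *)
Lemma mean_value_test_fun e M tau : test_fun e M tau ->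
  radial_int u tau = u a * radial_int (fun=> 1) tau.
Proof.
move=> tt; have [c c0 cE] := @volume_constant R k a a1.
rewrite (cE _ _ _ tt).
pose t1 : R -> R := tent 1 2.
have tt1 : test_fun 1 2 t1 by apply: test_fun_tent; lra.
have I1 : 0 < (\int[leb]_y t1 y)%R by apply: integral_tent_gt0; lra.
pose d := radial_int u t1 / (\int[leb]_y t1 y)%R.
have dE e' M' tau' : test_fun e' M' tau' -> radial_int u tau' = d * (\int[leb]_y tau' y)%R.
  move=> tt'; rewrite (radial_int_proportional a1 Cu hu tt' tt1) ?gt_eqF//.
  by rewrite mulrAC [RHS]mulrC mulrA.
rewrite (dE _ _ _ tt) mulrA; congr (_ * _); apply/eqP; rewrite -subr_eq0 -normr_le0.
apply/ler_addgt0Pr => eps eps0; rewrite add0r.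
have [|del del0 udel] := @pdist_small (eps / c); first by rewrite divr_gt0.
pose t2 : R -> R := tent (del / 2) del.
have del2 : 0 < del / 2 by rewrite divr_gt0.
have del2' : del / 2 < del by lra.
have tt2 : test_fun (del / 2) del t2 by apply: test_fun_tent => //; exact: ltW.
have I2 : 0 < (\int[leb]_y t2 y)%R by exact: integral_tent_gt0.
rewrite -(ler_pM2r I2) -[X in _ * X](gtr0_norm I2) -normrM mulrBl -(dE _ _ _ tt2) -mulrA -(cE _ _ _ tt2).
have iu := integrable_test_fun_radial a1 Cu tt2.
have i1 := integrable_test_fun_radial a1 (@C2_cst R k unit_ball 1) tt2.
rewrite -RintegralZl// -RintegralB//; last by have := integrableZl measurableT (u a) i1.
apply: (le_trans (le_normr_Rintegral _ _)) => //.
  by have := integrableB measurableT iu (integrableZl measurableT (u a) i1).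
apply: (@le_trans _ _ (\int[mu_ball]_(x in setT) (eps / c *
    (1 * (t2 (pdist a (\val x)) * vpow k (pdist a (\val x))))))%R); last first.
  by rewrite RintegralZl// (cE _ _ _ tt2) mulrA divfK// gt_eqF.
apply: le_Rintegral => //.
- have := integrableB measurableT iu (integrableZl measurableT (u a) i1).
  by move=> /integrable_norm.
- by have := integrableZl measurableT (eps / c) i1.
move=> x _; have w0 : 0 <= t2 (pdist a (\val x)) * vpow k (pdist a (\val x)).
  by rewrite mulr_ge0 ?vpow_ge0 ?tent_ge0.
rewrite mul1r -mulrBl normrM (ger0_norm w0).
have [xd|xd] := ltP (pdist a (\val x)) del.
  by rewrite ler_wpM2r ?udel.
have [_ _ _ t20] := tt2.
by rewrite t20 ?mul0r ?mulr0//; right.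
Qed.

End mean_value_test.
(** * Hyperbolic distance and shells *)

Section hyperbolic_distance.
Context {R : realType} {m : nat}.
Implicit Types a x : 'rV[R]_m.

Definition dotp a x : R := \sum_i a ord0 i * x ord0 i.

Lemma sqnormZ (c : R) x : sqnorm (c *: x) = c ^+ 2 * sqnorm x.
Proof.
by rewrite /sqnorm mulr_sumr; apply: eq_bigr => i _; rewrite !mxE exprMn.
Qed.

Lemma sqnorm_lin (c d : R) a x :
  sqnorm (c *: a + d *: x) = c ^+ 2 * sqnorm a + 2 * c * d * dotp a x + d ^+ 2 * sqnorm x.
Proof.
rewrite /sqnorm /dotp !mulr_sumr -!big_split/=; apply: eq_bigr => i _.
by rewrite !mxE; ring.
Qed.

Lemma sqnormB a x : sqnorm (x - a) = sqnorm x - 2 * dotp a x + sqnorm a.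
Proof.
have := sqnorm_lin (-1) 1 a x; rewrite scale1r scaleN1r [- a + x]addrC => ->.
ring.
Qed.

Definition psi_den a x : R := sqnorm (x - a) + (1 - sqnorm a) * (1 - sqnorm x).

Lemma psi_den_gt a x : sqnorm a < 1 -> sqnorm x < 1 ->
  (1 - sqnorm a) ^+ 2 / 4 <= psi_den a x.
Proof.
move=> a1 x1.
(* Weighted arithmetic-geometric mean for the scalar product, with a weight
   strictly between the squared norm of a and 1. *)
pose s := (1 + sqnorm a) / 2.
have s0 : 0 < s by rewrite divr_gt0// ltr_wpDr// sqnorm_ge0.
have := sqnorm_ge0 ((- s^-1) *: a + 1 *: x).
rewrite sqnorm_lin => h.
have {}h : 2 * dotp a x <= s^-1 * sqnorm a + s * sqnorm x.
  have := mulr_ge0 (ltW s0) h.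
  have -> : s * ((- s^-1) ^+ 2 * sqnorm a + 2 * - s^-1 * 1 * dotp a x + 1 ^+ 2 * sqnorm x)
    = s^-1 * sqnorm a + s * sqnorm x - 2 * dotp a x by field; rewrite gt_eqF.
  by rewrite subr_ge0.
rewrite /psi_den sqnormB.
have x0 := sqnorm_ge0 x; have a0 := sqnorm_ge0 a.
have sx : s * sqnorm x - sqnorm a * sqnorm x <= s - sqnorm a.
  by rewrite -mulrBl ger_pMr ?ltW//; rewrite /s; lra.
have E : 1 - s^-1 * sqnorm a - s + sqnorm a = (1 - sqnorm a) ^+ 2 / 4 / s.
  by rewrite /s; field; rewrite gt_eqF//; lra.
have : (1 - sqnorm a) ^+ 2 / 4 <= (1 - sqnorm a) ^+ 2 / 4 / s.
  rewrite ler_pdivlMr// ger_pMr ?divr_gt0 ?exprn_gt0 ?subr_gt0//.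
  by rewrite /s; lra.
by rewrite -E; nra.
Qed.

Lemma psi_den_gt0 a x : sqnorm a < 1 -> sqnorm x < 1 -> 0 < psi_den a x.
Proof.
move=> a1 x1; apply: lt_le_trans (psi_den_gt a1 x1).
by rewrite divr_gt0// exprn_gt0// subr_gt0.
Qed.

Lemma sqnorm_psi a x : sqnorm a < 1 -> sqnorm x < 1 ->
  sqnorm (psi a x) = sqnorm (x - a) / psi_den a x.
Proof.
move=> a1 x1; have D0 := psi_den_gt0 a1 x1.
rewrite /psi sqnormZ -/(psi_den a x).
have -> : sqnorm (x - a) *: a + (1 - sqnorm a) *: (a - x) =
    (sqnorm (x - a) + (1 - sqnorm a)) *: a + (- (1 - sqnorm a)) *: x.
  by rewrite scalerBr [in RHS]scalerDl scaleNr addrA.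
rewrite sqnorm_lin.
suff -> : (sqnorm (x - a) + (1 - sqnorm a)) ^+ 2 * sqnorm a +
    2 * (sqnorm (x - a) + (1 - sqnorm a)) * - (1 - sqnorm a) * dotp a x +
    (- (1 - sqnorm a)) ^+ 2 * sqnorm x = sqnorm (x - a) * psi_den a x.
  by field; rewrite gt_eqF.
by rewrite /psi_den sqnormB; ring.
Qed.

End hyperbolic_distance.

Section distance_profile.
Context {R : realType}.

(** exp of the hyperbolic distance, as a function of pdist; the absolute
    values make it continuous on the whole line. *)
Definition exp_dist (y : R) : R := (Num.sqrt (1 + `|y|) + Num.sqrt `|y|) ^+ 2.

Lemma continuous_exp_dist : continuous exp_dist.
Proof.
move=> y; have cn : {for y, continuous (fun z : R => `|z|)} by exact: norm_continuous.
have cs (f : R -> R) : {for y, continuous f} -> {for y, continuous (fun z => Num.sqrt (f z))}.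
  by move=> cf; apply: (@continuous_comp _ _ _ f Num.sqrt) => //; exact: sqrt_continuous.
apply: (@for_continuousX _ _ (fun z => Num.sqrt (1 + `|z|) + Num.sqrt `|z|)).
apply: (@for_continuousD _ _ (fun z => Num.sqrt (1 + `|z|)) (fun z => Num.sqrt `|z|)).
  apply: (cs (fun z => 1 + `|z|)).
  by apply: (@for_continuousD _ _ (cst 1) (fun z => `|z|)) => //; exact: cst_continuous.
exact: (cs (fun z => `|z|)).
Qed.

Lemma exp_dist_ge (y : R) : 0 <= y -> 1 + y <= exp_dist y.
Proof.
move=> y0; rewrite /exp_dist ger0_norm//.
rewrite -{1}(sqr_sqrtr (_ : 0 <= 1 + y)) ?addr_ge0// ler_pXn2r ?nnegrE ?addr_ge0 ?sqrtr_ge0//.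
by rewrite lerDl sqrtr_ge0.
Qed.

Lemma exp_dist_le (y : R) : 0 <= y -> exp_dist y <= 4 * (1 + y).
Proof.
move=> y0; rewrite /exp_dist ger0_norm//.
have s1 : 0 <= Num.sqrt (1 + y) by exact: sqrtr_ge0.
have s2 : Num.sqrt y <= Num.sqrt (1 + y) by rewrite ler_wsqrtr// lerDr.
have sE : Num.sqrt (1 + y) ^+ 2 = 1 + y by rewrite sqr_sqrtr// addr_ge0.
rewrite -[X in 4 * X]sE; have := sqrtr_ge0 y; nra.
Qed.

Lemma exp_dist_gt0 (y : R) : 0 < exp_dist y.
Proof.
by rewrite exprn_gt0// ltr_wpDr ?sqrtr_ge0// sqrtr_gt0.
Qed.

Lemma ltr_exp_dist (y z : R) : 0 <= y -> y < z -> exp_dist y < exp_dist z.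
Proof.
move=> y0 yz; have z0 : 0 < z := le_lt_trans y0 yz.
rewrite /exp_dist ger0_norm// gtr0_norm//.
rewrite ltr_pXn2r// ?nnegrE ?addr_ge0 ?sqrtr_ge0//.
by rewrite ltrD// ltr_sqrt ?ltrD2l// addr_gt0.
Qed.

Lemma ler_exp_dist (y z : R) : 0 <= y -> 0 <= z -> (exp_dist y <= exp_dist z) = (y <= z).
Proof.
move=> y0 z0; apply/idP/idP; last first.
  by rewrite le_eqVlt => /predU1P[->//|/(ltr_exp_dist y0)/ltW].
by apply: contraTT; rewrite -!ltNge; exact: ltr_exp_dist.
Qed.

(** The value of pdist at hyperbolic distance t, the square of sinh (t / 2). *)
Definition shell_radius (t : R) : R := ((expR (t / 2) - expR (- (t / 2))) / 2) ^+ 2.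

Lemma shell_radius_ge0 t : 0 <= shell_radius t.
Proof. exact: sqr_ge0. Qed.

Lemma exp_dist_shell_radius t : 0 <= t -> exp_dist (shell_radius t) = expR t.
Proof.
move=> t0; rewrite /exp_dist (ger0_norm (shell_radius_ge0 t)) /shell_radius.
set E := expR (t / 2); have E0 : 0 < E := expR_gt0 _.
rewrite expRN -/E.
have E1 : 1 <= E by rewrite -expR0 ler_expR divr_ge0.
have E2 : 0 <= E - E^-1.
  by rewrite subr_ge0 invf_ple ?posrE// (le_trans _ E1)// invf_le1.
have -> : 1 + ((E - E^-1) / 2) ^+ 2 = ((E + E^-1) / 2) ^+ 2.
  by field; rewrite gt_eqF.
have n1 : 0 <= (E + E^-1) / 2 by rewrite divr_ge0// addr_ge0 ?invr_ge0 ?(ltW E0).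
have n2 : 0 <= (E - E^-1) / 2 by rewrite divr_ge0.
rewrite !sqrtr_sqr (ger0_norm n1) (ger0_norm n2).
have -> : (E + E^-1) / 2 + (E - E^-1) / 2 = E by field; rewrite gt_eqF.
by rewrite /E expr2 -expRD -splitr.
Qed.

End distance_profile.

Section uball_distance.
Context {R : realType} {k : nat}.
Notation m := k.+2.
Variables a : uball R m.
Implicit Types x : uball R m.
Notation p x := (pdist (\val a) (\val x)).

Lemma sqnorm_psi_pdist x : sqnorm (psi (\val a) (\val x)) = p x / (1 + p x).
Proof.
have a1 := sqnorm_uball a; have x1 := sqnorm_uball x.
have D0 := psi_den_gt0 a1 x1; rewrite sqnorm_psi// /pdist.
have e1 : 1 - sqnorm (\val a) != 0 by rewrite gt_eqF// subr_gt0.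
have e2 : 1 - sqnorm (\val x) != 0 by rewrite gt_eqF// subr_gt0.
move: D0; rewrite /psi_den => D0.
by field; rewrite e1 e2 !gt_eqF// addrC.
Qed.

Lemma p_ge0 x : 0 <= p x.
Proof. by apply: pdist_ge0; exact: sqnorm_uball. Qed.

Lemma expR_dh x : expR (dh (\val a) (\val x)) = exp_dist (p x).
Proof.
have p0 := p_ge0 x.
rewrite /dh /enorm sqnorm_psi_pdist sqrtrM// sqrtrV ?addr_ge0//.
rewrite /exp_dist (ger0_norm p0).
set t := Num.sqrt (p x); set w := Num.sqrt (1 + p x).
have w0 : 0 < w by rewrite sqrtr_gt0 ltr_wpDr.
have t0 : 0 <= t by exact: sqrtr_ge0.
have tw : t < w by rewrite ltr_sqrt ?ltrDr// ltr_wpDr.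
have wt1 : w ^+ 2 - t ^+ 2 = 1 by rewrite !sqr_sqrtr ?addr_ge0// addrK.
have w1 : 0 < 1 + t / w by rewrite ltr_wpDr// divr_ge0// ltW.
have w2 : 0 < 1 - t / w by rewrite subr_gt0 ltr_pdivrMr ?mul1r.
rewrite lnK ?posrE ?divr_gt0//.
have wn : w != 0 by rewrite gt_eqF.
have wtn : w - t != 0 by rewrite gt_eqF// subr_gt0.
have -> : (1 + t / w) / (1 - t / w) = (w + t) / (w - t) by field; rewrite wtn wn.
apply: (mulIf wtn); rewrite divfK//.
by rewrite -[LHS]mulr1 -wt1; ring.
Qed.

Lemma dh_ge0 x : 0 <= dh (\val a) (\val x).
Proof.
rewrite -ler_expR expR0 expR_dh (le_trans _ (exp_dist_ge (p_ge0 x)))//.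
by rewrite lerDl p_ge0.
Qed.

Lemma le_dh (t : R) x : 0 <= t -> (t <= dh (\val a) (\val x)) = (shell_radius t <= p x).
Proof.
move=> t0; rewrite -(ler_expR t) expR_dh -(exp_dist_shell_radius t0).
by rewrite ler_exp_dist// ?shell_radius_ge0// p_ge0.
Qed.

Lemma weightE s x : weight s a x = exp_dist (p x) `^ (- s).
Proof. by rewrite /weight -expR_dh /powR gt_eqF ?expR_gt0// expRK. Qed.

Lemma weight_gt0 s x : 0 < weight s a x.
Proof. exact: expR_gt0. Qed.

(** Moving the centre of the distance from 0 to a costs a constant factor. *)
Lemma expRN_dh_le x :
  expR (- dh (\val a) (\val x)) <= 4 / (1 - sqnorm (\val a)) * (1 - sqnorm (\val x)).
Proof.
have a1 := sqnorm_uball a; have x1 := sqnorm_uball x.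
have D0 := psi_den_gt0 a1 x1; have D := psi_den_gt a1 x1.
set A := 1 - sqnorm (\val a) in D *; set B := 1 - _.
have A0 : 0 < A by rewrite subr_gt0.
have B0 : 0 < B by rewrite subr_gt0.
rewrite expRN expR_dh.
have E1 : 1 + p x = psi_den (\val a) (\val x) / (A * B).
  by rewrite /pdist /psi_den -/A -/B; field; rewrite !gt_eqF.
apply: (@le_trans _ _ (1 + p x)^-1).
  by rewrite lef_pV2 ?posrE ?exp_dist_gt0 ?ltr_wpDr ?p_ge0// exp_dist_ge ?p_ge0.
rewrite E1 invf_div ler_pdivrMr//.
have -> : A * B = 4 / A * B * (A ^+ 2 / 4) by field; rewrite gt_eqF.
by rewrite ler_wpM2l// mulr_ge0 ?divr_ge0// ltW.
Qed.

End uball_distance.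

Section ramps.
Context {R : realType}.

Definition clamp (y : R) : R := Num.max 0 (Num.min y 1).

Lemma clamp_ge0 y : 0 <= clamp y. Proof. by rewrite le_max lexx. Qed.

Lemma clamp_le1 y : clamp y <= 1.
Proof. by rewrite ge_max ler01 ge_min lexx orbT. Qed.

Lemma clamp0 (y : R) : y <= 0 -> clamp y = 0.
Proof. by move=> y0; apply/max_idPl; rewrite ge_min y0. Qed.

Lemma clamp1 (y : R) : 1 <= y -> clamp y = 1.
Proof. by move=> y1; rewrite /clamp (min_idPr y1); apply/max_idPr. Qed.

Lemma continuous_clamp : continuous clamp.
Proof.
move=> y; have cc (r : R) : {for y, continuous (fun _ : R => r)}.
  exact: for_continuous_cst.
have cid : {for y, continuous (fun z : R => z)} by exact: cvg_id.
suff : {for y, continuous (fun z : R => Num.max 0 (Num.min z 1))} by [].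
by repeat continuity_step; try exact: cc.
Qed.

Lemma continuous_clamp_affine (c d : R) : continuous (fun y => clamp (c * y + d)).
Proof.
move=> y; apply: (@continuous_comp _ _ _ (fun z => c * z + d) clamp); last exact: continuous_clamp.
have cc (r : R) : {for y, continuous (fun _ : R => r)}.
  exact: for_continuous_cst.
have cid : {for y, continuous (fun z : R => z)} by exact: cvg_id.
by repeat continuity_step; try exact: cc.
Qed.

(** Continuous functions with compact support in the open half-line, that
    converge to the indicator of [al, be[ there. *)
Definition ramp (al be : R) (n : nat) (y : R) : R :=
  clamp (n.+1%:R * y + (1 - n.+1%:R * al)) * clamp (n.+1%:R * y + (- 1)) *
  clamp (- n.+1%:R * y + n.+1%:R * be).

Lemma ramp_ge0 al be n y : 0 <= ramp al be n y.
Proof. by rewrite !mulr_ge0// clamp_ge0. Qed.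

Lemma ramp_le1 al be n y : ramp al be n y <= 1.
Proof. by rewrite !mulr_ile1// ?mulr_ge0 ?clamp_ge0 ?clamp_le1. Qed.

Lemma ramp_out (al be : R) n (y : R) : y <= n.+1%:R^-1 \/ be <= y -> ramp al be n y = 0.
Proof.
case=> h; rewrite /ramp.
  rewrite [X in _ * X * _]clamp0 ?mulr0 ?mul0r// subr_le0.
  by rewrite -ler_pdivlMl// mulr1.
rewrite [X in _ * X]clamp0 ?mulr0// mulNr addrC subr_le0.
by rewrite ler_wpM2l.
Qed.

Lemma test_fun_ramp al be n (h : R -> R) : continuous h ->
  test_fun n.+1%:R^-1 (Num.max n.+1%:R^-1 be) (fun y => h y * ramp al be n y).
Proof.
move=> ch; split.
- move=> y; apply: (@for_continuousM _ _ h (ramp al be n)); first exact: ch.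
  suff : {for y, continuous (fun y : R => clamp (n.+1%:R * y + (1 - n.+1%:R * al)) *
      clamp (n.+1%:R * y + (- 1)) * clamp (- n.+1%:R * y + n.+1%:R * be))} by [].
  by repeat continuity_step; exact: continuous_clamp_affine.
- by rewrite invr_gt0.
- by rewrite le_max lexx.
- move=> y [ye|]; first by rewrite ramp_out ?mulr0//; left.
  by rewrite ge_max => /andP[_ My]; rewrite ramp_out ?mulr0//; right.
Qed.

Lemma near_ge_mulS (c d : R) : 0 < d -> \forall n \near \oo, c <= n.+1%:R * d.
Proof.
move=> d0; near=> n; rewrite -ler_pdivrMr//.
apply: (@le_trans _ _ n%:R); last by rewrite ler_nat.
by near: n; exact: nbhs_infty_ger.
Unshelve. all: by end_near. Qed.

Lemma cvg_ramp (al be y : R) : 0 < y ->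
  ramp al be n y @[n --> \oo] --> ((al <= y < be)%R%:R : R).
Proof.
move=> y0; apply: cvg_near_cst.
have [be_y|y_be] := leP be y.
  by near=> n; rewrite andbF ramp_out//; right.
rewrite andbT; have [al_y|y_al] := leP al y; last first.
  have h : 0 < al - y by rewrite subr_gt0.
  near=> n; rewrite /ramp clamp0 ?mul0r//.
  have : 1 <= n.+1%:R * (al - y) by near: n; exact: near_ge_mulS.
  by rewrite mulrBr; lra.
have h : 0 < be - y by rewrite subr_gt0.
near=> n; rewrite /ramp !clamp1 ?mulr1//.
- have : 1 <= n.+1%:R * (be - y) by near: n; exact: near_ge_mulS.
  by rewrite mulrBr mulNr addrC.
- have : 2 <= n.+1%:R * y by near: n; exact: near_ge_mulS.
  by lra.
- by rewrite addrCA lerDl -mulrBr mulr_ge0// subr_ge0.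
Unshelve. all: by end_near. Qed.

End ramps.

Section mean_value_shell.
Context {R : realType} {k : nat}.
Notation m := k.+2.
Variable a : uball R m.
Notation p x := (pdist (\val a) (\val x)).

Let a1 : sqnorm (\val a) < 1 := sqnorm_uball a.

Lemma measurable_uball_set1 (x : uball R m) : measurable ([set x] : set (borel (uball R m))).
Proof.
have -> : [set x] = \val @^-1` [set \val x].
  by apply/seteqP; split => y /=; [move=> ->|exact: val_inj].
rewrite -[X in measurable X]setTI; apply: measurable_uball_val => //.
apply: closed_borel_measurable; exact: (accessible_closed_set1 (hausdorff_accessible (@norm_hausdorff _ _))).
Qed.

Lemma measurable_density_uball : measurable_fun setT
  (fun x : borel (uball R m) => ((1 - sqnorm (\val x)) ^- m)%:E).
Proof.
apply/measurable_EFinP.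
by apply: (uball_continuous_measurable (g := fun x => (1 - sqnorm x) ^- m)) => v; exact: continuous_density.
Qed.

Lemma mu_ball_set1 (x : uball R m) : mu_ball ([set x] : set (borel (uball R m))) = 0%E.
Proof.
have mx := measurable_uball_set1 x.
rewrite /mu_ball null_set_integral//.
  by apply: measurable_funTS; exact: measurable_density_uball.
rewrite /= /Vm (_ : \val @` [set x] = [set \val x]).
  by rewrite lebesgue_rV_set1// mule0.
exact: (@image_set1 (uball R m) 'rV[R]_m \val x).
Qed.

Lemma pdist_eq0 (x : uball R m) : p x = 0 -> x = a.
Proof.
move=> p0; apply/val_inj/rowP => j; apply/eqP.
have N0 : sqnorm (\val x - \val a) = 0.
  move/eqP: p0; rewrite /pdist mulf_eq0 invr_eq0 mulf_eq0 !subr_eq0.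
  case/or3P => /eqP // E; first by have := a1; rewrite -E ltxx.
  by have := sqnorm_uball x; rewrite -E ltxx.
rewrite -subr_eq0 -[_ == 0]sqrf_eq0 eq_le sqr_ge0 andbT -N0.
by have := coord_le_sqnorm (\val x - \val a) j; rewrite !mxE.
Qed.

Definition radial_indic (al be : R) (x : uball R m) : R := (al <= p x < be)%R%:R.

Lemma measurable_radial_indic al be :
  measurable_fun setT (radial_indic al be : borel (uball R m) -> R).
Proof.
have -> : radial_indic al be = (fun y => \1_(`[al, be[%classic) y) \o (fun x : uball R m => p x).
  apply/funext => x; rewrite /radial_indic/=; move: (p x) => y.
  by rewrite indicE mem_setE in_itv.
apply: (@measurable_radial R k (\val a) (\1_(`[al, be[%classic : set R))).
exact: measurable_indic.
Qed.

Section dominated.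
Variables (u : 'rV[R]_m -> R) (h : R -> R) (al be : R).
Hypotheses (Cu : C2_on unit_ball u) (ch : continuous h).
Let f_ n (x : uball R m) := u (\val x) * (h (p x) * ramp al be n (p x)).
Let f (x : uball R m) := u (\val x) * (h (p x) * radial_indic al be x).

Lemma cvg_ramp_integral :
  mu_ball.-integrable setT (EFin \o f : borel (uball R m) -> \bar R) /\
  (\int[mu_ball]_x f_ n x)%R @[n --> \oo] --> (\int[mu_ball]_x f x)%R.
Proof.
pose M := Num.max be 0; have M0 : 0 <= M by rewrite le_max lexx orbT.
pose g0 v := `|u v * h (pdist (\val a) v)|.
have cu v : unit_ball v -> {for v, continuous u} by move=> vB; have [] := Cu vB.
have cg0 v : unit_ball v -> {for v, continuous g0}.
  move=> vB; apply: (@continuous_comp _ _ _ (fun v => u v * h (pdist (\val a) v)) Num.norm).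
    apply: for_continuousM; first exact: cu.
    by apply: continuous_comp; [exact: continuous_pdist|exact: ch].
  exact: norm_continuous.
pose g (x : borel (uball R m)) := (g0 (\val x) * \1_(hyp_closed_ball (\val a) M) (\val x))%:E.
have ig : mu_ball.-integrable setT g by exact: integrable_compact.
have mu_ : measurable_fun setT (fun x : borel (uball R m) => u (\val x)).
  exact: uball_continuous_measurable.
have mh : measurable_fun setT (fun x : borel (uball R m) => h (p x)).
  by apply: measurable_radial; exact: continuous_measurable_fun.
have mf_ n : measurable_fun setT (EFin \o f_ n : borel (uball R m) -> \bar R).
  apply/measurable_EFinP; apply: measurable_funM => //.
  apply: (@measurable_radial R k (\val a) (fun y => h y * ramp al be n y)).
  by apply: continuous_measurable_fun; have [] := test_fun_ramp al be n ch.
have mf : measurable_fun setT (EFin \o f : borel (uball R m) -> \bar R).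
  apply/measurable_EFinP; apply: measurable_funM => //.
  by apply: measurable_funM => //; exact: measurable_radial_indic.
have f_f : {ae mu_ball, forall x, setT x -> (EFin \o f_ n) x @[n --> \oo] --> (EFin \o f) x}.
  exists [set a]; split; first exact: measurable_uball_set1.
    exact: mu_ball_set1.
  move=> x /=; apply: contra_notP => xa _.
  apply: cvg_EFin; first by near=> n.
  rewrite /f_ /f; apply: cvgM; first exact: cvg_cst.
  apply: cvgM; first exact: cvg_cst.
  apply: cvg_ramp; rewrite lt_neqAle p_ge0 andbT eq_sym.
  by apply/eqP => /pdist_eq0.
have f_g : {ae mu_ball, forall x n, setT x -> (`|(EFin \o f_ n) x| <= g x)%E}.
  apply: aeW => x n _; rewrite lee_fin /f_ /g /g0 indic_hyp_closed_ball//.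
  rewrite mulrA normrM (ger0_norm (ramp_ge0 _ _ _ _)).
  have [xM|Mx] := leP (p x) M.
    by rewrite ler_wpM2l ?normr_ge0// ramp_le1.
  by rewrite ramp_out ?mulr0//; right; rewrite ltW// (le_lt_trans _ Mx)// le_max lexx.
have [iF _ cF] := dominated_convergence measurableT mf_ mf f_f ig f_g.
split=> //; rewrite /Rintegral; apply: fine_cvg.
rewrite fineK; first exact: cF.
exact: integrable_fin_num.
Unshelve. all: by end_near. Qed.

End dominated.

(** Ramps extend the mean value property from continuous radial weights to
    weights that are cut off sharply on a shell. *)
Lemma mean_value_shell (u : 'rV[R]_m -> R) (h : R -> R) (al be : R) :
  C2_on unit_ball u -> (forall x, unit_ball x -> hyp_laplacian u x = 0) ->
  continuous h ->
  (\int[mu_ball]_x (u (\val x) * (h (p x) * radial_indic al be x)))%R =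
  u (\val a) * (\int[mu_ball]_x (h (p x) * radial_indic al be x))%R.
Proof.
move=> Cu hu ch.
have [_ c1] := cvg_ramp_integral al be Cu ch.
have [_ c2] := cvg_ramp_integral al be (@C2_cst R k unit_ball 1) ch.
have E n : (\int[mu_ball]_x (u (\val x) * (h (p x) * ramp al be n (p x))))%R =
  u (\val a) * (\int[mu_ball]_x (1 * (h (p x) * ramp al be n (p x))))%R.
  have tt := test_funM (test_fun_ramp al be n ch) (fun y => @continuous_powR_yy R (k%:R / 2) y).
  have vE y : h y * ramp al be n y * (y * (1 + y)) `^ (k%:R / 2) * vpow k y =
      h y * ramp al be n y.
    have [y0|y0] := ltP 0 y.
      rewrite -mulrA /vpow powRN divff ?mulr1// gt_eqF// powR_gt0// mulr_gt0//.
      by rewrite addr_gt0.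
    by rewrite ramp_out ?mulr0 ?mul0r//; left; rewrite (le_trans y0).
  have := mean_value_test_fun a1 Cu hu tt.
  by congr (_ = _ * _); apply: eq_Rintegral => x _; rewrite vE.
have := cvg_unique _ c1; move/(_ (@Rhausdorff R)).
apply; rewrite (_ : (fun n => _) = fun n => u (\val a) *
    (\int[mu_ball]_x (1 * (h (p x) * ramp al be n (p x))))%R); last exact/funext.
apply: cvgM; first exact: cvg_cst.
rewrite (_ : (\int[mu_ball]_x _)%R = (\int[mu_ball]_x (1 * (h (p x) * radial_indic al be x)))%R)//.
by apply: eq_Rintegral => x _; rewrite mul1r.
Qed.

End mean_value_shell.

(** * Volume growth *)

Section volume_growth_profile.
Context {R : realType}.
Notation leb := (@lebesgue_measure R).

Lemma is_derive_powR1D (r y : R) : 0 <= y ->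
  is_derive y (1 : R) (fun z => (1 + z) `^ r) (r * (1 + y) `^ (r - 1)).
Proof.
move=> y0; have y1 : 0 < 1 + y by rewrite ltr_wpDr.
have D1 : is_derive y (1 : R) (fun z => cst 1 z + z) (0 + 1).
  exact: (@is_derive_addf R R (cst 1) id y 1 0 1 (is_derive_cst _ _ _) (is_derive_id _ _)).
have := @is_derive_chain R R (fun t : R => t `^ r) (fun z => 1 + z) y 1 _ _
  (is_derive1_powR r y1) D1.
by rewrite add0r mulr1.
Qed.

Lemma integral_powR1D (e al be : R) : 0 < e -> 0 <= al -> al < be ->
  (\int[leb]_(y in `[al, be]) ((1 + y) `^ (- e - 1))%:E =
   (((1 + al) `^ (- e) - (1 + be) `^ (- e)) / e)%:E)%E.
Proof.
move=> e0 al0 albe.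
have d (y : R) : 0 <= y -> is_derive y (1 : R)
    (fun z => cst (- e^-1) z * (1 + z) `^ (- e)) ((1 + y) `^ (- e - 1)).
  move=> y0; have := @is_derive_mul R R (cst (- e^-1)) _ y 1 _ _
    (is_derive_cst _ _ _) (is_derive_powR1D (- e) y0).
  by rewrite mulr0 addr0 /cst mulrA mulrNN mulVf ?mul1r// gt_eqF.
have cd (y : R) : 0 <= y -> {for y, continuous (fun z : R => cst (- e^-1) z * (1 + z) `^ (- e))}.
  move=> y0; apply: differentiable_continuous; apply/derivable1_diffP.
  by case: (d y y0).
rewrite (@continuous_FTC2 R _ (fun z => cst (- e^-1) z * (1 + z) `^ (- e))) //.
- by rewrite -EFinB; congr EFin; rewrite /cst; field; rewrite gt_eqF.
- apply: continuous_in_subspaceT => y; rewrite inE/= in_itv/= => /andP[aly _].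
  apply: differentiable_continuous; apply/derivable1_diffP.
  by case: (is_derive_powR1D (- e - 1) (le_trans al0 aly)).
- split.
  + move=> y; rewrite in_itv/= => /andP[aly _].
    by case: (d y (le_trans al0 (ltW aly))).
  + by apply: cvg_at_right_filter; exact: cd.
  + by apply: cvg_at_left_filter; apply: cd; rewrite (le_trans al0)// ltW.
- move=> y; rewrite in_itv/= => /andP[aly _]; rewrite derive1E.
  by case: (d y (le_trans al0 (ltW aly))).
Qed.

Definition trapezoid (B y : R) : R := clamp (2 * y + (- 1)) * clamp (- B^-1 * y + 2).

Lemma trapezoid_ge0 B y : 0 <= trapezoid B y.
Proof. by rewrite mulr_ge0// clamp_ge0. Qed.

Lemma trapezoid_le1 B y : trapezoid B y <= 1.
Proof. by rewrite mulr_ile1// ?clamp_ge0 ?clamp_le1. Qed.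

Lemma trapezoid1 (B y : R) : 0 < B -> 1 <= y -> y <= B -> trapezoid B y = 1.
Proof.
move=> B0 y1 yB; rewrite /trapezoid !clamp1 ?mulr1//; last by lra.
have : B^-1 * y <= 1 by rewrite ler_pdivrMl// mulr1.
by rewrite mulNr; lra.
Qed.

Lemma trapezoid0 (B y : R) : 0 < B -> y <= 2^-1 \/ 2 * B <= y -> trapezoid B y = 0.
Proof.
move=> B0 [h|h]; rewrite /trapezoid.
  by rewrite clamp0 ?mul0r//; lra.
rewrite [X in _ * X]clamp0 ?mulr0// mulNr addrC subr_le0 ler_pdivlMl//.
by rewrite mulrC.
Qed.

Lemma continuous_trapezoid B : continuous (trapezoid B).
Proof.
move=> y; suff : {for y, continuous (fun y : R => clamp (2 * y + (- 1)) * clamp (- B^-1 * y + 2))} by [].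
by repeat continuity_step; exact: continuous_clamp_affine.
Qed.

Lemma test_fun_trapezoid (B : R) (f : R -> R) : 1 <= B ->
  (forall y : R, 0 < y -> {for y, continuous f}) ->
  test_fun 2^-1 (2 * B) (fun y => trapezoid B y * f y).
Proof.
move=> B1; apply: test_funM; split.
- exact: continuous_trapezoid.
- by [].
- lra.
- by move=> y h; apply: trapezoid0 => //; lra.
Qed.

Lemma test_fun_trapezoid_pow (e B : R) : 1 <= B ->
  test_fun 2^-1 (2 * B) (fun y => trapezoid B y * (1 + y) `^ (- e - 1)).
Proof.
move=> B1; apply: test_fun_trapezoid => // y y0.
apply: differentiable_continuous; apply/derivable1_diffP.
by case: (is_derive_powR1D (- e - 1) (ltW y0)).
Qed.

Lemma integral_trapezoid_bounds (e B : R) : 0 < e -> 1 < B ->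
  ((1 + 1) `^ (- e) - (1 + B) `^ (- e)) / e <=
    (\int[leb]_y (trapezoid B y * (1 + y) `^ (- e - 1)))%R <= e^-1.
Proof.
move=> e0 B1; have B0 : 0 < B by lra.
have tt := test_fun_trapezoid_pow e (ltW B1).
have it := integrable_test_fun tt.
have fin : (\int[leb]_y (trapezoid B y * (1 + y) `^ (- e - 1))%:E)%E \is a fin_num.
  exact: integrable_fin_num.
have mE : measurable_fun setT (fun y : measurableTypeR R =>
    (trapezoid B y * (1 + y) `^ (- e - 1))%:E) by exact: measurable_int it.
have mp D : measurable D -> measurable_fun D (fun y : measurableTypeR R => ((1 + y) `^ (- e - 1))%:E).
  move=> mD; apply: measurable_funTS; apply/measurable_EFinP.
  apply: (@measurableT_comp _ _ _ _ _ _ (fun t : R => t `^ (- e - 1))).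
    exact: measurable_powR.
  by apply: measurable_funD.
apply/andP; split.
  rewrite -lee_fin /Rintegral fineK// -integral_powR1D//.
  rewrite [leLHS]integral_mkcond; apply: ge0_le_integral => //.
  - by move=> y _; rewrite patchE; case: ifPn => _; rewrite ?lee_fin ?powR_ge0.
  - by apply/(measurable_restrictT _ _).1 => //; exact: mp.
  - move=> y _; rewrite patchE; case: ifPn => [|_].
      rewrite inE/= in_itv/= => /andP[y1 yB].
      by rewrite lee_fin trapezoid1// mul1r.
    by rewrite lee_fin mulr_ge0 ?trapezoid_ge0 ?powR_ge0.
rewrite -lee_fin /Rintegral fineK//.
apply: (@le_trans _ _ (((1 + 2^-1) `^ (- e) - (1 + 2 * B) `^ (- e)) / e)%:E).
  rewrite -integral_powR1D//; last by lra.
  rewrite [leRHS]integral_mkcond; apply: ge0_le_integral => //.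
  - by move=> y _; rewrite lee_fin mulr_ge0 ?trapezoid_ge0 ?powR_ge0.
  - by apply/(measurable_restrictT _ _).1 => //; exact: mp.
  - move=> y _; rewrite patchE; case: ifPn => [_|].
      by rewrite lee_fin ler_piMl ?powR_ge0 ?trapezoid_le1.
    rewrite notin_setE/= in_itv/= => /negP; rewrite negb_and -!ltNge => h.
    rewrite trapezoid0 ?mul0r//; case/orP: h => h; [left|right]; exact: ltW.
rewrite lee_fin -[leRHS]mul1r ler_wpM2r ?invr_ge0 ?(ltW e0)//.
rewrite (@le_trans _ _ ((1 + 2^-1) `^ (- e)))// ?gerBl ?powR_ge0//.
apply: (@le_trans _ _ ((1 + 2^-1) `^ 0)); last by rewrite powRr0.
by rewrite ler_powR ?oppr_le0 ?(ltW e0)//; lra.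
Qed.

End volume_growth_profile.

Section volume_growth.
Context {R : realType} {k : nat}.
Notation m := k.+2.
Notation leb := (@lebesgue_measure R).
Variable a : uball R m.
Notation p x := (pdist (\val a) (\val x)).

Let a1 : sqnorm (\val a) < 1 := sqnorm_uball a.

Lemma measurable_weight s : measurable_fun setT (weight s a : borel (uball R m) -> R).
Proof.
have -> : weight s a = (fun y => exp_dist y `^ (- s)) \o (fun x : uball R m => p x).
  by apply/funext => x; rewrite weightE.
apply: (@measurable_radial R k (\val a) (fun y => exp_dist y `^ (- s))).
apply: (@measurableT_comp _ _ _ _ _ _ (fun t : R => t `^ (- s))).
  exact: measurable_powR.
by apply: continuous_measurable_fun; exact: continuous_exp_dist.
Qed.

Lemma weight_le s (x : uball R m) : 0 <= s -> weight s a x <= (1 + p x) `^ (- s).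
Proof.
move=> s0; have p0 := p_ge0 a x.
have p1 : 0 < 1 + p x by rewrite ltr_wpDr.
rewrite weightE !powRN lef_pV2 ?posrE ?powR_gt0 ?exp_dist_gt0//.
by rewrite ge0_ler_powR ?nnegrE ?(ltW p1) ?(ltW (exp_dist_gt0 _))// exp_dist_ge.
Qed.

Lemma weight_ge s (x : uball R m) : 0 <= s -> 4 `^ (- s) * (1 + p x) `^ (- s) <= weight s a x.
Proof.
move=> s0; have p0 := p_ge0 a x.
have p1 : 0 < 1 + p x by rewrite ltr_wpDr.
rewrite -powRM ?(ltW p1)// weightE !powRN lef_pV2 ?posrE ?powR_gt0 ?exp_dist_gt0 ?mulr_gt0//.
by rewrite ge0_ler_powR ?nnegrE ?mulr_ge0 ?(ltW p1) ?(ltW (exp_dist_gt0 _))// exp_dist_le.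
Qed.

(** The density of the invariant measure with respect to vpow is comparable
    to a power of 1 + y away from 0. *)
Lemma vpow_ge (y : R) : 0 < y -> (1 + y) `^ (- k%:R) <= vpow k y.
Proof.
move=> y0; have y1 : 0 < 1 + y by rewrite addr_gt0.
rewrite /vpow !powRN lef_pV2 ?posrE ?powR_gt0 ?mulr_gt0//.
have -> : (1 + y) `^ k%:R = ((1 + y) * (1 + y)) `^ (k%:R / 2).
  rewrite powRM ?(ltW y1)// -powRD; last by rewrite (gt_eqF y1) implybT.
  by rewrite -splitr.
by rewrite ge0_ler_powR ?nnegrE ?mulr_ge0 ?(ltW y0) ?(ltW y1)// ler_wpM2r ?(ltW y1)// lerDr.
Qed.

Lemma vpow_le (y : R) : 2^-1 <= y -> vpow k y <= 3 `^ (k%:R / 2) * (1 + y) `^ (- k%:R).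
Proof.
move=> y2; have y0 : 0 < y by lra.
have y1 : 0 < 1 + y by rewrite addr_gt0.
have -> : 3 `^ (k%:R / 2) * (1 + y) `^ (- k%:R) = (3^-1 * ((1 + y) * (1 + y))) `^ (- (k%:R / 2)).
  rewrite powRM// ?mulr_ge0 ?(ltW y1)//; congr (_ * _).
    by rewrite -(@powR_inv1 R 3)// -powRrM mulN1r opprK.
  rewrite powRM ?(ltW y1)// -powRD; last by rewrite (gt_eqF y1) implybT.
  by rewrite -opprD -splitr.
rewrite /vpow !powRN lef_pV2 ?posrE ?powR_gt0 ?mulr_gt0//.
rewrite ge0_ler_powR ?nnegrE ?mulr_ge0 ?(ltW y0) ?(ltW y1)//.
by rewrite mulrA ler_wpM2r ?(ltW y1)//; lra.
Qed.

Lemma trapezoid_vpow_ge0 (B y r : R) : 0 <= trapezoid B y * (1 + y) `^ r * vpow k y.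
Proof.
by rewrite mulr_ge0 ?vpow_ge0//; apply: mulr_ge0; rewrite ?trapezoid_ge0 ?powR_ge0.
Qed.

Lemma integral_trapezoid_radial : exists2 c : R, 0 < c & forall e B, 0 < e -> 1 < B ->
  (\int[mu_ball]_x (trapezoid B (p x) * (1 + p x) `^ (- e - 1) * vpow k (p x))%:E =
   (c * (\int[leb]_y (trapezoid B y * (1 + y) `^ (- e - 1)))%R)%:E)%E.
Proof.
have [c c0 cE] := @volume_constant R k (\val a) a1; exists c => // e B e0 B1.
have tt := test_fun_trapezoid_pow e (ltW B1).
rewrite -(cE _ _ _ tt) /Rintegral fineK.
  by apply: eq_integral => x _; rewrite mul1r.
by apply: integrable_fin_num => //; exact: (integrable_test_fun_radial a1 (@C2_cst _ _ unit_ball 1) tt).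
Qed.

(** In the variable y = pdist the invariant measure has a density of order y^k
    at infinity, and the weight is of order y^(-s). *)
Lemma integral_weight_lty (s : R) : k.+1%:R < s ->
  (\int[mu_ball]_x (weight s a x)%:E < +oo)%E.
Proof.
move=> ks; pose e := s - k.+1%:R; have e0 : 0 < e by rewrite subr_gt0.
have s0 : 0 <= s by rewrite (le_trans _ (ltW ks)).
have [c c0 cE] := integral_trapezoid_radial.
have mw : measurable_fun setT (EFin \o weight s a : borel (uball R m) -> \bar R).
  by apply/measurable_EFinP; exact: measurable_weight.
have mp : measurable_fun setT (fun x : borel (uball R m) => p x).
  by apply: (@measurable_radial R k (\val a) id).
pose F n : set (borel (uball R m)) := [set x | 1 <= p x <= n.+2%:R].
have mF n : measurable (F n).
  rewrite (_ : F n = (fun x : borel (uball R m) => p x) @^-1` `[1, n.+2%:R]%classic); last first.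
    by apply/seteqP; split => x; rewrite /F/= in_itv.
  by rewrite -[X in measurable X]setTI; exact: mp.
pose Z : set (borel (uball R m)) := [set x | p x <= 1].
have mZ : measurable Z.
  rewrite (_ : Z = (fun x : borel (uball R m) => p x) @^-1` `]-oo, 1]%classic); last first.
    by apply/seteqP; split => x; rewrite /Z/= in_itv.
  by rewrite -[X in measurable X]setTI; exact: mp.
have ZF : [set: borel (uball R m)] = Z `|` \bigcup_n F n.
  apply/seteqP; split => // x _; have [p1|p1] := leP (p x) 1; first by left.
  right; exists (Num.truncn (p x)) => //; rewrite /F/= (ltW p1)/=.
  by rewrite (le_trans (ltW (truncnS_gt _)))// ler_nat.
have mUF : measurable (\bigcup_n F n) by exact: bigcupT_measurable.
have w0 x : (0 <= (weight s a x)%:E)%E by rewrite lee_fin ltW// weight_gt0.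
apply: (@le_lt_trans _ _ (\int[mu_ball]_(x in Z) (weight s a x)%:E +
    \int[mu_ball]_(x in \bigcup_n F n) (weight s a x)%:E)%E).
  rewrite ZF; apply: (@le_trans _ _ (\int[mu_ball]_(x in Z `|` (\bigcup_n F n `\` Z)) (weight s a x)%:E)%E).
    by rewrite setDE setUIr setUv setIT.
  have mD : measurable (\bigcup_n F n `\` Z) by exact: measurableD.
  rewrite ge0_integral_setU//; last 2 first.
  - by apply: measurable_funTS.
  - by apply/disj_setPS => x [Zx [_ /(_ Zx)]].
  rewrite leeD2l//; apply: ge0_subset_integral => //.
  by apply: measurable_funTS.
rewrite lte_add_pinfty//.
  (* the part at distance less than 1 *)
  have i1 : mu_ball.-integrable setT (fun x : borel (uball R m) =>
      (1 * \1_(hyp_closed_ball (\val a) 1) (\val x))%:E).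
    by apply: (integrable_compact a1 (g := fun=> 1)) => // x _; exact: cst_continuous.
  apply: le_lt_trans (integrable_lty _ i1) => //.
  rewrite [leLHS]integral_mkcond; apply: ge0_le_integral => //.
  - by move=> x _; rewrite patchE; case: ifPn.
  - by apply/(measurable_restrictT _ _).1 => //; exact: measurable_funTS.
  - exact: measurable_int i1.
  move=> x _; rewrite patchE indic_hyp_closed_ball// mul1r.
  case: ifPn => [|_]; last by rewrite lee_fin.
  rewrite inE /Z/= => ->; rewrite lee_fin /weight -expR0 ler_expR.
  by rewrite mulNr oppr_le0 mulr_ge0// dh_ge0.
(* the dyadic part is controlled by trapezoids *)
have cF : (\int[mu_ball]_(x in F n) (weight s a x)%:E)%E @[n --> \oo] -->
    (\int[mu_ball]_(x in \bigcup_n F n) (weight s a x)%:E)%E.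
  apply: ge0_nondecreasing_set_cvg_integral => //.
  - move=> n1 n2 n12; apply/subsetPset => x; rewrite /F/= => /andP[-> h]/=.
    by rewrite (le_trans h)// ler_nat !ltnS.
  - by move=> i; apply: measurable_funTS.
apply: (@le_lt_trans _ _ (c * e^-1)%:E); last by rewrite ltry.
rewrite -(cvg_lim _ cF)//; apply: lime_le; first by apply/cvg_ex; eexists; exact: cF.
near=> n; have n1 : 1 < n.+2%:R :> R by rewrite ltr1n.
apply: (@le_trans _ _ (c * (\int[leb]_y (trapezoid n.+2%:R y * (1 + y) `^ (- e - 1)))%R)%:E).
  rewrite -cE// [leLHS]integral_mkcond; apply: ge0_le_integral => //.
  - by move=> x _; rewrite patchE; case: ifPn.
  - by apply/(measurable_restrictT _ _).1 => //; exact: measurable_funTS.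
  - have tt := test_fun_trapezoid_pow e (ltW n1).
    have := measurable_int _ (integrable_test_fun_radial a1 (@C2_cst R k unit_ball 1) tt).
    by under eq_fun do rewrite mul1r.
  move=> x _; rewrite patchE; case: ifPn => [|_]; last first.
    by rewrite -[leLHS]/(0%:E) lee_fin trapezoid_vpow_ge0.
  rewrite inE /F/= => /andP[p1 pn]; rewrite lee_fin trapezoid1// ?mul1r.
  apply: (le_trans (weight_le x s0)).
  have pp : 0 < p x by lra.
  apply: (@le_trans _ _ ((1 + p x) `^ (- e - 1) * (1 + p x) `^ (- k%:R))).
    rewrite -powRD; last by rewrite (gt_eqF (addr_gt0 ltr01 pp)) implybT.
    by rewrite (_ : - e - 1 + - k%:R = - s)// /e -natr1; ring.
  by rewrite ler_wpM2l ?powR_ge0// vpow_ge.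
rewrite lee_fin ler_wpM2l ?(ltW c0)//.
by have /andP[] := integral_trapezoid_bounds e0 n1.
Unshelve. all: by end_near. Qed.

(** The integral of y^(k - s) over a half-line is of order 1 / (s - k - 1). *)
Lemma integral_weight_ge (S : R) : exists2 c : R, 0 < c & forall s, k.+1%:R < s -> s <= S ->
  ((c / (s - k.+1%:R))%:E <= \int[mu_ball]_x (weight s a x)%:E)%E.
Proof.
have [c c0 cE] := integral_trapezoid_radial.
exists (8 `^ (- S) * (3 `^ (- (k%:R / 2)) * (c / 2))).
  by rewrite !mulr_gt0 ?powR_gt0 ?divr_gt0.
move=> s ks sS; pose e := s - k.+1%:R; have e0 : 0 < e by rewrite subr_gt0.
have s0 : 0 < s by rewrite (le_lt_trans _ ks).
have mw : measurable_fun setT (EFin \o weight s a : borel (uball R m) -> \bar R).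
  by apply/measurable_EFinP; exact: measurable_weight.
(* B is chosen so that (1 + B)^-e is half of 2^-e *)
pose B := 2 * 2 `^ e^-1 - 1.
have B1 : 1 < B.
  have : 1 < 2 `^ e^-1 :> R.
    rewrite -[ltLHS](powRr0 2) /powR gt_eqF// ltr_expR mul0r mulr_gt0 ?invr_gt0//.
    by rewrite ln_gt0//; lra.
  by rewrite /B; lra.
have BE : (1 + B) `^ (- e) = 2 `^ (- e) / 2.
  rewrite /B addrC subrK powRM ?powR_ge0// -powRrM mulrN mulVf ?gt_eqF//.
  by rewrite powR_inv1.
have := integral_trapezoid_bounds e0 B1; move=> /andP[+ _].
rewrite BE (_ : 1 + 1 = 2 :> R)// => lo.
have tt := test_fun_trapezoid_pow e (ltW B1).
have mt : measurable_fun setT (fun x : borel (uball R m) =>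
    (trapezoid B (p x) * (1 + p x) `^ (- e - 1) * vpow k (p x))%:E).
  have := measurable_int _ (integrable_test_fun_radial a1 (@C2_cst R k unit_ball 1) tt).
  by under eq_fun do rewrite mul1r.
pose d : R := 4 `^ (- s) * 3 `^ (- (k%:R / 2)).
have d0 : 0 < d by rewrite mulr_gt0 ?powR_gt0.
have low : (d%:E * (c * (\int[leb]_y (trapezoid B y * (1 + y) `^ (- e - 1)))%R)%:E <=
    \int[mu_ball]_x (weight s a x)%:E)%E.
  rewrite -cE// -ge0_integralZl//; last 2 first.
  - by move=> x _; rewrite lee_fin trapezoid_vpow_ge0.
  - by rewrite lee_fin ltW.
  apply: ge0_le_integral => //.
  - move=> x _; rewrite -EFinM lee_fin.
    by rewrite mulr_ge0 ?(ltW d0)// trapezoid_vpow_ge0.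
  - exact: emeasurable_funM.
  move=> x _; rewrite -EFinM lee_fin; apply: (le_trans _ (weight_ge x (ltW s0))).
  rewrite /d -[leLHS]mulrA; apply: ler_wpM2l; first exact: powR_ge0.
  have [p2|p2] := leP (p x) 2^-1.
    by rewrite trapezoid0 ?mul0r ?mulr0 ?powR_ge0//; [lra|left].
  rewrite -(ler_pM2l (powR_gt0 (k%:R / 2) (_ : 0 < 3)))// mulrA -powRD; last by rewrite pnatr_eq0 implybT.
  rewrite subrr powRr0 mul1r.
  have pp : 0 < p x by lra.
  apply: (@le_trans _ _ ((1 + p x) `^ (- e - 1) * (3 `^ (k%:R / 2) * (1 + p x) `^ (- k%:R)))).
    apply: ler_pM.
    - by apply: mulr_ge0; rewrite ?trapezoid_ge0 ?powR_ge0.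
    - exact: vpow_ge0.
    - by rewrite ler_piMl ?powR_ge0 ?trapezoid_le1.
    - by apply: vpow_le; exact: ltW.
  rewrite mulrCA ler_wpM2l ?powR_ge0// -powRD; last by rewrite (gt_eqF (addr_gt0 ltr01 pp)) implybT.
  by rewrite (_ : - e - 1 + - k%:R = - s)// /e -natr1; ring.
apply: le_trans low; rewrite -EFinM lee_fin.
have lo2 : 2 `^ (- s) / 2 / e <= (2 `^ (- e) - 2 `^ (- e) / 2) / e.
  rewrite ler_wpM2r ?invr_ge0 ?(ltW e0)//.
  have : 2 `^ (- s) <= 2 `^ (- e) :> R.
    by rewrite ler_powR ?lerN2 /e ?gerBl//; lra.
  by lra.
apply: (@le_trans _ _ (d * (c * (2 `^ (- s) / 2 / e)))); last first.
  by rewrite !ler_wpM2l ?(ltW c0) ?(ltW d0)// (le_trans lo2).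
have -> : d * (c * (2 `^ (- s) / 2 / e)) =
    (4 `^ (- s) * 2 `^ (- s)) * (3 `^ (- (k%:R / 2)) * (c / 2)) / e.
  by rewrite /d; field; rewrite gt_eqF.
rewrite -powRM// (_ : 4 * 2 = 8 :> R) -?natrM// ler_wpM2r ?invr_ge0 ?(ltW e0)//.
rewrite ler_wpM2r ?mulr_ge0 ?powR_ge0 ?divr_ge0 ?(ltW c0)//.
by rewrite ler_powR ?lerN2//; lra.
Qed.

End volume_growth.

(** * Complex moduli and Hilbert spaces of functions *)

Section modulus_theory.
Context {R : realType}.
Implicit Types z w : R[i].

Lemma sqr_modulus z : modulus z ^+ 2 = complex.Re z ^+ 2 + complex.Im z ^+ 2.
Proof. by case: z => x y; rewrite /modulus /= sqr_sqrtr// addr_ge0// sqr_ge0. Qed.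

Lemma modulus_ge0 z : 0 <= modulus z.
Proof. by case: z => x y; exact: sqrtr_ge0. Qed.

Lemma mulcJ_modulus z : z * z^* = (modulus z ^+ 2)%:C.
Proof. by case: z => x y; rewrite sqr_modulus /=; simpc; congr (_ +i* _); ring. Qed.

Lemma modulusM z w : modulus (z * w) = modulus z * modulus w.
Proof. exact: ComplexField.Normc.normcM. Qed.

Lemma modulusJ z : modulus z^* = modulus z.
Proof. by case: z => x y; rewrite /modulus /= sqrrN. Qed.

Lemma modulusN z : modulus (- z) = modulus z.
Proof. by case: z => x y; rewrite /modulus /= !sqrrN. Qed.

Lemma modulus_real (x : R) : modulus x%:C = `|x|.
Proof. by rewrite /modulus /= expr0n addr0 sqrtr_sqr. Qed.

Lemma modulus0 : modulus (0 : R[i]) = 0.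
Proof. exact: ComplexField.Normc.normc0. Qed.

Lemma Re_le_modulus z : `|complex.Re z| <= modulus z.
Proof.
by rewrite -(@ler_pXn2r _ 2)// ?nnegrE ?modulus_ge0// sqr_modulus real_normK ?num_real// lerDl sqr_ge0.
Qed.

Lemma Im_le_modulus z : `|complex.Im z| <= modulus z.
Proof.
by rewrite -(@ler_pXn2r _ 2)// ?nnegrE ?modulus_ge0// sqr_modulus real_normK ?num_real// lerDr sqr_ge0.
Qed.

End modulus_theory.

Section hilbert_space.
Context {R : realType} {T : Type}.
Variables (H : set (T -> R[i])) (dot : (T -> R[i]) -> (T -> R[i]) -> R[i]).
Hypothesis hH : is_hilbert_space H dot.
Implicit Types (f g h : T -> R[i]) (c : R[i]).
Local Notation "`N f" := (hnorm dot f) (at level 10, f at level 8).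

Definition scalef c f : T -> R[i] := fun x => c * f x.

Lemma scale0f f : scalef 0 f = 0.
Proof. by apply/funext => x; rewrite /scalef mul0r. Qed.

Lemma scalefA c1 c2 f : scalef c1 (scalef c2 f) = scalef (c1 * c2) f.
Proof. by apply/funext => x; rewrite /scalef mulrA. Qed.

Lemma hilbert_space0 : H 0. Proof. exact: hilbert0 hH. Qed.

Lemma hilbert_spaceD f g : H f -> H g -> H (f + g).
Proof.
move=> Hf Hg; have := hilbertD hH 1 Hf Hg.
by congr H; apply/funext => x; rewrite mul1r.
Qed.

Lemma hilbert_spaceZ c f : H f -> H (scalef c f).
Proof.
move=> Hf; have := hilbertD hH c Hf hilbert_space0.
by congr H; apply/funext => x; rewrite addr0.
Qed.

Lemma hilbert_spaceB f g : H f -> H g -> H (f - g).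
Proof.
move=> Hf Hg; apply: hilbert_spaceD => //; have := hilbert_spaceZ (-1) Hg.
by congr H; apply/funext => x; rewrite /scalef mulN1r.
Qed.

Lemma hilbert_space_sum (I : Type) (r : seq I) (P : pred I) (F : I -> T -> R[i]) :
  (forall i, P i -> H (F i)) -> H (\sum_(i <- r | P i) F i).
Proof. by move=> HF; apply: big_ind => //; [exact: hilbert_space0|exact: hilbert_spaceD]. Qed.

Lemma dotDl f g h : H f -> H g -> H h -> dot (f + g) h = dot f h + dot g h.
Proof.
move=> Hf Hg Hh; rewrite -[dot f h]mul1r -(hilbert_linear hH)//.
by congr dot; apply/funext => x; rewrite mul1r.
Qed.

Lemma dot0l h : H h -> dot 0 h = 0.
Proof.
move=> Hh; have := dotDl hilbert_space0 hilbert_space0 Hh; rewrite addr0 => /eqP.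
by rewrite -subr_eq subrr => /eqP.
Qed.

Lemma dotZl c f h : H f -> H h -> dot (scalef c f) h = c * dot f h.
Proof.
move=> Hf Hh; rewrite -[RHS]addr0 -(dot0l Hh) -(hilbert_linear hH)//; last exact: hilbert_space0.
by congr dot; apply/funext => x; rewrite addr0.
Qed.

Lemma dotBl f g h : H f -> H g -> H h -> dot (f - g) h = dot f h - dot g h.
Proof.
move=> Hf Hg Hh.
have -> : - g = scalef (-1) g by apply/funext => x; rewrite /scalef mulN1r.
by rewrite dotDl// ?dotZl ?mulN1r//; exact: hilbert_spaceZ.
Qed.

Lemma dot_suml (I : Type) (r : seq I) (F : I -> T -> R[i]) h :
  (forall i, H (F i)) -> H h ->
  dot (\sum_(i <- r) F i) h = \sum_(i <- r) dot (F i) h.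
Proof.
move=> HF Hh; elim: r => [|i r IH]; first by rewrite !big_nil dot0l.
by rewrite !big_cons dotDl ?IH//; exact: hilbert_space_sum.
Qed.

Lemma dotDr f g h : H f -> H g -> H h -> dot h (f + g) = dot h f + dot h g.
Proof.
move=> Hf Hg Hh; rewrite (hilbert_conj hH (hilbert_spaceD Hf Hg) Hh) dotDl// rmorphD.
by rewrite (hilbert_conj hH Hf Hh) (hilbert_conj hH Hg Hh).
Qed.

Lemma dotBr f g h : H f -> H g -> H h -> dot h (f - g) = dot h f - dot h g.
Proof.
move=> Hf Hg Hh; rewrite (hilbert_conj hH (hilbert_spaceB Hf Hg) Hh) dotBl// rmorphB.
by rewrite (hilbert_conj hH Hf Hh) (hilbert_conj hH Hg Hh).
Qed.

Lemma dotZr c f h : H f -> H h -> dot h (scalef c f) = c^* * dot h f.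
Proof.
move=> Hf Hh; rewrite (hilbert_conj hH (hilbert_spaceZ c Hf) Hh) dotZl// rmorphM.
by rewrite (hilbert_conj hH Hf Hh).
Qed.

Lemma hnorm_ge0 f : 0 <= `N f. Proof. exact: sqrtr_ge0. Qed.

Lemma dot_hnorm f : H f -> dot f f = (`N f ^+ 2)%:C.
Proof.
move=> Hf; have := hilbert_ge0 hH Hf; rewrite lecE /= => /andP[/eqP Im0 Re0].
rewrite sqr_sqrtr//; case: (dot f f) Im0 {Re0} => x y /= ->.
by rewrite complexr0.
Qed.

Lemma sqr_hnorm f : H f -> `N f ^+ 2 = complex.Re (dot f f).
Proof. by move=> Hf; rewrite dot_hnorm. Qed.

Lemma hnorm_eq0 f : H f -> `N f = 0 -> f = 0.
Proof.
move=> Hf f0; apply: (hilbert_eq0 hH Hf).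
by rewrite dot_hnorm// f0 expr0n.
Qed.

Lemma hnorm0 : `N 0 = 0.
Proof. by rewrite /hnorm dot0l ?sqrtr0//; exact: hilbert_space0. Qed.

Lemma hnormZ c f : H f -> `N (scalef c f) = modulus c * `N f.
Proof.
move=> Hf; apply/eqP; rewrite -(@eqrXn2 _ 2)// ?mulr_ge0 ?hnorm_ge0 ?modulus_ge0//; apply/eqP.
rewrite sqr_hnorm; last exact: hilbert_spaceZ.
rewrite dotZr ?dotZl//; last exact: hilbert_spaceZ.
by rewrite dot_hnorm// mulrA [_^* * _]mulrC mulcJ_modulus -rmorphM exprMn.
Qed.

Lemma sqr_hnormB f g : H f -> H g ->
  `N (f - g) ^+ 2 = `N f ^+ 2 - 2 * complex.Re (dot f g) + `N g ^+ 2.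
Proof.
move=> Hf Hg; have Hfg := hilbert_spaceB Hf Hg.
rewrite sqr_hnorm// dotBr// !dotBl// (hilbert_conj hH Hf Hg) !dot_hnorm//.
by case: (dot f g) => x y /=; ring.
Qed.

Lemma cauchy_schwarz f g : H f -> H g -> modulus (dot f g) <= `N f * `N g.
Proof.
move=> Hf Hg; have [g0|g0] := eqVneq (`N g) 0.
  rewrite (hnorm_eq0 Hg g0) (hilbert_conj hH hilbert_space0 Hf) dot0l//.
  by rewrite modulusJ modulus0 mulr_ge0 ?hnorm_ge0.
have g1 : 0 < `N g by rewrite lt_def g0 hnorm_ge0.
rewrite -(@ler_pXn2r _ 2)// ?nnegrE ?mulr_ge0 ?hnorm_ge0 ?modulus_ge0//.
pose c : R[i] := dot f g * (`N g ^- 2)%:C.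
have E1 : complex.Re (dot f (scalef c g)) = modulus (dot f g) ^+ 2 * `N g ^- 2.
  have cE : c^* = (dot f g)^* * (`N g ^- 2)%:C.
    by rewrite /c rmorphM; congr (_ * _); exact: conjc_real.
  have -> : dot f (scalef c g) = (modulus (dot f g) ^+ 2 * `N g ^- 2)%:C.
    rewrite dotZr//; transitivity ((dot f g)^* * (`N g ^- 2)%:C * dot f g).
      by congr (_ * _); exact: cE.
    rewrite mulrAC [_^* * _]mulrC mulcJ_modulus; exact/esym/(rmorphM (real_complex R)).
  by [].
have := sqr_ge0 (`N (f - scalef c g)); rewrite sqr_hnormB//; last exact: hilbert_spaceZ.
rewrite E1 hnormZ// modulusM modulus_real ger0_norm; last by rewrite invr_ge0 sqr_ge0.
have -> : (modulus (dot f g) * `N g ^- 2 * `N g) ^+ 2 = modulus (dot f g) ^+ 2 * `N g ^- 2.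
  by field.
move=> /mulr_ge0/(_ (ltW (exprn_gt0 2 g1))).
have -> : (`N f ^+ 2 - 2 * (modulus (dot f g) ^+ 2 * `N g ^- 2) + modulus (dot f g) ^+ 2 * `N g ^- 2)
    * `N g ^+ 2 = (`N f * `N g) ^+ 2 - modulus (dot f g) ^+ 2 by field.
by rewrite subr_ge0.
Qed.

Lemma hnormD f g : H f -> H g -> `N (f + g) <= `N f + `N g.
Proof.
move=> Hf Hg; have Hfg := hilbert_spaceD Hf Hg.
rewrite -(@ler_pXn2r _ 2)// ?nnegrE ?addr_ge0 ?hnorm_ge0//.
have -> : `N (f + g) ^+ 2 = `N f ^+ 2 + 2 * complex.Re (dot f g) + `N g ^+ 2.
  rewrite sqr_hnorm// dotDr// !dotDl// (hilbert_conj hH Hf Hg) !dot_hnorm//.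
  by case: (dot f g) => x y /=; ring.
have := le_trans (Re_le_modulus (dot f g)) (cauchy_schwarz Hf Hg).
by rewrite ler_norml => /andP[_ h]; rewrite sqrrD; nra.
Qed.

Lemma hnorm_sum (I : Type) (r : seq I) (F : I -> T -> R[i]) : (forall i, H (F i)) ->
  `N (\sum_(i <- r) F i) <= \sum_(i <- r) `N (F i).
Proof.
move=> HF; elim: r => [|i r IH]; first by rewrite !big_nil hnorm0.
rewrite !big_cons (le_trans (hnormD _ _))// ?lerD2l//; exact: hilbert_space_sum.
Qed.

End hilbert_space.

Section gram_schmidt.
Context {R : realType} {T : Type}.
Variables (H : set (T -> R[i])) (dot : (T -> R[i]) -> (T -> R[i]) -> R[i]).
Hypothesis hH : is_hilbert_space H dot.
Variable v : nat -> T -> R[i].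
Hypothesis Hv : forall n, H (v n).
Implicit Types (f g h : T -> R[i]) (c : R[i]).
Local Notation "`N f" := (hnorm dot f) (at level 10, f at level 8).

(** The zero function is sent to itself, so that the family may be linearly
    dependent. *)
Definition normalize f := scalef (`N f)^-1%:C f.

(** [residual n f] is f minus its projection on the span of v 0, ..., v (n-1).
    Recursion on residuals rather than on the orthonormal vectors makes this a
    structural definition of the Gram-Schmidt process. *)
Fixpoint residual n f := if n is n'.+1 then
    let e := normalize (residual n' (v n')) in
    residual n' f - scalef (dot (residual n' f) e) e
  else f.

Definition gram_schmidt n := normalize (residual n (v n)).
Local Notation e_ := gram_schmidt.

Lemma residualS n f :
  residual n.+1 f = residual n f - scalef (dot (residual n f) (e_ n)) (e_ n).
Proof. by []. Qed.

Lemma H_residual n f : H f -> H (residual n f).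
Proof.
elim: n f => // n IH f Hf; rewrite residualS; apply: (hilbert_spaceB hH); first exact: IH.
by apply: (hilbert_spaceZ hH); apply: (hilbert_spaceZ hH); exact/IH/Hv.
Qed.

Lemma H_gram_schmidt n : H (e_ n).
Proof. by apply: (hilbert_spaceZ hH); exact: H_residual. Qed.

Lemma normalizeK f : H f -> f = scalef (`N f)%:C (normalize f).
Proof.
move=> Hf; have [f0|f0] := eqVneq (`N f) 0.
  by rewrite f0 (hnorm_eq0 hH Hf f0) scale0f.
rewrite scalefA -(rmorphM (real_complex R)) divff//.
by apply/funext => x; rewrite /scalef mul1r.
Qed.

(** Either e_ n is a unit vector or it is zero and both sides vanish. *)
Lemma hnorm_gram_schmidt f n : H f ->
  modulus (dot f (e_ n)) * `N (e_ n) = modulus (dot f (e_ n)).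
Proof.
move=> Hf; have He := H_gram_schmidt n.
have [r0|r0] := eqVneq (`N (residual n (v n))) 0.
  have -> : e_ n = 0.
    by rewrite /e_ /normalize (hnorm_eq0 hH (H_residual _ (Hv n)) r0); apply/funext => x; rewrite /scalef mulr0.
  by rewrite (hnorm0 hH) mulr0 (hilbert_conj hH (hilbert_space0 hH) Hf) (dot0l hH)// modulusJ modulus0.
rewrite {2}/e_ (hnormZ hH) ?modulus_real; last exact: H_residual.
by rewrite ger0_norm ?invr_ge0 ?hnorm_ge0// mulVf// mulr1.
Qed.

Lemma dot_residualr h g n : H h -> H g ->
  (forall i, (i < n)%N -> dot h (e_ i) = 0) -> dot h (residual n g) = dot h g.
Proof.
move=> Hh Hg; elim: n => // n IH he; rewrite residualS (dotBr hH)//.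
- rewrite (dotZr hH)//; last exact: H_gram_schmidt.
  by rewrite he// mulr0 subr0 IH// => i /ltnW ?; apply: he.
- exact: H_residual.
- by apply: (hilbert_spaceZ hH); exact: H_gram_schmidt.
Qed.

Lemma residual_orth n f j : H f -> (j < n)%N -> dot (residual n f) (e_ j) = 0.
Proof.
move=> Hf; elim: n f Hf j => // n IH f Hf j jn.
have Hr := H_residual n Hf; have He := H_gram_schmidt.
rewrite residualS (dotBl hH)//; last exact: (hilbert_spaceZ hH).
rewrite (dotZl hH)//; move: jn; rewrite ltnS leq_eqVlt => /orP[/eqP ->|jn].
  have := hnorm_gram_schmidt n Hr; rewrite (dot_hnorm hH)//.
  set c := dot _ _; have [c0|c0] := eqVneq (modulus c) 0.
    by rewrite (ComplexField.Normc.eq0_normc c0) mul0r subr0.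
  rewrite -[RHS]mulr1 => /(mulfI c0) ->.
  by rewrite expr1n mulr1 subrr.
have Hrv := H_residual n (Hv n).
by rewrite (IH f)// sub0r [dot (e_ n) _](dotZl hH)// (IH (v n))// !mulr0 oppr0.
Qed.

Lemma dot_residual_gram_schmidt n f : H f -> dot (residual n f) (e_ n) = dot f (e_ n).
Proof.
move=> Hf; have He := H_gram_schmidt n.
rewrite (hilbert_conj hH He (H_residual n Hf)) (hilbert_conj hH He Hf).
congr (_^*); apply: dot_residualr => // i ni.
have Hrv := H_residual n (Hv n).
by rewrite [LHS](dotZl hH) ?residual_orth ?mulr0//; exact: H_gram_schmidt.
Qed.

Lemma residual_pythagoras f n : H f ->
  `N f ^+ 2 = \sum_(0 <= j < n) modulus (dot f (e_ j)) ^+ 2 + `N (residual n f) ^+ 2.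
Proof.
move=> Hf; elim: n => [|n IH]; first by rewrite big_geq// add0r.
rewrite big_nat_recr//= [LHS]IH -addrA; congr (_ + _).
have He := H_gram_schmidt n; have Hr := H_residual n Hf.
rewrite -/(e_ n) (sqr_hnormB hH)//; last exact: (hilbert_spaceZ hH).
rewrite (dotZr hH)// [_^* * _]mulrC mulcJ_modulus (hnormZ hH)// hnorm_gram_schmidt//.
by rewrite dot_residual_gram_schmidt//=; ring.
Qed.

Lemma residual_cauchy f p q : H f -> (p <= q)%N ->
  `N (residual p f - residual q f) ^+ 2 = `N (residual p f) ^+ 2 - `N (residual q f) ^+ 2.
Proof.
move=> Hf pq; have Hr n := H_residual n Hf.
rewrite (sqr_hnormB hH)// (hilbert_conj hH (Hr q) (Hr p)).
rewrite dot_residualr//; last by move=> i ip; apply: residual_orth => //; exact: leq_trans pq.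
rewrite -(@dot_residualr _ _ q)//; last by move=> i iq; apply: residual_orth.
by rewrite (dot_hnorm hH)//=; ring.
Qed.

Lemma hnormBC f g : H f -> H g -> `N (f - g) = `N (g - f).
Proof.
move=> Hf Hg; have -> : f - g = scalef (-1) (g - f).
  by apply/funext => x; rewrite /scalef mulN1r -[in LHS]opprB.
by rewrite (hnormZ hH) ?modulusN ?(modulus_real 1) ?normr1 ?mul1r//; exact: (hilbert_spaceB hH).
Qed.

(** The residuals form a Cauchy sequence by Pythagoras, and their limit is
    orthogonal to all of the v n: this is Parseval's identity for the
    orthonormalisation of a total family. *)
Lemma parseval f : H f -> (forall g, H g -> (forall n, dot g (v n) = 0) -> g = 0) ->
  \sum_(0 <= j < n) modulus (dot f (e_ j)) ^+ 2 @[n --> \oo] --> `N f ^+ 2.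
Proof.
move=> Hf total; pose u n := `N (residual n f) ^+ 2.
have Hr n : H (residual n f) by exact: H_residual.
have nu : nonincreasing_seq u.
  by move=> p q pq; rewrite -subr_ge0 -residual_cauchy// sqr_ge0.
have cu : cvgn u.
  apply: nonincreasing_is_cvgn => //; exists 0 => _ [n _ <-]; exact: sqr_ge0.
have lu n : limn u <= u n by apply: nonincreasing_cvgn_ge.
have [e e0|g Hg rg] := hilbert_complete hH Hr.
  have /cvgrPdist_lt/(_ _ (exprn_gt0 2 e0))[N _ Nu] := cu.
  have half p q : (N <= p)%N -> (p <= q)%N -> `N (residual p f - residual q f) < e.
    move=> Np pq; rewrite -(@ltr_pXn2r _ 2)// ?nnegrE ?hnorm_ge0 ?ltW// residual_cauchy//.
    apply: le_lt_trans (Nu _ Np); rewrite distrC ger0_norm ?subr_ge0//.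
    by apply: lerB => //; exact: (lu q).
  exists N => p q Np Nq; have [pq|/ltnW qp] := leqP p q; first exact: half.
  by rewrite hnormBC//; exact: half.
have lim0 h : H h -> (\forall n \near \oo, dot (residual n f) h = 0) -> dot g h = 0.
  move=> Hh rh; apply: ComplexField.Normc.eq0_normc; apply/eqP; rewrite -/(modulus _) eq_le modulus_ge0 andbT.
  have : hnorm dot (residual n f - g) * `N h @[n --> \oo] --> 0 * `N h.
    by apply: cvgMl; exact: rg.
  rewrite mul0r => c0; rewrite -(cvg_lim (@Rhausdorff R) c0).
  apply: limr_ge; first by apply/cvg_ex; exists 0.
  apply: filterS rh => n rh0; rewrite -modulusN -[- _]add0r -{1}rh0 -(dotBl hH)//.
  by apply: (cauchy_schwarz hH) => //; exact: (hilbert_spaceB hH).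
have ge j : dot g (e_ j) = 0.
  apply: lim0; first exact: H_gram_schmidt.
  by exists j.+1 => // n /= jn; exact: residual_orth.
have g0 : g = 0.
  apply: total => // n; rewrite -(@dot_residualr _ _ n)//.
  have Hrv := H_residual n (Hv n).
  by rewrite (normalizeK Hrv) (dotZr hH) ?ge ?mulr0//; exact: H_gram_schmidt.
have u0 : u n @[n --> \oo] --> 0.
  have -> : u = fun n => hnorm dot (residual n f - g) ^+ 2 by apply/funext => n; rewrite g0 subr0.
  by rewrite -[X in _ --> X](mulr0 0); exact: (cvgM rg rg).
have -> : (fun n => \sum_(0 <= j < n) modulus (dot f (e_ j)) ^+ 2) = fun n => `N f ^+ 2 - u n.
  by apply/funext => n; rewrite (residual_pythagoras n Hf) addrK.
by rewrite -[X in _ --> X]subr0; apply: cvgB => //; exact: cvg_cst.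
Qed.

End gram_schmidt.

(** * Reproducing kernels of spaces of hyperbolic harmonic functions *)

Section reproducing_kernel.
Context {R : realType} {T : Type}.
Variables (H : set (T -> R[i])) (dot : (T -> R[i]) -> (T -> R[i]) -> R[i]).
Variables (K : T -> T -> R[i]) (rkhsH : is_rkhs H dot K).

Lemma kernel_diag x : K x x = (hnorm dot (ksection K x) ^+ 2)%:C.
Proof.
rewrite -(dot_hnorm (rkhs_hilbert rkhsH)); last exact: (rkhs_section rkhsH).
by rewrite -(rkhs_reproducing rkhsH)//; exact: (rkhs_section rkhsH).
Qed.

Lemma Re_kernel_diag x : complex.Re (K x x) = hnorm dot (ksection K x) ^+ 2.
Proof. by rewrite kernel_diag. Qed.

Lemma Re_kernel_diag_ge0 x : 0 <= complex.Re (K x x).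
Proof. by rewrite Re_kernel_diag sqr_ge0. Qed.

Lemma dot_ksection f x : H f -> dot (ksection K x) f = (f x)^*.
Proof.
move=> Hf; rewrite (rkhs_reproducing rkhsH x Hf).
by apply: (hilbert_conj (rkhs_hilbert rkhsH)) => //; exact: (rkhs_section rkhsH).
Qed.

End reproducing_kernel.

Section harmonic_space.
Context {R : realType} {m : nat}.
Implicit Types (x : uball R m) (f : uball R m -> R[i]).

Lemma re_extE f x : re_ext f (\val x) = complex.Re (f x).
Proof. exact: (congr1 (fun g => complex.Re (g x)) (valLK 0 f)). Qed.

Lemma im_extE f x : im_ext f (\val x) = complex.Im (f x).
Proof. exact: (congr1 (fun g => complex.Im (g x)) (valLK 0 f)). Qed.

Lemma harmonic_continuous_re f (y : 'rV[R]_m) : H_harmonic f -> unit_ball y ->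
  {for y, continuous (re_ext f)}.
Proof. by case=> + _ _ _ yB => /(_ _ yB)[]. Qed.

Lemma harmonic_continuous_im f (y : 'rV[R]_m) : H_harmonic f -> unit_ball y ->
  {for y, continuous (im_ext f)}.
Proof. by case=> _ + _ _ yB => /(_ _ yB)[]. Qed.

Lemma measurable_harmonic_re f : H_harmonic f ->
  measurable_fun setT (fun x : borel (uball R m) => complex.Re (f x)).
Proof.
move=> hf; under eq_fun do rewrite -re_extE.
by apply: uball_continuous_measurable => y yB; exact: harmonic_continuous_re.
Qed.

Lemma measurable_harmonic_im f : H_harmonic f ->
  measurable_fun setT (fun x : borel (uball R m) => complex.Im (f x)).
Proof.
move=> hf; under eq_fun do rewrite -im_extE.
by apply: uball_continuous_measurable => y yB; exact: harmonic_continuous_im.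
Qed.

Lemma measurable_harmonic_modulus f : H_harmonic f ->
  measurable_fun setT (fun x : borel (uball R m) => modulus (f x) ^+ 2).
Proof.
move=> hf; under eq_fun do rewrite sqr_modulus.
apply: measurable_funD; apply: measurable_funX.
- exact: measurable_harmonic_re.
- exact: measurable_harmonic_im.
Qed.

Lemma uball_dense_seq : exists x_ : nat -> uball R m,
  forall U : set 'rV[R]_m, open U -> U `&` unit_ball !=set0 -> exists n, U (\val (x_ n)).
Proof.
pose rv (q : 'rV[rat]_m) : 'rV[R]_m := map_mx ratr q.
pose x_ n : uball R m := if @unpickle 'rV[rat]_m n is Some q then
    (if pselect (rv q \in unit_ball) is left qB then exist _ (rv q) qB else point)
  else point.
exists x_ => U oU [v [Uv Bv]].
have /nbhs_ballP[e /= e0 eW] : nbhs v (U `&` unit_ball).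
  by apply: open_nbhs_nbhs; split=> //; apply: openI => //; exact: open_unit_ball.
have /choice[q qv] (i : 'I_m) : exists r : rat, `|ratr r - v ord0 i| < e.
  have [|r] := @rat_in_itvoo R (v ord0 i - e) (v ord0 i + e).
    by rewrite ltrD2l gtrN.
  by rewrite in_itv /= => rv'; exists r; rewrite ltr_distl.
have [Uq Bq] : (U `&` unit_ball) (rv (\row_i q i)).
  apply: eW; split=> // i j; rewrite !mxE (ord1 i) -ball_normE /= distrC.
  exact: qv.
exists (pickle (\row_i q i)); rewrite /x_ pickleK.
by case: pselect => [//|]; rewrite inE.
Qed.

Lemma harmonic_eq0 (x_ : nat -> uball R m) f : H_harmonic f ->
  (forall U : set 'rV[R]_m, open U -> U `&` unit_ball !=set0 -> exists n, U (\val (x_ n))) ->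
  (forall n, f (x_ n) = 0) -> f = 0.
Proof.
move=> hf dense_x f0.
have zero (u : 'rV[R]_m -> R) (x : uball R m) :
    (forall y, unit_ball y -> {for y, continuous u}) ->
    (forall n, u (\val (x_ n)) = 0) -> u (\val x) = 0.
  move=> cu u0; apply/eqP/negP => /negP ux.
  have xB : unit_ball (\val x) by exact/set_mem/(valP x).
  have [||n [un _]] := dense_x [set y | u y != 0 /\ unit_ball y].
  - rewrite openE => y [uy By]; apply: filterI; last first.
      by apply: open_nbhs_nbhs; split=> //; exact: open_unit_ball.
    have u1 : nbhs (u y) [set z : R | z != 0].
      by apply: open_nbhs_nbhs; split=> //; exact: open_neq.
    exact: (cu _ By _ u1).
  - by exists (\val x).
  - by move: un; rewrite u0 eqxx.
apply/funext => x; apply/eqP; rewrite eq_complex -re_extE -im_extE.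
rewrite (zero (re_ext f)); last 2 first.
- by move=> y yB; exact: harmonic_continuous_re.
- by move=> n; rewrite re_extE f0.
rewrite (zero (im_ext f)) ?eqxx//.
- by move=> y yB; exact: harmonic_continuous_im.
- by move=> n; rewrite im_extE f0.
Qed.

Variables (H : set (uball R m -> R[i])).
Variables (dot : (uball R m -> R[i]) -> (uball R m -> R[i]) -> R[i]).
Variables (K : uball R m -> uball R m -> R[i]).
Hypotheses (rkhsH : is_rkhs H dot K) (harmonicH : H `<=` H_harmonic).

(** Harmonic functions are continuous, hence the kernel functions at a dense
    sequence of points are total. *)
Lemma exists_orthonormal_basis : exists e_ : nat -> uball R m -> R[i],
  [/\ forall j, H (e_ j),
      forall f, H f -> \sum_(0 <= j < n) modulus (dot f (e_ j)) ^+ 2 @[n --> \oo] --> hnorm dot f ^+ 2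
    & forall x, \sum_(0 <= j < n) modulus (e_ j x) ^+ 2 @[n --> \oo] --> complex.Re (K x x)].
Proof.
have [x_ dense_x] := uball_dense_seq; have hH := rkhs_hilbert rkhsH.
pose v n := ksection K (x_ n); have Hv n : H (v n) by exact: (rkhs_section rkhsH).
have total g : H g -> (forall n, dot g (v n) = 0) -> g = 0.
  move=> Hg gv; apply: (harmonic_eq0 (harmonicH Hg) dense_x) => n.
  by rewrite (rkhs_reproducing rkhsH)//; exact: gv.
exists (gram_schmidt dot v); split.
- by move=> j; exact: H_gram_schmidt hH _ _ _.
- by move=> f Hf; exact: parseval hH _ _ _ _ _.
- move=> x; rewrite (Re_kernel_diag rkhsH).
  have Hx : H (ksection K x) by exact: (rkhs_section rkhsH).
  have dotE j : modulus (dot (ksection K x) (gram_schmidt dot v j)) = modulus (gram_schmidt dot v j x).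
    by rewrite (dot_ksection rkhsH) ?modulusJ//; exact: (H_gram_schmidt hH).
  have := parseval hH Hv Hx total.
  by under eq_fun do under eq_bigr do rewrite dotE.
Qed.

Lemma measurable_kernel_diag :
  measurable_fun setT (fun x : borel (uball R m) => complex.Re (K x x)).
Proof.
have [e_ [He _ cK]] := exists_orthonormal_basis.
pose h n (x : borel (uball R m)) := \sum_(0 <= j < n) modulus (e_ j x) ^+ 2.
apply: (measurable_fun_cvg (h := h)) => // [n|x _]; last exact: cK.
apply: measurable_sum => j; by apply: measurable_harmonic_modulus; exact: harmonicH.
Qed.

End harmonic_space.

(** * Convergence of series *)

Section nonnegative_series.
Context {R : realType}.
Implicit Types u : nat -> R.

Lemma nneseries_le_bound u (B : R) : (forall n, 0 <= u n) ->
  (forall n, \sum_(0 <= j < n) u j <= B) -> (\sum_(0 <= j <oo) (u j)%:E <= B%:E)%E.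
Proof.
move=> u0 uB; apply: lime_le; first by apply: is_cvg_nneseries => n _ _; rewrite lee_fin.
by apply: nearW => n; rewrite sumEFin lee_fin.
Qed.

Lemma nneseries_lty_cvg u : (forall n, 0 <= u n) -> (\sum_(0 <= j <oo) (u j)%:E < +oo)%E ->
  cvgn (series u).
Proof.
move=> u0 uoo; apply: nondecreasing_is_cvgn.
  by apply/nondecreasing_seqP => n; rewrite seriesEnat /= big_nat_recr//= lerDl.
have fin : (\sum_(0 <= j <oo) (u j)%:E)%E \is a fin_num.
  by rewrite ge0_fin_numE//; apply: nneseries_ge0 => n _ _; rewrite lee_fin.
exists (fine (\sum_(0 <= j <oo) (u j)%:E)%E) => _ [n _ <-].
rewrite -lee_fin fineK// seriesEnat /= -sumEFin.
by apply: nneseries_lim_ge => j _ _; rewrite lee_fin.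
Qed.

Lemma nneseries_lty_cvg0 u : (forall n, 0 <= u n) -> (\sum_(0 <= j <oo) (u j)%:E < +oo)%E ->
  u n @[n --> \oo] --> 0.
Proof. by move=> u0 /(nneseries_lty_cvg u0); exact: cvg_series_cvg_0. Qed.

Lemma nneseries_geometric_lty (q : R) : 0 <= q -> q < 1 ->
  (\sum_(0 <= j <oo) (q ^+ j)%:E < +oo)%E.
Proof.
move=> q0 q1; apply: (@le_lt_trans _ _ (1 - q)^-1%:E); last exact: ltry.
apply: nneseries_le_bound => [n|n]; first exact: exprn_ge0.
have := congr1 (@^~ n) (@geometric_seriesE R 1 q _); rewrite lt_eqF// => /(_ isT).
rewrite seriesEnat /= => E; under eq_bigr do rewrite -[_ ^+ _]mul1r.
rewrite E mul1r ler_piMl ?invr_ge0 ?subr_ge0 ?(ltW q1)//.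
by rewrite gerBl exprn_ge0.
Qed.

Lemma sqrt_cvg0 u : u n ^+ 2 @[n --> \oo] --> 0 -> u n @[n --> \oo] --> 0.
Proof.
move=> u2; apply/norm_cvg0P; have -> : (fun n => `|u n|) = Num.sqrt \o (fun n => u n ^+ 2).
  by apply/funext => n; rewrite /= sqrtr_sqr.
by rewrite -[X in _ --> X]sqrtr0; apply: continuous_cvg => //; exact: sqrt_continuous.
Qed.

Lemma cvg_modulus (w : nat -> R[i]^o) (l : R[i]) :
  modulus (w n - l) @[n --> \oo] --> 0 -> w n @[n --> \oo] --> (l : R[i]^o).
Proof.
move=> wl; apply/cvgrPdist_lt => e; rewrite ltcE /= => /andP[/eqP eI e0].
have eE : e = (complex.Re e)%:C by case: e eI {e0} => x y /= ->.
move/cvgrPdist_lt : wl => /(_ _ e0); apply: filterS => n.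
rewrite sub0r normrN ger0_norm ?modulus_ge0// => we.
by rewrite eE distrC [`|_|](_ : _ = (modulus (w n - l))%:C)// ltcR.
Qed.

End nonnegative_series.

(** Expectation and non-negative series commute. *)
Lemma ae_nneseries_lty {R : realType} d (T : measurableType d) (P : {measure set T -> \bar R})
    (Y : nat -> T -> \bar R) :
  (forall n, measurable_fun setT (Y n)) -> (forall n t, (0 <= Y n t)%E) ->
  (\sum_(0 <= n <oo) \int[P]_t Y n t < +oo)%E ->
  {ae P, forall t, (\sum_(0 <= n <oo) Y n t < +oo)%E}.
Proof.
move=> mY Y0; rewrite -integral_nneseries// => Yoo.
have S0 t : (0 <= \sum_(0 <= n <oo) Y n t)%E by exact: nneseries_ge0.
have mS : measurable_fun setT (fun t => \sum_(0 <= n <oo) Y n t)%E.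
  exact: ge0_emeasurable_sum.
have : P.-integrable setT (fun t => \sum_(0 <= n <oo) Y n t)%E.
  by apply/integrableP; split=> //; under eq_integral do rewrite gee0_abs//.
move/(integrable_ae measurableT); apply: filterS => t /(_ I).
by rewrite ge0_fin_numE.
Qed.

Lemma limn_einf_le {R : realType} (u : nat -> \bar R) (B : \bar R) :
  (forall n, (u n <= B)%E) -> (limn_einf u <= B)%E.
Proof.
move=> uB; rewrite limn_einf_lim; apply: lime_le; first exact: is_cvg_einfs.
apply: nearW => n; apply: le_trans (uB n); apply: ereal_inf_lbound.
by exists n => /=.
Qed.

Section hilbert_series.
Context {R : realType} {T : Type}.
Variables (H : set (T -> R[i])) (dot : (T -> R[i]) -> (T -> R[i]) -> R[i]).
Hypothesis hH : is_hilbert_space H dot.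
Local Notation "`N f" := (hnorm dot f) (at level 10, f at level 8).

Lemma ler_dist_hnorm f g : H f -> H g -> `| `N f - `N g | <= `N (f - g).
Proof.
move=> Hf Hg; have := hnormD hH (hilbert_spaceB hH Hf Hg) Hg; have := hnormD hH (hilbert_spaceB hH Hg Hf) Hf.
rewrite !subrK (hnormBC hH Hg Hf) ler_distlC => h1 h2.
by apply/andP; split; lra.
Qed.

Lemma hseries_cvg (t : nat -> T -> R[i]) : (forall n, H (t n)) ->
  (\sum_(0 <= j <oo) (`N (t j))%:E < +oo)%E -> exists2 f, H f & hseries dot t f.
Proof.
move=> Ht toolty; have N0 n : 0 <= `N (t n) by exact: hnorm_ge0.
have HS n : H (\sum_(0 <= j < n) t j) by exact: (hilbert_space_sum hH).
apply: (hilbert_complete hH) => // e e0.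
have /cauchy_cvgP/cauchy_seriesP/(_ _ e0) := nneseries_lty_cvg N0 toolty.
move=> [[A B] /= [[M _ AM] [N _ BN]] AB]; exists (maxn M N).
have half p q : (maxn M N <= p)%N -> (p <= q)%N ->
    `N (\sum_(0 <= j < q) t j - \sum_(0 <= j < p) t j) < e.
  rewrite geq_max => /andP[Mp Np] pq.
  rewrite (big_cat_nat (leq0n p) pq)/= addrAC subrr add0r.
  apply: le_lt_trans (hnorm_sum hH _ Ht) _.
  have := AB (p, q) (conj (AM p Mp) (BN q (leq_trans Np pq))).
  by rewrite /= ger0_norm// sumr_ge0.
move=> p q Mp Mq; have [pq|/ltnW qp] := leqP p q; last exact: half.
by rewrite (hnormBC hH)//; exact: half.
Qed.

End hilbert_series.

(** * Linear statistics of configurations *)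

Section finite_windows.
Context {R : realType} {E : ptopologicalType}.
Implicit Types (X : Conf E) (B : set E).

(** Relatively compact windows make the sums over X finite; multiplicities are
    kept out of this list and enter the sums as coefficients. *)
Definition points X B : seq E :=
  finmap.enum_fset (fset_set (B `&` [set x | X x != 0%N])).

Lemma fsbig_points (V : nmodType) (g : E -> V) X B : precompact B ->
  (forall x, X x = 0%N -> g x = 0) -> \sum_(x \in B) g x = \sum_(x <- points X B) g x.
Proof.
move=> pB g0; have fB := mult_locally_finite X pB.
rewrite -(fsbig_finite _ g fB); apply/esym/fsbig_widen; first by move=> x [].
by move=> x [Bx] /= /not_andP[//|/negP/negPn/eqP]; exact: g0.
Qed.

Lemma esum_points (g : E -> \bar R) X B : precompact B -> (forall x, 0 <= g x)%E ->
  (forall x, X x = 0%N -> g x = 0%E) ->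
  (\esum_(x in B) g x = \sum_(x <- points X B) g x)%E.
Proof.
move=> pB g0 gX; have fB := mult_locally_finite X pB.
rewrite /points -(fsbig_finite _ g fB) -esum_fset// [LHS]esum_mkcond [RHS]esum_mkcond.
apply: eq_esum => x _; rewrite in_setI; case: (x \in B) => //=; case: ifPn => //.
by rewrite notin_setE => /negP/negPn/eqP; exact: gX.
Qed.

Lemma nnsum_points (h : E -> R) X B : precompact B -> (forall x, 0 <= h x) ->
  (forall x, x \notin B -> h x = 0) ->
  nnsum X h = (\sum_(x <- points X B) (X x)%:R * h x)%:E.
Proof.
move=> pB h0 hB; rewrite -sumEFin -esum_points//.
- rewrite [RHS]esum_mkcond; apply: eq_esum => x _.
  by case: ifPn => // /hB ->; rewrite mulr0.
- by move=> x; rewrite lee_fin mulr_ge0.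
- by move=> x ->; rewrite mul0r.
Qed.

Lemma rsum_points (h : E -> R) X B : precompact B -> (forall x, x \notin B -> h x = 0) ->
  rsum X h = \sum_(x <- points X B) (X x)%:R * h x.
Proof.
move=> pB hB; rewrite /rsum (@nnsum_points _ X B)//; last first.
  by move=> x /hB hx; rewrite /funrpos hx maxxx.
rewrite (@nnsum_points _ X B)//; last first.
  by move=> x /hB hx; rewrite /funrneg hx oppr0 maxxx.
rewrite /= -sumrB; apply: eq_bigr => x _; rewrite -mulrBr; congr (_ * _).
exact: (congr1 (@^~ x) (funrposBneg h)).
Qed.

Lemma csum_points (f : E -> R[i]) X B : precompact B -> (forall x, x \notin B -> f x = 0) ->
  csum X f = \sum_(x <- points X B) (X x)%:R * f x.
Proof.
move=> pB fB; rewrite /csum !(@rsum_points _ X B)//; try by move=> x /fB ->.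
elim: (points X B) => [|x r IH]; first by rewrite !big_nil.
rewrite !big_cons -IH; case: (f x) => u w.
by rewrite -(rmorph_nat (real_complex R)) /=; simpc.
Qed.

Lemma num_points_fsum X B : precompact B ->
  num_points B X = (\sum_(x \in B) X x)%N%:R%:E :> \bar R.
Proof.
move=> pB; rewrite /num_points (@esum_points _ X B)//; last by move=> x ->.
by rewrite sumEFin -natr_sum -fsbig_points.
Qed.

Lemma measurable_num_points B : precompact B -> measurable (B : set (borel E)) ->
  measurable_fun [set: Conf E] (num_points B : Conf E -> \bar R).
Proof.
move=> pB mB; rewrite (_ : num_points B = fun X => (\sum_(x \in B) X x)%N%:R%:E); last first.
  by apply/funext => X; exact: num_points_fsum.
apply/measurable_EFinP; pose N X := (\sum_(x \in B) X x)%N.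
have -> : (fun X => (\sum_(x \in B) X x)%N%:R : R) = (fun n : nat => n%:R) \o N by [].
move=> _ Y mY; rewrite setTI comp_preimage.
rewrite [X in measurable X](_ : _ = \bigcup_(n in [set n : nat | Y n%:R]) [set X : Conf E | N X = n]).
  apply: bigcup_measurable => n _; apply: sub_sigma_algebra.
  by exists B, n; split.
by apply/seteqP; split=> [X YX|X [n Yn XN]]; [exists (N X)|rewrite /preimage /= [N X]XN].
Qed.

End finite_windows.

Section campbell.
Context {R : realType} {E : ptopologicalType}.
Local Open Scope ereal_scope.

Definition window_sum (B : set E) (f : E -> \bar R) (X : Conf E) : \bar R :=
  \sum_(x <- points X B) (X x)%:R%:E * f x.

Lemma window_sum_indic (B A : set E) X : precompact B ->
  window_sum B (fun x => (\1_A x)%:E) X = num_points (B `&` A) X.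
Proof.
move=> pB; rewrite /num_points esum_mkcondr (@esum_points _ _ _ X B)//.
- apply: eq_bigr => x _; rewrite indicE.
  by case: ifPn => _; rewrite ?mule1 ?mule0.
- by move=> x; case: ifPn => _; rewrite ?lee_fin.
- by move=> x ->; rewrite if_same.
Qed.

Lemma window_sum_esum (B : set E) (f : E -> \bar R) X : precompact B -> (forall x, 0 <= f x) ->
  window_sum B f X = \esum_(x in B) ((X x)%:R%:E * f x).
Proof.
move=> pB f0; rewrite (@esum_points _ _ _ X B)//.
- by move=> x; rewrite mule_ge0// lee_fin.
- by move=> x ->; rewrite mul0e.
Qed.

Lemma window_sum_ge0 (B : set E) (f : E -> \bar R) X : (forall x, 0 <= f x) ->
  0 <= window_sum B f X.
Proof. by move=> f0; apply: sume_ge0 => x _; rewrite mule_ge0// lee_fin. Qed.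

Variables (Pi : probability (Conf E) R) (nu : {measure set (borel E) -> \bar R}).
Hypothesis intensity : forall B : set (borel E), measurable B -> first_intensity Pi B = nu B.

(** The formula holds for indicators by definition of the intensity, and both
    sides are linear and continuous along increasing sequences. *)
Lemma campbell_window (B : set E) (f : borel E -> \bar R) : precompact B ->
  measurable (B : set (borel E)) -> measurable_fun setT f -> (forall x, 0 <= f x) ->
  measurable_fun setT (window_sum B f) /\
  \int[Pi]_X window_sum B f X = \int[nu]_(x in (B : set (borel E))) f x.
Proof.
move=> pB mB; move: f; apply: ge0_measurable_fun_ind.
- move=> A mA.
  have -> : window_sum B (fun x => (\1_A x)%:E) = num_points (B `&` A).
    by apply/funext => X; exact: window_sum_indic.
  have mBA : measurable (B `&` A : set (borel E)) by exact: measurableI.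
  split; last by rewrite integral_indic// [in RHS]setIC; exact: (intensity mBA).
  by apply: measurable_num_points => //; apply: precompact_subset pB => x [].
- move=> k f k0 mf f0 [mwf If].
  have -> : window_sum B (fun x => k%:E * f x) = fun X => k%:E * window_sum B f X.
    apply/funext => X; rewrite /window_sum ge0_sume_distrr; last first.
      by move=> x _; rewrite mule_ge0// lee_fin.
    by apply: eq_bigr => x _; rewrite muleCA.
  split; first exact: measurable_funeM.
  rewrite ge0_integralZl//; last by move=> X _; exact: window_sum_ge0.
  rewrite If ge0_integralZl//; exact: measurable_funTS.
- move=> f g mf mg f0 g0 [mwf If] [mwg Ig].
  have -> : window_sum B (fun x => f x + g x) = fun X => window_sum B f X + window_sum B g X.
    apply/funext => X; rewrite /window_sum -big_split; apply: eq_bigr => x _.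
    by rewrite ge0_muleDr.
  split; first exact: emeasurable_funD.
  rewrite ge0_integralD//; [|by move=> X _; exact: window_sum_ge0..].
  by rewrite If Ig ge0_integralD//; exact: measurable_funTS.
- move=> f mf f0 ndf IH.
  have cf x : cvgn (f^~ x) by apply: ereal_nondecreasing_is_cvgn; exact: ndf.
  have cw X : window_sum B (f n) X @[n --> \oo] --> window_sum B (fun x => limn (f^~ x)) X.
    apply: cvg_nnesum => x _; last exact: cvgeZl.
    by apply: nearW => n; rewrite mule_ge0// lee_fin.
  have mw : measurable_fun setT (window_sum B (fun x => limn (f^~ x))).
    apply: (@emeasurable_fun_cvg _ _ _ _ (fun n => window_sum B (f n))) => [n|X _].
      by have [] := IH n.
    exact: cw.
  split=> //.
  transitivity (limn (fun n => \int[Pi]_X window_sum B (f n) X)); last first.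
    rewrite monotone_convergence//.
    + by congr (limn _); apply/funext => n; have [] := IH n.
    + by move=> n; apply: measurable_funTS.
  rewrite -monotone_convergence//.
  + by apply: eq_integral => X _; apply/esym/cvg_lim => //; exact: cw.
  + by move=> n; have [] := IH n.
  + by move=> n X _; exact: window_sum_ge0.
  + move=> X _ i j ij; apply: lee_sum => x _; rewrite lee_wpmul2l ?lee_fin//.
    exact: ndf.
Qed.

Lemma cvg_esum_exhaustion (B_ : nat -> set E) (g : E -> \bar R) :
  (forall i j, (i <= j)%N -> B_ i `<=` B_ j) -> (forall x, exists n, B_ n x) ->
  (forall x, 0 <= g x) -> \esum_(x in B_ n) g x @[n --> \oo] --> \esum_(x in [set: E]) g x.
Proof.
move=> ndB BT g0; pose u n := \esum_(x in B_ n) g x.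
have le_esumS (A C : set E) : A `<=` C -> \esum_(x in A) g x <= \esum_(x in C) g x.
  move=> AC; rewrite [leLHS]esum_mkcond [leRHS]esum_mkcond; apply: le_esum => x _.
  case: ifPn => [/set_mem/AC/mem_set ->//|_]; case: ifPn => // _; exact: g0.
have ndu : nondecreasing_seq u by move=> i j ij; exact/le_esumS/ndB.
rewrite (_ : \esum_(x in setT) _ = ereal_sup (range u)); first exact: ereal_nondecreasing_cvgn.
apply/eqP; rewrite eq_le; apply/andP; split; last first.
  by apply: ge_ereal_sup => _ [n _ <-]; exact: le_esumS.
apply: ge_ereal_sup => _ [F [finF _] <-].
have [n FB] : exists n, F `<=` B_ n.
  have /choice[N BN] := BT; have [s ->] := (finite_seqP F).1 finF.
  exists (\max_(x <- s) N x)%N => x xs; apply: ndB (BN x).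
  by apply: leq_bigmax_seq.
apply: (@le_trans _ _ (u n)); last by apply: ereal_sup_ubound; exists n.
by apply: esum_ge; exists F.
Qed.

Variable B_ : nat -> set E.
Hypotheses (pB : forall n, precompact (B_ n)) (mB : forall n, measurable (B_ n : set (borel E))).
Hypotheses (ndB : forall i j, (i <= j)%N -> B_ i `<=` B_ j) (BT : forall x, exists n, B_ n x).

(** Campbell's formula: an exhaustion by windows removes the compactness of the
    support. *)
Lemma campbell (h : borel E -> R) : measurable_fun setT h -> (forall x, (0 <= h x)%R) ->
  measurable_fun setT (fun X => nnsum X h) /\
  \int[Pi]_X nnsum X h = \int[nu]_x (h x)%:E.
Proof.
move=> mh h0; have mh' : measurable_fun setT (EFin \o h) by exact/measurable_EFinP.
have h0' x : 0 <= (EFin \o h) x by rewrite lee_fin.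
have cw X : window_sum (B_ n) (EFin \o h) X @[n --> \oo] --> nnsum X h.
  under eq_fun do rewrite window_sum_esum//; apply: cvg_esum_exhaustion => // x.
  by rewrite lee_fin mulr_ge0.
have IH n := campbell_window (pB n) (mB n) mh' h0'.
split.
  apply: (@emeasurable_fun_cvg _ _ _ _ (fun n => window_sum (B_ n) (EFin \o h))) => [n|X _].
    by have [] := IH n.
  exact: cw.
transitivity (limn (fun n => \int[Pi]_X window_sum (B_ n) (EFin \o h) X)).
  rewrite -monotone_convergence//.
  - by apply: eq_integral => X _; apply/esym/cvg_lim => //; exact: cw.
  - by move=> n; have [] := IH n.
  - by move=> n X _; exact: window_sum_ge0.
  - move=> X _ i j ij; rewrite !window_sum_esum// [leLHS]esum_mkcond [leRHS]esum_mkcond.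
    apply: le_esum => x _; case: ifPn => [/set_mem/(ndB ij)/mem_set ->//|_].
    by case: ifPn => // _; rewrite mule_ge0// lee_fin.
have -> : (fun n => \int[Pi]_X window_sum (B_ n) (EFin \o h) X) =
    fun n => \int[nu]_(x in (B_ n : set (borel E))) (h x)%:E.
  by apply/funext => n; have [] := IH n.
rewrite -[in RHS](_ : \bigcup_n B_ n = setT); last first.
  by apply/seteqP; split=> // x _; have [n Bn] := BT x; exists n.
apply/cvg_lim => //; apply: ge0_nondecreasing_set_cvg_integral => //.
- by move=> i j ij; apply/subsetPset; exact: ndB.
- by move=> i; exact: measurable_funTS.
- by move=> i x _; exact: h0'.
Qed.

End campbell.

(** * Point processes with constant intensity and small variance *)

Section windows.
Context {R : realType} {k : nat}.
Notation m := k.+2.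
Variable a : uball R m.
Local Notation p x := (pdist (\val a) (\val x)).
Let a1 : sqnorm (\val a) < 1 := sqnorm_uball a.

Definition window (M : R) : set (uball R m) := [set x | p x <= M].

Lemma windowE M : window M = \val @^-1` hyp_closed_ball (\val a) M.
Proof.
apply/seteqP; split=> x; rewrite /window /=.
  move=> xM; have := indic_hyp_closed_ball a1 M x; rewrite xM indicE.
  by case: (boolP (_ \in _)) => [/set_mem//|_ /eqP]; rewrite eq_sym oner_eq0.
by move=> /mem_set xM; have := indic_hyp_closed_ball a1 M x; rewrite indicE xM; case: leP => // _ /eqP; rewrite oner_eq0.
Qed.

Lemma closed_window M : closed (window M).
Proof.
rewrite windowE; apply: closed_comp; last exact: closed_hyp_closed_ball.
by move=> x _; exact: continuous_uball_val.
Qed.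

Lemma measurable_window M : measurable (window M : set (borel (uball R m))).
Proof. exact: (@closed_borel_measurable (uball R m) _ (@closed_window M)). Qed.

(** The closed hyperbolic balls are compact subsets of the open ball. *)
Lemma precompact_window M : 0 <= M -> precompact (window M).
Proof.
move=> M0; rewrite precompact_closed; last exact: closed_window.
rewrite windowE => F FF FW.
have [|y [yM cy]] := @compact_hyp_closed_ball R k _ a1 M M0 (\val @ F) _; first exact: FW.
have yB : unit_ball y := hyp_closed_ball_sub a1 M0 yM.
exists (exist _ y (mem_set yB)); split=> //= A N FA.
rewrite nbhsE => -[U [oU Uy] UN]; case: oU Uy UN => V oV <- Vy UN.
have [|z [[x Ax <-] Vx]] := cy (\val @` A) V _ (open_nbhs_nbhs (conj oV Vy)).
  by apply: (@filterS _ F _ _ _ _ FA) => x Ax; exists x.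
by exists x; split=> //; exact: UN.
Qed.

Lemma window_le M N : M <= N -> window M `<=` window N.
Proof. by move=> MN x /le_trans; exact. Qed.

Lemma window_exhaustion (x : uball R m) : exists n : nat, window n%:R x.
Proof.
by exists (Num.truncn (p x)).+1; rewrite /window /= ltW// truncnS_gt.
Qed.

End windows.

Section moments.
Context {R : realType} {E : ptopologicalType}.
Variables (Pi : probability (Conf E) R) (nu : {measure set (borel E) -> \bar R}).
Hypothesis campbell_nu : forall h : borel E -> R, measurable_fun setT h -> (forall x, 0 <= h x) ->
  measurable_fun setT (fun X => nnsum X h) /\
  (\int[Pi]_X nnsum X h = \int[nu]_x (h x)%:E)%E.

Lemma nnsum_ge0 (X : Conf E) (h : E -> R) : (forall x, 0 <= h x) -> (0 <= nnsum X h)%E.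
Proof. by move=> h0; apply: esum_ge0 => x _; rewrite lee_fin mulr_ge0. Qed.

Lemma nnsum_expectation (h : borel E -> R) : measurable_fun setT h -> (forall x, 0 <= h x) ->
  nu.-integrable setT (EFin \o h) ->
  [/\ measurable_fun setT (fun X => fine (nnsum X h)),
      Pi.-integrable setT (EFin \o (fun X => fine (nnsum X h))),
      (\int[Pi]_X fine (nnsum X h) = \int[nu]_x h x)%R
    & {ae Pi, forall X, (nnsum X h < +oo)%E}].
Proof.
move=> mh h0 ih; have [mY EY] := campbell_nu mh h0.
have Y0 X : (0 <= nnsum X h)%E by exact: nnsum_ge0.
have iY : Pi.-integrable setT (fun X => nnsum X h).
  apply/integrableP; split=> //; under eq_integral do rewrite gee0_abs//.
  rewrite EY; exact: (integrable_lty measurableT ih).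
have aeY : {ae Pi, forall X, (nnsum X h < +oo)%E}.
  have := integrable_ae measurableT iY; apply: filterS => X /(_ I).
  by rewrite ge0_fin_numE.
have mfY : measurable_fun setT (fun X => fine (nnsum X h)) by exact: measurableT_comp.
have aeE : {ae Pi, forall X, setT X -> nnsum X h = (fine (nnsum X h))%:E}.
  by apply: filterS aeY => X Xoo _; rewrite fineK// ge0_fin_numE.
have E1 : (\int[Pi]_X (fine (nnsum X h))%:E = \int[Pi]_X nnsum X h)%E.
  by apply: ae_eq_integral => //; [exact/measurable_EFinP|apply: filterS aeE => X /[apply]].
split=> //.
- apply/integrableP; split; first exact/measurable_EFinP.
  under eq_integral do rewrite /= ger0_norm ?fine_ge0//.
  rewrite E1 EY; exact: (integrable_lty measurableT ih).
- by rewrite /Rintegral E1 EY.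
Qed.

Lemma rsum_expectation (h : borel E -> R) : measurable_fun setT h ->
  nu.-integrable setT (EFin \o h) ->
  [/\ measurable_fun setT (fun X => rsum X h),
      Pi.-integrable setT (EFin \o (fun X => rsum X h))
    & (\int[Pi]_X rsum X h = \int[nu]_x h x)%R].
Proof.
move=> mh ih.
have mp : measurable_fun setT h^\+ by exact: measurable_funrpos.
have mn : measurable_fun setT h^\- by exact: measurable_funrneg.
have ip : nu.-integrable setT (EFin \o h^\+).
  by have := integrable_funepos measurableT ih; rewrite -funerpos.
have in_ : nu.-integrable setT (EFin \o h^\-).
  by have := integrable_funeneg measurableT ih; rewrite -funerneg.
have [mYp iYp Ep _] := nnsum_expectation mp (funrpos_ge0 h) ip.
have [mYn iYn En _] := nnsum_expectation mn (funrneg_ge0 h) in_.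
split.
- exact: measurable_funB.
- exact: (integrableB measurableT iYp iYn).
- rewrite /rsum (RintegralB measurableT iYp iYn) Ep En -RintegralB//.
  by apply: eq_Rintegral => x _; exact: (congr1 (@^~ x) (funrposBneg h)).
Qed.

(** The expectations in the small variance inequality are integrals against the
    intensity, by Campbell's formula. *)
Lemma csum_variance (C : R) (f : borel E -> R[i]) :
  (measurable_fun [set: borel E] (fun x : borel E => complex.Re (f x)) ->
   measurable_fun [set: borel E] (fun x : borel E => complex.Im (f x)) ->
   (\int[Pi]_X nnsum X (fun x => (modulus (f x) + modulus (f x) ^+ 2)%R) < +oo)%E ->
   (cvariance Pi (csum^~ f) <=
     C%:E * \int[Pi]_X nnsum X (fun x => (modulus (f x) ^+ 2)%R))%E) ->
  measurable_fun setT (fun x => complex.Re (f x)) ->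
  measurable_fun setT (fun x => complex.Im (f x)) ->
  (\int[nu]_x (modulus (f x) + modulus (f x) ^+ 2)%:E < +oo)%E ->
  (\int[Pi]_X (modulus (csum X f - ((\int[nu]_x complex.Re (f x))%R +i*
      (\int[nu]_x complex.Im (f x))%R)) ^+ 2)%:E
    <= C%:E * \int[nu]_x (modulus (f x) ^+ 2)%:E)%E.
Proof.
move=> sv mre mim foo.
have mm2 : measurable_fun setT (fun x => modulus (f x) ^+ 2).
  by under eq_fun do rewrite sqr_modulus; apply: measurable_funD; exact: measurable_funX.
have mm : measurable_fun setT (fun x => modulus (f x)).
  have -> : (fun x => modulus (f x)) = Num.sqrt \o (fun x => modulus (f x) ^+ 2).
    by apply/funext => x; rewrite /= sqrtr_sqr ger0_norm ?modulus_ge0.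
  by apply: measurableT_comp mm2; apply: continuous_measurable_fun; exact: sqrt_continuous.
have m0 x : 0 <= modulus (f x) + modulus (f x) ^+ 2 by rewrite addr_ge0 ?modulus_ge0 ?sqr_ge0.
have ms : measurable_fun setT (fun x => modulus (f x) + modulus (f x) ^+ 2).
  exact: measurable_funD.
have ile (h : borel E -> R) : measurable_fun setT h -> (forall x, `|h x| <= modulus (f x)) ->
    nu.-integrable setT (EFin \o h).
  move=> mh hf; apply/integrableP; split; first exact/measurable_EFinP.
  apply: le_lt_trans foo; apply: ge0_le_integral => //.
  - by apply/measurable_EFinP; exact: measurableT_comp.
  - exact/measurable_EFinP.
  - by move=> x _; rewrite lee_fin (le_trans (hf x))// lerDl sqr_ge0.
have [mr _ Er] := rsum_expectation mre (ile _ mre (fun x => Re_le_modulus _)).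
have [mi _ Ei] := rsum_expectation mim (ile _ mim (fun x => Im_le_modulus _)).
have := sv mre mim; rewrite (campbell_nu ms m0).2 (campbell_nu mm2 (fun x => sqr_ge0 _)).2.
move=> /(_ foo); rewrite /cvariance unlock /cexpectation !unlock.
by rewrite -Er -Ei.
Qed.

End moments.

Lemma rsum_ge0 (R : realType) (E : ptopologicalType) (X : Conf E) (h : E -> R) :
  (forall x, 0 <= h x) -> rsum X h = fine (nnsum X h).
Proof.
move=> h0; rewrite /rsum.
have -> : h^\+ = h by apply/funext => x; exact/max_idPl.
have -> : h^\- = fun=> 0 by apply/funext => x; apply/max_idPr; rewrite oppr_le0.
by rewrite [X in _ - fine X](_ : _ = 0%E) ?subr0//; apply: esum1 => x _; rewrite mulr0.
Qed.

Section constant_intensity.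
Context {R : realType} {k : nat}.
Notation m := k.+2.
Notation uB := (borel (uball R m)).
Variables (a : uball R m) (Pi : probability (Conf (uball R m)) R).
Variables (lambda : R) (lambda_gt0 : 0 < lambda).
Hypothesis intensityPi : forall B : set (borel (uball R m)), measurable B ->
  first_intensity Pi B = (lambda%:E * mu_ball B)%E.

Definition intensity_measure : {measure set uB -> \bar R} :=
  mscale (NngNum (ltW lambda_gt0)) mu_ball.
Local Notation nu := intensity_measure.

Lemma campbell_ball (h : uB -> R) : measurable_fun setT h -> (forall x, 0 <= h x) ->
  measurable_fun setT (fun X => nnsum X h) /\
  (\int[Pi]_X nnsum X h = \int[nu]_x (h x)%:E)%E.
Proof.
apply: (@campbell _ _ _ _ _ (fun n => window a n%:R)).
- exact: intensityPi.
- by move=> n; exact: precompact_window.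
- by move=> n; exact: measurable_window.
- by move=> i j ij; apply: window_le; rewrite ler_nat.
- exact: window_exhaustion.
Qed.

Lemma ge0_integral_intensity (f : uB -> \bar R) : measurable_fun setT f -> (forall x, 0 <= f x)%E ->
  (\int[nu]_x f x = lambda%:E * \int[mu_ball]_x f x)%E.
Proof. by move=> mf f0; rewrite /intensity_measure ge0_integral_mscale. Qed.

Lemma Rintegral_intensity (h : uB -> R) : mu_ball.-integrable setT (EFin \o h) ->
  (\int[nu]_x h x)%R = lambda * (\int[mu_ball]_x h x)%R.
Proof.
move=> ih; have mh := measurable_int _ ih; rewrite /Rintegral integralE [in RHS]integralE.
rewrite !ge0_integral_intensity//; [|exact: measurable_funeneg|exact: measurable_funepos].
rewrite -muleBr//; last by apply: integrable_add_def.
by rewrite fineM//; rewrite -integralE; exact: integrable_fin_num.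
Qed.

Variable C : R.
Hypothesis C_gt0 : 0 < C.
Hypothesis small_var : forall f : uball R m -> R[i],
  measurable_fun [set: borel (uball R m)] (fun x : borel (uball R m) => complex.Re (f x)) ->
  measurable_fun [set: borel (uball R m)] (fun x : borel (uball R m) => complex.Im (f x)) ->
  (\int[Pi]_X nnsum X (fun x => (modulus (f x) + modulus (f x) ^+ 2)%R) < +oo)%E ->
  (cvariance Pi (csum^~ f) <=
    C%:E * \int[Pi]_X nnsum X (fun x => (modulus (f x) ^+ 2)%R))%E.

Lemma ball_variance (f : uB -> R[i]) :
  measurable_fun setT (fun x => complex.Re (f x)) ->
  measurable_fun setT (fun x => complex.Im (f x)) ->
  mu_ball.-integrable setT (fun x => (modulus (f x))%:E) ->
  mu_ball.-integrable setT (fun x => (modulus (f x) ^+ 2)%:E) ->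
  (\int[Pi]_X (modulus (csum X f - ((lambda * (\int[mu_ball]_x complex.Re (f x))%R) +i*
      (lambda * (\int[mu_ball]_x complex.Im (f x))%R))) ^+ 2)%:E
    <= (C * lambda)%:E * \int[mu_ball]_x (modulus (f x) ^+ 2)%:E)%E.
Proof.
move=> mre mim i1 i2.
have m1 := measurable_int _ i1; have m2 := measurable_int _ i2.
have ile (h : uB -> R) : measurable_fun setT h -> (forall x, `|h x| <= modulus (f x)) ->
    mu_ball.-integrable setT (EFin \o h).
  move=> mh hf; apply: (le_integrable measurableT _ _ i1); first exact/measurable_EFinP.
  by move=> x _; rewrite lee_fin (le_trans (hf x))// ler_norm.
have foo : (\int[nu]_x (modulus (f x) + modulus (f x) ^+ 2)%:E < +oo)%E.
  under eq_integral do rewrite EFinD.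
  rewrite ge0_integral_intensity//; last first.
  - by move=> x; rewrite -EFinD lee_fin addr_ge0 ?modulus_ge0 ?sqr_ge0.
  - exact: emeasurable_funD.
  rewrite lte_mul_pinfty ?lee_fin ?ltW//.
  exact: (integrable_lty measurableT (integrableD measurableT i1 i2)).
have := csum_variance campbell_ball (small_var (f := f)) mre mim foo.
rewrite !Rintegral_intensity; last 2 first.
- by apply: ile => // x; exact: Im_le_modulus.
- by apply: ile => // x; exact: Re_le_modulus.
rewrite [X in (_ <= _ * X)%E]ge0_integral_intensity//; last first.
  by move=> x; rewrite lee_fin sqr_ge0.
by rewrite muleA -EFinM.
Qed.

(** The square of the weight of exponent s is the weight of exponent 2 s, far
    from the critical one: the variance stays bounded where the mean diverges. *)
Lemma poincare_variance (s : R) : k.+1%:R < s ->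
  [/\ measurable_fun setT (fun X => fine (poincare s a X)),
      {ae Pi, forall X, (poincare s a X < +oo)%E}
   & (\int[Pi]_X ((fine (poincare s a X) - lambda * (\int[mu_ball]_x weight s a x)%R) ^+ 2)%:E
     <= (C * lambda)%:E * \int[mu_ball]_x (weight s a x ^+ 2)%:E)%E].
Proof.
move=> ks.
have w0 x : 0 <= weight s a x by rewrite ltW// weight_gt0.
have mw := @measurable_weight R k a s.
have iw : mu_ball.-integrable setT (fun x : uB => (weight s a x)%:E).
  apply/integrableP; split; first exact/measurable_EFinP.
  by under eq_integral do rewrite /= ger0_norm//; exact: integral_weight_lty.
have w1 x : weight s a x <= 1.
  rewrite /weight -expR0 ler_expR mulNr oppr_le0 mulr_ge0 ?dh_ge0//.
  by rewrite (le_trans _ (ltW ks)).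
have iw2 : mu_ball.-integrable setT (fun x : uB => (weight s a x ^+ 2)%:E).
  apply: (le_integrable measurableT _ _ iw).
    by apply/measurable_EFinP; exact: measurable_funX.
  move=> x _; rewrite lee_fin !ger0_norm ?sqr_ge0// expr2.
  by rewrite ler_piMl.
have iwn : intensity_measure.-integrable setT (EFin \o (weight s a : uB -> R)).
  apply/integrableP; split; first exact/measurable_EFinP.
  under eq_integral do rewrite /= ger0_norm//.
  rewrite ge0_integral_intensity//; last exact/measurable_EFinP.
  rewrite lte_mul_pinfty ?lee_fin ?ltW//; exact: integral_weight_lty.
have [mP _ _ Poo] := nnsum_expectation campbell_ball mw w0 iwn.
split=> //.
have mod_w x : modulus (weight s a x)%:C = weight s a x by rewrite modulus_real ger0_norm.
have j1 : mu_ball.-integrable setT (fun x : uB => (modulus (weight s a x)%:C)%:E).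
  by under eq_fun do rewrite mod_w.
have j2 : mu_ball.-integrable setT (fun x : uB => (modulus (weight s a x)%:C ^+ 2)%:E).
  by under eq_fun do rewrite mod_w.
have := @ball_variance (fun x : uB => (weight s a x)%:C) mw (measurable_cst _) j1 j2.
rewrite (_ : (\int[mu_ball]_x complex.Im _)%R = 0); last first.
  by rewrite /Rintegral integral0.
rewrite [X in (_ <= _ * X)%E -> _](_ : _ = \int[mu_ball]_x (weight s a x ^+ 2)%:E)%E; last first.
  by apply: eq_integral => x _; rewrite mod_w.
apply: le_trans; rewrite le_eqVlt; apply/orP; left; apply/eqP.
apply: eq_integral => X _; rewrite /csum (rsum_ge0 X w0) (@rsum_ge0 _ _ X (fun=> 0))//.
have -> : nnsum X (fun=> 0 : R) = 0%E by apply: esum1 => x _; rewrite mulr0.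
by rewrite sqr_modulus /= mulr0 subr0 expr0n addr0.
Qed.


(** * Sums of kernel functions *)

Variables (H : set (uball R m -> R[i])).
Variables (dot : (uball R m -> R[i]) -> (uball R m -> R[i]) -> R[i]).
Variables (K : uball R m -> uball R m -> R[i]).
Hypotheses (rkhsH : is_rkhs H dot K) (harmonicH : H `<=` H_harmonic).
Let hH := rkhs_hilbert rkhsH.
Implicit Types (X : Conf (uball R m)) (s l L : R).
Local Notation "`N f" := (hnorm dot f) (at level 10, f at level 8).
Local Notation p x := (pdist (\val a) (\val x)).

Definition cut s l L (x : uball R m) : R :=
  weight s a x * radial_indic a (shell_radius l) (shell_radius L) x.

(** The sum of the kernel functions with weights phi; stated with csum, it does
    not depend on the choice of a window containing the support of phi. *)
Definition vsum X (phi : uball R m -> R) : uball R m -> R[i] :=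
  fun y => csum X (fun x => (phi x)%:C * K y x).

Lemma cutE s l L x : 0 <= l -> 0 <= L ->
  cut s l L x = weight s a x * (l <= dh (\val a) (\val x) < L)%R%:R.
Proof. by move=> l0 L0; rewrite /cut /radial_indic -le_dh// !ltNge -le_dh. Qed.

Lemma cut_ge0 s l L x : 0 <= cut s l L x.
Proof. by rewrite mulr_ge0// ltW// weight_gt0. Qed.

Lemma cut_out s l L x : x \notin window a (shell_radius L) -> cut s l L x = 0.
Proof.
rewrite notin_setE /window /= => /negP; rewrite -ltNge => xL.
by rewrite /cut /radial_indic [p x < _]ltNge (ltW xL) andbF mulr0.
Qed.

Lemma cut_le1 s l L x : 0 <= s -> cut s l L x <= 1.
Proof.
move=> s0; rewrite /cut -[leRHS]mulr1; apply: ler_pM => //.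
- by rewrite ltW// weight_gt0.
- by rewrite /weight -expR0 ler_expR mulNr oppr_le0 mulr_ge0 ?dh_ge0.
- by rewrite /radial_indic; case: (_ && _).
Qed.

Lemma measurable_cut s l L : measurable_fun setT (cut s l L : uB -> R).
Proof.
by apply: measurable_funM; [exact: measurable_weight|exact: measurable_radial_indic].
Qed.

Lemma precompact_cut L : precompact (window a (shell_radius L)).
Proof. by apply: precompact_window; exact: shell_radius_ge0. Qed.

Lemma csum_cut X s l L (f : uball R m -> R[i]) :
  csum X (fun x => (cut s l L x)%:C * f x) =
  \sum_(x <- points X (window a (shell_radius L))) (X x)%:R * ((cut s l L x)%:C * f x).
Proof.
apply: csum_points; first exact: precompact_cut.
by move=> x /cut_out ->; rewrite mul0r.
Qed.

Lemma vsum_cut X s l L : vsum X (cut s l L) =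
  \sum_(x <- points X (window a (shell_radius L))) scalef ((X x)%:R * (cut s l L x)%:C) (ksection K x).
Proof.
apply/funext => y; rewrite /vsum csum_cut fct_sumE.
by apply: eq_bigr => x _; rewrite /scalef mulrA.
Qed.

Lemma H_vsum X s l L : H (vsum X (cut s l L)).
Proof.
rewrite vsum_cut; apply: (hilbert_space_sum hH) => x _; apply: (hilbert_spaceZ hH); exact: (rkhs_section rkhsH).
Qed.

Lemma dot_vsum X s l L f : H f ->
  dot (vsum X (cut s l L)) f = csum X (fun x => (cut s l L x)%:C * (f x)^*).
Proof.
move=> Hf; have HK x : H (ksection K x) by exact: (rkhs_section rkhsH).
rewrite vsum_cut (dot_suml hH)//; last by move=> x; exact: (hilbert_spaceZ hH).
rewrite csum_cut; apply: eq_bigr => x _.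
by rewrite (dotZl hH)// (dot_ksection rkhsH)// mulrA.
Qed.

Lemma dot_vsumr X s l L f : H f ->
  dot f (vsum X (cut s l L)) = csum X (fun x => (cut s l L x)%:C * f x).
Proof.
move=> Hf; rewrite (hilbert_conj hH (H_vsum X s l L) Hf) dot_vsum// !csum_cut.
rewrite (raddf_sum (@conjc R)); apply: eq_bigr => x _.
rewrite -(rmorph_nat (real_complex R)); case: (f x) => u v.
by apply/eqP; rewrite eq_complex /=; apply/andP; split; apply/eqP; ring.
Qed.

Lemma shell_sumE X s n f :
  shell_sum s a X n f = csum X (fun x => (cut s n%:R n.+1%:R x)%:C * f x).
Proof.
have cE x : cut s n%:R n.+1%:R x = weight s a x * (x \in shell a n)%:R.
  rewrite cutE//; congr (_ * (nat_of_bool _)%:R).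
  by apply/idP/idP; rewrite inE.
rewrite csum_cut /shell_sum.
rewrite -(@fsbig_points _ _ (fun x => (X x)%:R * ((cut s n%:R n.+1%:R x)%:C * f x))); last 2 first.
- exact: precompact_cut.
- by move=> x ->; rewrite mul0r.
have shell_window : shell a n `<=` window a (shell_radius n.+1%:R).
  by move=> x /andP[_]; rewrite ltNge le_dh// -ltNge => /ltW.
transitivity (\sum_(x \in shell a n) (X x)%:R * ((cut s n%:R n.+1%:R x)%:C * f x)).
  by apply: eq_fsbigr => x xn; rewrite cE xn mulr1 mulrA.
apply: fsbig_widen => //; move=> x [_] /= xn; rewrite cE; case: (boolP (x \in shell a n)) => [/set_mem//|_].
by rewrite mulr0 mul0r mulr0.
Qed.

Lemma kernel_shell_sumE X s n : kernel_shell_sum K s a X n = vsum X (cut s n%:R n.+1%:R).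
Proof. by apply/funext => y; rewrite /kernel_shell_sum shell_sumE. Qed.

Lemma shell_sum_dot X s n f : H f ->
  shell_sum s a X n f = dot f (kernel_shell_sum K s a X n).
Proof. by move=> Hf; rewrite kernel_shell_sumE dot_vsumr// shell_sumE. Qed.

Lemma cutD s l L L' x : 0 <= l -> l <= L -> L <= L' ->
  cut s l L' x = cut s l L x + cut s L L' x.
Proof.
move=> l0 lL LL'; have L0 := le_trans l0 lL.
rewrite !cutE// ?(le_trans L0)// -mulrDr; congr (_ * _).
case: (ltP (dh _ _) L) => dL; case: (leP l (dh _ _)) => ld; rewrite ?(lt_le_trans dL LL') ?add0r ?addr0//=.
by have := lt_le_trans ld (le_trans lL dL); rewrite ltxx.
Qed.

Lemma sum_kernel_shell_sum X s N :
  \sum_(0 <= j < N) kernel_shell_sum K s a X j = vsum X (cut s 0 N%:R).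
Proof.
elim: N => [|N IH].
  rewrite big_geq// vsum_cut big1// => x _.
  by rewrite cutE// [_ < 0]ltNge dh_ge0 andbF mulr0 mulr0 scale0f.
rewrite (big_nat_recr _ _ _ (leq0n N)) IH.
rewrite kernel_shell_sumE.
apply/funext => y.
rewrite -[LHS]/(vsum X (cut s 0 N%:R) y + vsum X (cut s N%:R N.+1%:R) y) /vsum.
have NS : N%:R <= N.+1%:R :> R by rewrite ler_nat.
rewrite !(@csum_points _ _ _ X (window a (shell_radius N.+1%:R)));
  try exact: precompact_cut; last 3 first.
- by move=> x /cut_out ->; rewrite mul0r.
- by move=> x /cut_out ->; rewrite mul0r.
- move=> x xw; have := cut_out s 0 xw; rewrite (@cutD s 0 N%:R)// => /eqP.
  by rewrite paddr_eq0 ?cut_ge0// => /andP[/eqP -> _]; rewrite mul0r.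
rewrite -big_split; apply: eq_bigr => x _ /=.
rewrite -mulrDr -mulrDl [in RHS](@cutD s 0 N%:R N.+1%:R)//; congr (_ * (_ * _)).
exact/esym/(rmorphD (real_complex R)).
Qed.

Definition mean_cut s l L : R := (\int[mu_ball]_x cut s l L x)%R.

Definition centered X s l L : uball R m -> R[i] :=
  vsum X (cut s l L) - scalef (lambda * mean_cut s l L)%:C (ksection K a).

Lemma H_centered X s l L : H (centered X s l L).
Proof.
apply: (hilbert_spaceB hH); first exact: H_vsum.
by apply: (hilbert_spaceZ hH); exact: (rkhs_section rkhsH).
Qed.

Lemma integrable_cut_modulus s l L (f : uball R m -> R[i]) : 0 <= s -> H_harmonic f ->
  mu_ball.-integrable setT (fun x : uB => (cut s l L x * modulus (f x))%:E) /\
  mu_ball.-integrable setT (fun x : uB => ((cut s l L x * modulus (f x)) ^+ 2)%:E).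
Proof.
move=> s0 hf; pose M := shell_radius L.
pose g v := 1 + (re_ext f v ^+ 2 + im_ext f v ^+ 2).
have cg v : unit_ball v -> {for v, continuous g}.
  move=> vB; apply: (@for_continuousD _ _ (cst 1)); first exact: cst_continuous.
  apply: for_continuousD; apply: for_continuousX.
    exact: harmonic_continuous_re.
  exact: harmonic_continuous_im.
have ig := integrable_compact (sqnorm_uball a) (shell_radius_ge0 L) cg.
have gE x : g (\val x) = 1 + modulus (f x) ^+ 2 by rewrite /g re_extE im_extE sqr_modulus.
have m2 := measurable_harmonic_modulus hf.
have mm : measurable_fun setT (fun x : uB => modulus (f x)).
  have -> : (fun x : uB => modulus (f x)) = Num.sqrt \o (fun x => modulus (f x) ^+ 2).
    by apply/funext => x; rewrite /= sqrtr_sqr ger0_norm ?modulus_ge0.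
  by apply: measurableT_comp m2; apply: continuous_measurable_fun; exact: sqrt_continuous.
have mc : measurable_fun setT (fun x : uB => cut s l L x * modulus (f x)).
  by apply: measurable_funM => //; exact: measurable_cut.
have bound x : cut s l L x * modulus (f x) <= g (\val x) * \1_(hyp_closed_ball (\val a) M) (\val x) /\
    (cut s l L x * modulus (f x)) ^+ 2 <= g (\val x) * \1_(hyp_closed_ball (\val a) M) (\val x).
  rewrite (indic_hyp_closed_ball (sqnorm_uball a)) gE.
  have [xM|Mx] := leP (p x) M; last first.
    have -> : cut s l L x = 0 by apply: cut_out; rewrite notin_setE /window /= -/M; apply/negP; rewrite -ltNge.
    by rewrite mul0r mulr0 expr0n.
  have := cut_ge0 s l L x; have := cut_le1 l L x s0; have := modulus_ge0 (f x).
  move: (cut _ _ _ _) (modulus _) => c y y0 c1 c0; rewrite mulr1; split.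
    by rewrite (@le_trans _ _ y) ?ler_piMl//; nra.
  by rewrite exprMn (@le_trans _ _ (y ^+ 2)) ?lerDr// ler_piMl ?sqr_ge0// expr_le1.
split; apply: (le_integrable measurableT _ _ ig).
- exact/measurable_EFinP.
- move=> x _; rewrite lee_fin (le_trans _ (ler_norm _))//.
  by rewrite (ger0_norm (mulr_ge0 (cut_ge0 _ _ _ _) (modulus_ge0 _))); have [] := bound x.
- by apply/measurable_EFinP; exact: measurable_funX.
- move=> x _; rewrite lee_fin (le_trans _ (ler_norm _))//.
  by rewrite ger0_norm ?sqr_ge0//; have [] := bound x.
Qed.

Lemma mean_value_cut s l L (u : 'rV[R]_m -> R) : C2_on unit_ball u ->
  (forall x, unit_ball x -> hyp_laplacian u x = 0) ->
  (\int[mu_ball]_x (cut s l L x * u (\val x)))%R = u (\val a) * mean_cut s l L.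
Proof.
move=> Cu hu; pose h y := exp_dist y `^ (- s).
have ch : continuous h.
  move=> y; apply: (@continuous_comp _ _ _ exp_dist (fun z => z `^ (- s))).
    exact: continuous_exp_dist.
  apply: differentiable_continuous; apply/derivable1_diffP.
  by case: (is_derive1_powR (- s) (exp_dist_gt0 y)).
have := @mean_value_shell R k a u h (shell_radius l) (shell_radius L) Cu hu ch.
rewrite /mean_cut; congr (_ = _ * _).
  by apply: eq_Rintegral => x _; rewrite /cut weightE mulrC.
by apply: eq_Rintegral => x _; rewrite /cut weightE.
Qed.

(** By the mean value property, a coordinate of the statistic has the same
    coordinate of the kernel function at a as its mean, up to the factor
    lambda * mean_cut; hence the coordinate of the centered statistic is
    controlled by the small variance inequality. *)
Lemma centered_coordinate s l L f : 0 <= s -> H f ->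
  measurable_fun setT (fun X => modulus (dot (centered X s l L) f) ^+ 2) /\
  (\int[Pi]_X (modulus (dot (centered X s l L) f) ^+ 2)%:E
    <= (C * lambda)%:E * \int[mu_ball]_x (cut s l L x ^+ 2 * modulus (f x) ^+ 2)%:E)%E.
Proof.
move=> s0 Hf; have hf := harmonicH Hf; have [Cre Cim hre him] := hf.
pose F (x : uB) : R[i] := (cut s l L x)%:C * f x.
have ReF x : complex.Re (F x) = cut s l L x * complex.Re (f x).
  by rewrite /F; case: (f x) => u v /=; rewrite mul0r subr0.
have ImF x : complex.Im (F x) = cut s l L x * complex.Im (f x).
  by rewrite /F; case: (f x) => u v /=; rewrite mul0r addr0.
have modF x : modulus (F x) = cut s l L x * modulus (f x).
  by rewrite /F modulusM modulus_real ger0_norm ?cut_ge0.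
have mre : measurable_fun setT (fun x => complex.Re (F x)).
  under eq_fun do rewrite ReF; apply: measurable_funM; first exact: measurable_cut.
  exact: measurable_harmonic_re.
have mim : measurable_fun setT (fun x => complex.Im (F x)).
  under eq_fun do rewrite ImF; apply: measurable_funM; first exact: measurable_cut.
  exact: measurable_harmonic_im.
have [i1 i2] := integrable_cut_modulus l L s0 hf.
have j1 : mu_ball.-integrable setT (fun x : uB => (modulus (F x))%:E).
  by under eq_fun do rewrite modF.
have j2 : mu_ball.-integrable setT (fun x : uB => (modulus (F x) ^+ 2)%:E).
  by under eq_fun do rewrite modF.
have HK : H (ksection K a) by exact: (rkhs_section rkhsH).
have intRe : (\int[mu_ball]_x complex.Re (F x))%R = complex.Re (f a) * mean_cut s l L.
  rewrite -re_extE -mean_value_cut//; apply: eq_Rintegral => x _.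
  by rewrite ReF re_extE.
have intIm : (\int[mu_ball]_x complex.Im (F x))%R = complex.Im (f a) * mean_cut s l L.
  rewrite -im_extE -mean_value_cut//; apply: eq_Rintegral => x _.
  by rewrite ImF im_extE.
have modE X : modulus (dot (centered X s l L) f) = modulus (csum X F -
    ((lambda * (\int[mu_ball]_x complex.Re (F x))%R) +i* (lambda * (\int[mu_ball]_x complex.Im (F x))%R))).
  rewrite (hilbert_conj hH Hf (H_centered X s l L)) modulusJ; congr modulus.
  rewrite /centered (dotBr hH)//; [|exact: H_vsum|exact: (hilbert_spaceZ hH)].
  rewrite dot_vsumr//; congr (_ - _); rewrite (dotZr hH)// -(rkhs_reproducing rkhsH)// intRe intIm.
  by case: (f a) => u v /=; apply/eqP; rewrite eq_complex /=; apply/andP; split; apply/eqP; ring.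
have mono (h : uB -> R) : measurable_fun setT h -> (forall x, `|h x| <= modulus (F x)) ->
    (intensity_measure).-integrable setT (EFin \o h).
  move=> mh hF; apply/integrableP; split; first exact/measurable_EFinP.
  have mh' : measurable_fun setT (EFin \o h) by exact/measurable_EFinP.
  rewrite ge0_integral_intensity//; last exact: measurableT_comp.
  rewrite lte_mul_pinfty ?lee_fin ?ltW//.
  have : mu_ball.-integrable setT (EFin \o h).
    apply: (le_integrable measurableT mh' _ j1) => x _.
    by rewrite lee_fin (le_trans (hF x))// ler_norm.
  by move=> /integrableP[].
have [mr _ _] := rsum_expectation campbell_ball mre (mono _ mre (fun x => Re_le_modulus _)).
have [mi _ _] := rsum_expectation campbell_ball mim (mono _ mim (fun x => Im_le_modulus _)).
split.
  under eq_fun do rewrite modE sqr_modulus /=.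
  by apply: measurable_funD; apply: measurable_funX; apply: measurable_funB.
under eq_integral do rewrite modE.
apply: le_trans (ball_variance mre mim j1 j2) _; rewrite lee_wpmul2l//.
  by rewrite lee_fin mulr_ge0 ?ltW.
rewrite le_eqVlt; apply/orP; left; apply/eqP; apply: eq_integral => x _.
by rewrite modF exprMn.
Qed.

(** Parseval turns the scalar variance inequality into a Hilbert-valued one. *)
Lemma centered_variance s l L : 0 <= s ->
  measurable_fun setT (fun X => `N (centered X s l L) ^+ 2) /\
  (\int[Pi]_X (`N (centered X s l L) ^+ 2)%:E
    <= (C * lambda)%:E * \int[mu_ball]_x (cut s l L x ^+ 2 * complex.Re (K x x))%:E)%E.
Proof.
move=> s0; have [e_ [He pars diag]] := exists_orthonormal_basis rkhsH harmonicH.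
have coord j := centered_coordinate l L s0 (He j).
have Hc X := H_centered X s l L.
split.
  apply: (measurable_fun_cvg (h := fun n X => \sum_(0 <= j < n) modulus (dot (centered X s l L) (e_ j)) ^+ 2)).
    by move=> n; apply: measurable_sum => j; have [] := coord j.
  by move=> X _; exact: pars.
have seriesE (u : nat -> R) (x : R) : (forall n, 0 <= u n) ->
    \sum_(0 <= j < n) u j @[n --> \oo] --> x -> (x%:E = \sum_(0 <= j <oo) (u j)%:E)%E.
  move=> u0 ux; apply/esym/cvg_lim => //.
  under eq_fun do rewrite sumEFin.
  by apply/fine_cvgP; split; [exact: nearW|exact: ux].
have sq0 (z : R[i]) : 0 <= modulus z ^+ 2 by exact: sqr_ge0.
rewrite (eq_integral (fun X => \sum_(0 <= j <oo) (modulus (dot (centered X s l L) (e_ j)) ^+ 2)%:E)%E); last first.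
  by move=> X _; apply: seriesE => //; exact: pars.
rewrite integral_nneseries//; last 2 first.
- by move=> j; apply/measurable_EFinP; have [] := coord j.
- by move=> j X _; rewrite lee_fin.
have -> : (\int[mu_ball]_x (cut s l L x ^+ 2 * complex.Re (K x x))%:E =
    \int[mu_ball]_x \sum_(0 <= j <oo) (cut s l L x ^+ 2 * modulus (e_ j x) ^+ 2)%:E)%E.
  apply: eq_integral => x _; rewrite EFinM (seriesE (fun j => modulus (e_ j x) ^+ 2) _ _ (diag x))//.
  rewrite -nneseriesZl//; last by move=> j _; rewrite lee_fin.
rewrite integral_nneseries//; last 2 first.
- move=> j; apply/measurable_EFinP; apply: measurable_funM.
    by apply: measurable_funX; exact: measurable_cut.
  by apply: measurable_harmonic_modulus; exact: harmonicH.
- by move=> j x _; rewrite lee_fin mulr_ge0 ?sqr_ge0.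
rewrite -nneseriesZl//; last first.
  by move=> j _; apply: integral_ge0 => x _; rewrite lee_fin mulr_ge0 ?sqr_ge0.
apply: lee_nneseries => [j _|j _]; last by have [] := coord j.
by move=> _; apply: integral_ge0 => X _; rewrite lee_fin.
Qed.

Local Notation Q := (k.+1%:R : R).
Local Notation c0 := (4 / (1 - sqnorm (\val a))).

(** The integrals of the summability hypothesis. *)
Definition kernel_energy s : \bar R :=
  (\int[Vm]_x (complex.Re (K x x) * (1 - sqnorm (\val x)) `^ (s - 1))%:E)%E.

Let ReK_ge0 x : 0 <= complex.Re (K x x) := Re_kernel_diag_ge0 rkhsH x.
Let mReK : measurable_fun setT (fun x : uB => complex.Re (K x x)) :=
  measurable_kernel_diag rkhsH harmonicH.

Lemma c0_ge1 : 1 <= c0.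
Proof.
have := sqnorm_ge0 (\val a); have := sqnorm_uball a => a1 a0.
by rewrite ler_pdivlMr ?subr_gt0//; lra.
Qed.

Lemma measurable_weight_kernel s :
  measurable_fun setT (fun x : uB => (weight s a x * complex.Re (K x x))%:E).
Proof.
by apply/measurable_EFinP; apply: measurable_funM => //; exact: measurable_weight.
Qed.

(** The weight of exponent r is at most c0^r (1 - |x|^2)^r; the density of the
    invariant measure leaves the exponent r - k - 2, which is at least s - 1. *)
Lemma integral_weight_kernel s r : Q < s -> s + Q <= r ->
  (\int[mu_ball]_x (weight r a x * complex.Re (K x x))%:E <=
   (c0 `^ r)%:E * kernel_energy s)%E.
Proof.
move=> Qs sr; have r0 : 0 <= r by apply: le_trans sr; rewrite addr_ge0// ltW// (le_lt_trans _ Qs).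
have my : measurable_fun setT (fun x : uB => 1 - sqnorm (\val x)).
  by apply: (uball_continuous_measurable (g := fun v => 1 - sqnorm v)) => v _; exact: continuous_1Bsqnorm.
rewrite ge0_integral_mu_ball; [|exact: measurable_weight_kernel|]; last first.
  by move=> x; rewrite lee_fin mulr_ge0// ltW// weight_gt0.
have mE : measurable_fun setT (fun x : uB => (complex.Re (K x x) * (1 - sqnorm (\val x)) `^ (s - 1))%:E).
  apply/measurable_EFinP; apply: measurable_funM => //.
  by apply: (@measurableT_comp _ _ _ _ _ _ (fun t : R => t `^ (s - 1))) => //; exact: measurable_powR.
have E0 (x : uB) : (0 <= (complex.Re (K x x) * (1 - sqnorm (\val x)) `^ (s - 1))%:E)%E.
  by rewrite lee_fin mulr_ge0// powR_ge0.
rewrite /kernel_energy -ge0_integralZl//; last by rewrite lee_fin powR_ge0.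
apply: ge0_le_integral => //.
- move=> x _; rewrite mule_ge0// lee_fin; first by rewrite mulr_ge0// ltW// weight_gt0.
  by rewrite invr_ge0 exprn_ge0// ltW// uball_1Bsqnorm_gt0.
- apply: emeasurable_funM; first exact: measurable_weight_kernel.
  exact: measurable_density_uball.
- by apply: emeasurable_funM.
move=> x _; rewrite -!EFinM lee_fin.
have y0 := uball_1Bsqnorm_gt0 x; set y := 1 - _ in y0 *.
have y1 : y <= 1 by rewrite gerBl sqnorm_ge0.
have wE : weight r a x <= c0 `^ r * y `^ r.
  have c00 : 0 <= c0 by rewrite (le_trans _ c0_ge1).
  rewrite -powRM ?(ltW y0)//.
  have -> : weight r a x = expR (- dh (\val a) (\val x)) `^ r.
    by rewrite /weight /powR gt_eqF ?expR_gt0// expRK mulrN mulNr.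
  by apply: ge0_ler_powR; rewrite ?nnegrE ?expR_ge0 ?(mulr_ge0 c00 (ltW y0)) ?r0// /y; exact: expRN_dh_le.
have yE : y `^ r * y ^- m <= y `^ (s - 1).
  rewrite -powR_mulrn ?(ltW y0)// -powRN -powRD; last by rewrite (gt_eqF y0) implybT.
  apply: ger_powR; first by rewrite y0.
  by move: sr; rewrite -[m]addn1 natrD; lra.
rewrite mulrAC [leRHS]mulrCA [leRHS]mulrC; apply: ler_wpM2r => //.
have yn : 0 <= y ^- m by rewrite invr_ge0 exprn_ge0 ?ltW.
apply: le_trans (ler_wpM2r yn wE) _; rewrite -mulrA ler_wpM2l ?powR_ge0//.
Qed.

(** By the Cauchy-Schwarz inequality, K(x, x) = 0 forces f(x) = 0. *)
Lemma kernel_diag_eq0 f : (forall x, complex.Re (K x x) = 0) -> H f -> f = 0.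
Proof.
move=> K0 Hf; apply/funext => x; apply: ComplexField.Normc.eq0_normc; apply/eqP.
rewrite -/(modulus _) eq_le modulus_ge0 andbT (rkhs_reproducing rkhsH)//.
apply: le_trans (cauchy_schwarz hH Hf (rkhs_section rkhsH x)) _.
have /eqP := K0 x; rewrite (Re_kernel_diag rkhsH) sqrf_eq0 => /eqP ->.
by rewrite mulr0.
Qed.

(** If the kernel is not zero, its energy is positive since the diagonal
    dominates the square modulus of a non-zero continuous function. *)
Lemma kernel_energy_gt0 s : 1 <= s -> (exists x, complex.Re (K x x) != 0) ->
  (0 < kernel_energy s)%E.
Proof.
move=> s1 [x0 Kx0]; have [e_ [He _ diag]] := exists_orthonormal_basis rkhsH harmonicH.
have [j ej] : exists j, modulus (e_ j x0) ^+ 2 != 0.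
  apply: contrapT => /forallNP e0; move/eqP : Kx0; apply.
  apply: (cvg_unique _ (diag x0)) => //.
  rewrite (_ : (fun n => _) = fun=> 0); first exact: cvg_cst.
  by apply/funext => n; apply: big1 => j _; have /negP/negPn/eqP := e0 j.
have le_diag x : modulus (e_ j x) ^+ 2 <= complex.Re (K x x).
  rewrite -(cvg_lim (@Rhausdorff R) (diag x)); apply: limr_ge.
    by apply/cvg_ex; eexists; exact: diag.
  exists j.+1 => // n /= jn; rewrite (bigD1_seq j) ?iota_uniq ?mem_index_iota//=.
  by rewrite lerDl sumr_ge0// => i _; exact: sqr_ge0.
have hf := harmonicH (He j).
pose g v : R := re_ext (e_ j) v ^+ 2 + im_ext (e_ j) v ^+ 2.
have gE x : g (\val x) = modulus (e_ j x) ^+ 2 by rewrite /g re_extE im_extE sqr_modulus.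
have cg v : unit_ball v -> {for v, continuous g}.
  move=> vB; apply: for_continuousD; apply: for_continuousX.
    exact: harmonic_continuous_re.
  exact: harmonic_continuous_im.
pose h (v : 'rV[R]_m) : R := 1 - sqnorm v.
pose c := modulus (e_ j x0) ^+ 2 / 2; pose y0 := h (\val x0) / 2.
have c0' : 0 < c by rewrite divr_gt0// lt_def ej sqr_ge0.
have y00 : 0 < y0 by rewrite divr_gt0// uball_1Bsqnorm_gt0.
pose D : set (uball R m) := \val @^-1` [set v | [/\ c < g v, y0 < h v & unit_ball v]].
have oD : open D.
  apply: open_comp; first by move=> x _; exact: continuous_uball_val.
  rewrite openE => v [cv yv vB].
  have n1 : nbhs v [set w | c < g w].
    have o1 : nbhs (g v) [set t | c < t] by apply: open_nbhs_nbhs; split=> //; exact: open_gt.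
    exact: (cg _ vB _ o1).
  have n2 : nbhs v [set w | y0 < h w].
    have o2 : nbhs (h v) [set t | y0 < t] by apply: open_nbhs_nbhs; split=> //; exact: open_gt.
    exact: (@continuous_1Bsqnorm R m v _ o2).
  have n3 : nbhs v unit_ball by apply: open_nbhs_nbhs; split=> //; exact: open_unit_ball.
  by apply: filterS (filterI n1 (filterI n2 n3)) => w [? [? ?]]; split.
have Dx0 : D x0.
  split; last exact/set_mem/(valP x0).
  - by rewrite gE /c gtr_pMr ?invf_lt1 ?ltr1n// lt_def ej sqr_ge0.
  - by rewrite /y0 gtr_pMr ?invf_lt1 ?ltr1n// uball_1Bsqnorm_gt0.
have D0 : (0 < mu_ball (D : set uB))%E by apply: mu_ball_open_gt0 => //; exists x0.
pose F (x : uB) : R := complex.Re (K x x) * h (\val x) `^ (s - 1) * h (\val x) ^+ m.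
have mh : measurable_fun setT (fun x : uB => h (\val x)).
  by apply: (uball_continuous_measurable (g := h)) => v _; exact: continuous_1Bsqnorm.
have mF : measurable_fun setT F.
  apply: measurable_funM; last exact: measurable_funX.
  apply: measurable_funM => //.
  by apply: (@measurableT_comp _ _ _ _ _ _ (fun t : R => t `^ (s - 1))) => //; exact: measurable_powR.
have h0 (x : uball R m) : 0 < h (\val x) by exact: uball_1Bsqnorm_gt0.
have F0 x : 0 <= F x.
  exact: mulr_ge0 (mulr_ge0 (ReK_ge0 x) (powR_ge0 _ _)) (exprn_ge0 _ (ltW (h0 x))).
have mD : measurable (D : set uB) by exact: (@open_borel_measurable (uball R m) _ oD).
have : (0 < \int[mu_ball]_x (F x)%:E)%E.
  apply: (integral_gt0 (c := c * y0 `^ (s - 1) * y0 ^+ m) mF F0 mD) => //.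
    exact: mulr_gt0 (mulr_gt0 c0' (powR_gt0 _ y00)) (exprn_gt0 _ y00).
  move=> x [cx yx _]; rewrite /F.
  have ex : c <= complex.Re (K x x) by rewrite (le_trans _ (le_diag x))// -gE ltW.
  apply: ler_pM.
  - exact: mulr_ge0 (ltW c0') (powR_ge0 _ _).
  - by rewrite exprn_ge0// ltW.
  - apply: ler_pM; [exact: ltW|exact: powR_ge0|exact: ex|].
    apply: ge0_ler_powR; [by rewrite subr_ge0|by rewrite nnegrE ltW|by rewrite nnegrE ltW|exact: ltW].
  - by apply: lerXn2r; rewrite ?nnegrE ltW.
rewrite ge0_integral_mu_ball//; last exact/measurable_EFinP.
congr (_ < _)%E; apply: eq_integral => x _; rewrite -EFinM /F -/(h (\val x)) mulfK//.
by rewrite expf_neq0// gt_eqF.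
Qed.

(** * Almost sure convergence *)

Lemma weight_ge0 s (x : uball R m) : 0 <= weight s a x.
Proof. exact/ltW/weight_gt0. Qed.

Lemma integrable_weight s : Q < s ->
  mu_ball.-integrable setT (fun x : uB => (weight s a x)%:E).
Proof.
move=> Qs; apply/integrableP; split; first by apply/measurable_EFinP; exact: measurable_weight.
under eq_integral do rewrite /= ger0_norm ?weight_ge0//.
exact: integral_weight_lty.
Qed.

Definition mean_weight s : R := (\int[mu_ball]_(x in [set: uB]) weight s a x)%R.

Lemma cut_le_weight s l L x : cut s l L x <= weight s a x.
Proof.
rewrite /cut ler_piMr ?weight_ge0//.
by rewrite /radial_indic; case: (_ && _).
Qed.

Lemma cut_sqr_le s l L x : cut s l L x ^+ 2 <= weight (s + s) a x.
Proof.
have -> : weight (s + s) a x = weight s a x ^+ 2.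
  by rewrite expr2 /weight -expRD; congr expR; ring.
by rewrite lerXn2r ?nnegrE ?cut_ge0 ?weight_ge0// cut_le_weight.
Qed.

Lemma cut_shell_le s (j : nat) x : Q < s ->
  expR ((s - Q) * j%:R) * cut s j%:R j.+1%:R x ^+ 2 <= cut (s + Q) j%:R j.+1%:R x.
Proof.
move=> Qs; rewrite !cutE//; case: (boolP (_ <= _ < _)) => [/andP[jd _]|_]; last first.
  by rewrite !mulr0 expr0n mulr0.
rewrite !mulr1 expr2 /weight -!expRD ler_expR.
have : (s - Q) * j%:R <= (s - Q) * dh (\val a) (\val x) by rewrite ler_wpM2l// subr_ge0 ltW.
by lra.
Qed.

Lemma integrable_cut s l L : Q < s -> mu_ball.-integrable setT (EFin \o (cut s l L : uB -> R)).
Proof.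
move=> Qs; apply: (le_integrable measurableT _ _ (integrable_weight Qs)).
  by apply/measurable_EFinP; exact: measurable_cut.
move=> x _; rewrite lee_fin !ger0_norm ?weight_ge0 ?cut_ge0//.
exact: cut_le_weight.
Qed.

Lemma mean_cut_ge0 s l L : 0 <= mean_cut s l L.
Proof. by apply: Rintegral_ge0 => x _; exact: cut_ge0. Qed.

Lemma mean_cut_le s l L : Q < s -> mean_cut s l L <= mean_weight s.
Proof.
move=> Qs; apply: le_Rintegral => //; first exact: integrable_cut.
  exact: integrable_weight.
by move=> x _; exact: cut_le_weight.
Qed.

Lemma sum_mean_cut s N : Q < s ->
  \sum_(0 <= j < N) mean_cut s j%:R j.+1%:R = mean_cut s 0 N%:R.
Proof.
move=> Qs; elim: N => [|N IH].
  rewrite big_geq// /mean_cut /Rintegral integral0_eq// => x _.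
  by rewrite cutE// [_ < 0]ltNge dh_ge0 andbF mulr0.
rewrite (big_nat_recr _ _ _ (leq0n N)) IH /mean_cut.
rewrite -[LHS](RintegralD measurableT (integrable_cut _ _ Qs) (integrable_cut _ _ Qs)).
by apply: eq_Rintegral => x _; rewrite -cutD// ler_nat.
Qed.

Lemma cvg_mean_cut s : Q < s -> mean_cut s 0 N%:R @[N --> \oo] --> mean_weight s.
Proof.
move=> Qs; apply: fine_cvg; rewrite fineK; last exact: (integrable_fin_num measurableT (integrable_weight Qs)).
have cvg_cut (x : uB) : (cut s 0 N%:R x)%:E @[N --> \oo] --> (weight s a x)%:E.
  apply: cvg_near_cst; exists (Num.truncn (dh (\val a) (\val x))).+1 => // N /= dN.
  rewrite cutE// dh_ge0 /= (lt_le_trans (truncnS_gt _)) ?mulr1//.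
  by rewrite ler_nat.
rewrite (_ : (\int[mu_ball]_x (weight s a x)%:E)%E =
    (\int[mu_ball]_x limn (fun N => (cut s 0 N%:R x)%:E))%E); last first.
  by apply: eq_integral => x _; apply/esym/cvg_lim => //; exact: cvg_cut.
apply: cvg_monotone_convergence => //.
- by move=> N; apply/measurable_EFinP; exact: measurable_cut.
- by move=> N x _; rewrite lee_fin cut_ge0.
- move=> x _ i j ij; rewrite lee_fin (@cutD s 0 i%:R j%:R)// ?ler_nat//.
  by rewrite lerDl cut_ge0.
Qed.

Lemma ge0_kernel_integral (h : uB -> R) : (forall x, 0 <= h x) ->
  (0 <= \int[mu_ball]_x (h x * complex.Re (K x x))%:E)%E.
Proof. by move=> h0; apply: integral_ge0 => x _; rewrite lee_fin mulr_ge0. Qed.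

Lemma integral_cut_kernel s L : Q < s ->
  (\int[mu_ball]_x (cut s 0 L x ^+ 2 * complex.Re (K x x))%:E <=
   (c0 `^ (s + s))%:E * kernel_energy s)%E.
Proof.
move=> Qs; apply: le_trans (integral_weight_kernel Qs _); last by rewrite lerD2l ltW.
apply: ge0_le_integral => //.
- by move=> x _; rewrite lee_fin mulr_ge0 ?sqr_ge0.
- apply/measurable_EFinP; apply: measurable_funM => //.
  by apply: measurable_funX; exact: measurable_cut.
- exact: measurable_weight_kernel.
- by move=> x _; rewrite lee_fin ler_wpM2r// cut_sqr_le.
Qed.

(** On the shell of index j the factor e^((s - Q) j) lowers the exponent 2 s of
    the squared weight to s + Q, the smallest one that the energy at s controls. *)
Lemma sum_integral_shell_kernel s : Q < s ->
  (\sum_(0 <= j <oo) (expR ((s - Q) * j%:R))%:E *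
    \int[mu_ball]_x (cut s j%:R j.+1%:R x ^+ 2 * complex.Re (K x x))%:E <=
   (c0 `^ (s + Q))%:E * kernel_energy s)%E.
Proof.
move=> Qs; apply: le_trans (integral_weight_kernel Qs _) => //.
have mcK r l L : measurable_fun setT (fun x : uB => (cut r l L x * complex.Re (K x x))%:E).
  by apply/measurable_EFinP; apply: measurable_funM => //; exact: measurable_cut.
have mc2 l L : measurable_fun setT (fun x : uB => (cut s l L x ^+ 2 * complex.Re (K x x))%:E).
  apply/measurable_EFinP; apply: measurable_funM => //.
  by apply: measurable_funX; exact: measurable_cut.
have cK0 r l L x : (0 <= (cut r l L x * complex.Re (K x x))%:E)%E.
  by rewrite lee_fin; exact: mulr_ge0 (cut_ge0 _ _ _ _) (ReK_ge0 _).
apply: (@le_trans _ _ (\sum_(0 <= j <oo)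
    \int[mu_ball]_x (cut (s + Q) j%:R j.+1%:R x * complex.Re (K x x))%:E)%E).
  apply: lee_nneseries => [j _ _|j _].
    by rewrite mule_ge0 ?lee_fin ?expR_ge0// ge0_kernel_integral// => x; exact: sqr_ge0.
  rewrite -ge0_integralZl//; first apply: ge0_le_integral => //.
  - by move=> x _; rewrite mule_ge0// lee_fin ?expR_ge0// mulr_ge0 ?sqr_ge0.
  - exact: measurable_funeM.
  - by move=> x _; rewrite -EFinM lee_fin mulrA ler_wpM2r// cut_shell_le.
  - by move=> x _; rewrite lee_fin mulr_ge0 ?sqr_ge0.
rewrite -integral_nneseries//; apply: ge0_le_integral => //.
- by move=> x _; apply: nneseries_ge0 => j _ _.
- exact: ge0_emeasurable_sum.
- exact: measurable_weight_kernel.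
move=> x _; apply: nneseries_le_bound => [j|N].
  exact: mulr_ge0 (cut_ge0 _ _ _ _) (ReK_ge0 _).
rewrite -mulr_suml ler_wpM2r// (_ : \sum_(0 <= j < N) _ = cut (s + Q) 0 N%:R x) ?cut_le_weight//.
elim: N => [|N IH].
  by rewrite big_geq// cutE// [_ < 0]ltNge dh_ge0 andbF mulr0.
by rewrite (big_nat_recr _ _ _ (leq0n N)) /= IH -cutD// ler_nat.
Qed.

(** The means of the shell sums add up to the mean of the Poincare series. The
    norms of the deviations are bounded by e^(-(s - Q) j) plus e^((s - Q) j) times
    their squares, whose expectations are summable. *)
Lemma ae_shell_norms_summable s : Q < s -> (kernel_energy s < +oo)%E ->
  {ae Pi, forall X, (\sum_(0 <= j <oo) (`N (kernel_shell_sum K s a X j))%:E < +oo)%E}.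
Proof.
move=> Qs Koo; have s0 : 0 <= s by rewrite ltW// (le_lt_trans _ Qs).
pose d := s - Q; have d0 : 0 < d by rewrite subr_gt0.
pose Y (j : nat) X : \bar R :=
  ((expR (d * j%:R))%:E * (`N (centered X s j%:R j.+1%:R) ^+ 2)%:E)%E.
have cv j := centered_variance j%:R j.+1%:R s0.
have mY j : measurable_fun setT (Y j).
  by apply: measurable_funeM; apply/measurable_EFinP; have [] := cv j.
have Y0 j X : (0 <= Y j X)%E by rewrite mule_ge0// lee_fin ?expR_ge0 ?sqr_ge0.
have EYoo : (\sum_(0 <= j <oo) \int[Pi]_X Y j X < +oo)%E.
  apply: (@le_lt_trans _ _ ((C * lambda)%:E * ((c0 `^ (s + Q))%:E * kernel_energy s)))%E; last first.
    by rewrite !lte_mul_pinfty// ?lee_fin ?powR_ge0// ?mulr_ge0 ?ltW// mule_ge0// ?lee_fin ?powR_ge0//;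
       apply: integral_ge0 => x _; rewrite lee_fin mulr_ge0 ?powR_ge0.
  have Cl : (0 <= (C * lambda)%:E)%E by rewrite lee_fin mulr_ge0 ?ltW.
  apply: le_trans (lee_wpmul2l Cl (sum_integral_shell_kernel Qs)).
  rewrite -nneseriesZl; last first.
    by move=> j _; rewrite mule_ge0 ?lee_fin ?expR_ge0// ge0_kernel_integral// => x; exact: sqr_ge0.
  apply: lee_nneseries => [j _ _|j _]; first exact: integral_ge0.
  rewrite /Y ge0_integralZl//; last 2 first.
  - by apply/measurable_EFinP; have [] := cv j.
  - by move=> X _; rewrite lee_fin sqr_ge0.
  by rewrite muleCA lee_wpmul2l ?lee_fin ?expR_ge0//; have [] := cv j.
have := ae_nneseries_lty mY Y0 EYoo; apply: filterS => X Xoo.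
have HK : H (ksection K a) by exact: (rkhs_section rkhsH).
pose g (j : nat) := lambda * mean_cut s j%:R j.+1%:R * `N (ksection K a).
have g0 j : 0 <= g j by rewrite mulr_ge0 ?hnorm_ge0// mulr_ge0 ?mean_cut_ge0 ?ltW.
have q0 j : (0 <= (expR (- d) ^+ j)%:E)%E by rewrite lee_fin exprn_ge0 ?expR_ge0.
(* The arithmetic-geometric mean inequality trades the norm for its square. *)
have bound j : ((`N (kernel_shell_sum K s a X j))%:E <= (expR (- d) ^+ j)%:E + Y j X + (g j)%:E)%E.
  rewrite /Y -!EFinM -!EFinD lee_fin kernel_shell_sumE.
  have -> : vsum X (cut s j%:R j.+1%:R) = centered X s j%:R j.+1%:R +
      scalef (lambda * mean_cut s j%:R j.+1%:R)%:C (ksection K a) by rewrite subrK.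
  apply: le_trans (hnormD hH _ _) _; [exact: H_centered|exact: (hilbert_spaceZ hH)|].
  rewrite (hnormZ hH)// modulus_real ger0_norm; last by rewrite mulr_ge0 ?mean_cut_ge0 ?ltW.
  rewrite -/(g j) lerD2r -expRM_natl mulrN mulrC expRN -[d * _]mulrC.
  set t := expR _; have t0 : 0 < t by exact: expR_gt0.
  move: (hnorm_ge0 dot (centered X s j%:R j.+1%:R)); move: (hnorm _ _) => z z0.
  have := sqr_ge0 (1 - t * z); rewrite -subr_ge0 => h.
  rewrite -(ler_pM2l t0) mulrDr divff ?gt_eqF//; nra.
apply: (@le_lt_trans _ _ (\sum_(0 <= j <oo) ((expR (- d) ^+ j)%:E + Y j X + (g j)%:E)))%E.
  by apply: lee_nneseries => [j _ _|j _]; [rewrite lee_fin hnorm_ge0|exact: bound].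
rewrite !nneseriesD//; last 2 first.
- by move=> j _ _; exact: adde_ge0.
- by move=> j _ _; rewrite lee_fin g0.
rewrite !lte_add_pinfty//.
- apply: nneseries_geometric_lty; first exact: expR_ge0.
  by rewrite -expR0 ltr_expR oppr_lt0.
- apply: (@le_lt_trans _ _ (lambda * mean_weight s * `N (ksection K a))%:E); last exact: ltry.
  apply: nneseries_le_bound => // N; rewrite /g -mulr_suml -mulr_sumr ler_wpM2r ?hnorm_ge0//.
  by apply: ler_wpM2l; [exact: ltW|rewrite sum_mean_cut//; exact: mean_cut_le].
Qed.

(** The distance of the limit F of the partial sums to its mean is a limit of
    distances of partial sums, so that Fatou's lemma bounds its expectation. *)
Definition limit_distance s X : \bar R :=
  limn_einf (fun N : nat => (`N (centered X s 0 N%:R) ^+ 2)%:E).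

Lemma limit_distance_ge0 s X : (0 <= limit_distance s X)%E.
Proof.
rewrite /limit_distance limn_einf_lim; apply: lime_ge; first exact: is_cvg_einfs.
apply: nearW => n; apply: le_ereal_inf_tmp => _ [j _ <-].
by rewrite lee_fin sqr_ge0.
Qed.

Lemma measurable_limit_distance s : 0 <= s -> measurable_fun setT (limit_distance s).
Proof.
move=> s0; have mc N : measurable_fun setT (fun X => (`N (centered X s 0 N%:R) ^+ 2)%:E).
  by apply/measurable_EFinP; have [] := centered_variance 0 N%:R s0.
apply: (@emeasurable_fun_cvg _ _ _ _ (fun n X => einfs (fun N : nat => (`N (centered X s 0 N%:R) ^+ 2)%:E) n)) => [n|X _].
  exact: measurable_fun_einfs.
by rewrite /limit_distance limn_einf_lim; exact: is_cvg_einfs.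
Qed.

Lemma limit_distance_expectation s : Q < s ->
  (\int[Pi]_X limit_distance s X <=
   (C * lambda)%:E * ((c0 `^ (s + s))%:E * kernel_energy s))%E.
Proof.
move=> Qs; have s0 : 0 <= s by rewrite ltW// (le_lt_trans _ Qs).
apply: le_trans (fatou _ measurableT _ _) _.
- by move=> N; apply/measurable_EFinP; have [] := centered_variance 0 N%:R s0.
- by move=> N X _; rewrite lee_fin sqr_ge0.
apply: limn_einf_le => N; have [_ vN] := centered_variance 0 N%:R s0.
apply: le_trans vN _; rewrite lee_wpmul2l ?integral_cut_kernel//.
by rewrite lee_fin mulr_ge0 ?ltW.
Qed.

Lemma limit_distanceE s X F : Q < s -> H F -> hseries dot (kernel_shell_sum K s a X) F ->
  limit_distance s X =
  (`N (F - scalef (lambda * mean_weight s)%:C (ksection K a)) ^+ 2)%:E.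
Proof.
move=> Qs HF cF; set A := F - _.
have HK : H (ksection K a) by exact: (rkhs_section rkhsH).
have HA : H A by apply: (hilbert_spaceB hH) => //; exact: (hilbert_spaceZ hH).
suff cN : `N (centered X s 0 N%:R) @[N --> \oo] --> `N A.
  rewrite /limit_distance; apply: (cvg_limn_einf_sup _).1.
  by apply/fine_cvgP; split; [exact: nearW|exact: (cvgM cN cN)].
pose z (N : nat) := hnorm dot (\sum_(0 <= j < N) kernel_shell_sum K s a X j - F) +
  lambda * `|mean_weight s - mean_cut s 0 N%:R| * `N (ksection K a).
have z0 : z N @[N --> \oo] --> 0.
  rewrite -[X in _ --> X]addr0 -[X in _ --> _ + X](mul0r (`N (ksection K a))).
  apply: cvgD; first exact: cF.
  apply: cvgMl; rewrite -[X in _ --> X](mulr0 lambda); apply: cvgMr.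
  apply/norm_cvg0P; rewrite -[X in _ --> X](subrr (mean_weight s)).
  by apply: cvgB; [exact: cvg_cst|exact: cvg_mean_cut].
apply/cvgrPdist_le => e e0; move/cvgrPdist_le : z0 => /(_ _ e0); apply: filterS => N.
rewrite sub0r normrN; apply: le_trans.
apply: le_trans (ler_dist_hnorm hH HA (H_centered X s 0 N%:R)) _.
rewrite (hnormBC hH)//; last exact: H_centered.
have -> : centered X s 0 N%:R - A = (\sum_(0 <= j < N) kernel_shell_sum K s a X j - F) +
    scalef (lambda * (mean_weight s - mean_cut s 0 N%:R))%:C (ksection K a).
  rewrite sum_kernel_shell_sum; apply/funext => y; rewrite /centered /A /scalef /= !fctE.
  rewrite (rmorphM (real_complex R) lambda (mean_weight s - _)) rmorphB.
  rewrite (rmorphM (real_complex R) lambda (mean_weight s)) (rmorphM (real_complex R) lambda (mean_cut _ _ _)) /=.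
  by ring.
apply: le_trans (hnormD hH _ _) _.
- by rewrite sum_kernel_shell_sum; apply: (hilbert_spaceB hH) => //; exact: H_vsum.
- exact: (hilbert_spaceZ hH).
rewrite (hnormZ hH)// modulus_real normrM (gtr0_norm lambda_gt0).
exact: ler_norm.
Qed.

Variable s_ : nat -> R.
Hypotheses (s_gt : forall n, Q < s_ n) (s_cvg : s_ n @[n --> \oo] --> Q).
Hypothesis sumK : (\sum_(0 <= n <oo) (((s_ n - Q) ^+ 2)%:E * kernel_energy (s_ n)) < +oo)%E.

Lemma kernel_energy_ge0 s : (0 <= kernel_energy s)%E.
Proof. by apply: integral_ge0 => x _; rewrite lee_fin mulr_ge0// powR_ge0. Qed.

Lemma gap_energy_ge0 n : (0 <= ((s_ n - Q) ^+ 2)%:E * kernel_energy (s_ n))%E.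
Proof. by apply: mule_ge0; [rewrite lee_fin sqr_ge0|exact: kernel_energy_ge0]. Qed.

Lemma kernel_energy_lty n : (kernel_energy (s_ n) < +oo)%E.
Proof.
rewrite ltNge leye_eq; apply/negP => /eqP Eoo; move: sumK.
rewrite (@nneseries_pinfty _ _ _ n)//.
  by move=> j _; exact: gap_energy_ge0.
by rewrite Eoo gt0_muley// lte_fin exprn_gt0// subr_gt0.
Qed.

Lemma exponents_bounded : exists2 S, Q < S & forall n, s_ n <= S.
Proof.
have [M [_ /(_ (M + 1))]] := cvg_seq_bounded (cvgP _ s_cvg).
rewrite ltrDl ltr01 => /(_ isT) sM; have sM' n : s_ n <= M + 1.
  exact: le_trans (ler_norm _) (sM n I).
by exists (M + 1) => //; exact: lt_le_trans (s_gt 0) (sM' 0).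
Qed.

(** The divergence of the mean weight at the critical exponent provides the
    factor (s_n - Q)^2 of the summability hypothesis. *)
Lemma mean_weight_inv_bound : exists2 c : R, 0 < c & forall n,
  0 < lambda * mean_weight (s_ n) /\ (lambda * mean_weight (s_ n)) ^- 2 <= c * (s_ n - Q) ^+ 2.
Proof.
have [S QS sS] := exponents_bounded; have [c c_gt0 cG] := integral_weight_ge a S.
exists ((lambda * c) ^- 2); first by rewrite invr_gt0 exprn_gt0// mulr_gt0.
move=> n; have d0 : 0 < s_ n - Q by rewrite subr_gt0.
have cd0 : 0 < c / (s_ n - Q) by rewrite divr_gt0.
have Gge : c / (s_ n - Q) <= mean_weight (s_ n).
  rewrite -lee_fin /mean_weight /Rintegral fineK ?cG//.
  exact: integrable_fin_num (integrable_weight (s_gt n)).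
have G0 := lt_le_trans cd0 Gge; have lG0 := mulr_gt0 lambda_gt0 G0.
split=> //; have -> : (lambda * c) ^- 2 * (s_ n - Q) ^+ 2 = (lambda * (c / (s_ n - Q))) ^- 2.
  by rewrite mulrA expr_div_n invf_div mulrC.
rewrite lef_pV2 ?posrE ?(exprn_gt0 _ lG0) ?(exprn_gt0 _ (mulr_gt0 lambda_gt0 cd0))//.
by rewrite lerXn2r ?nnegrE ?(ltW lG0) ?(ltW (mulr_gt0 lambda_gt0 cd0))// ler_pM2l.
Qed.

Lemma ae_limit_distance_summable :
  {ae Pi, forall X, (\sum_(0 <= n <oo)
     ((lambda * mean_weight (s_ n)) ^- 2)%:E * limit_distance (s_ n) X < +oo)%E}.
Proof.
have [S QS sS] := exponents_bounded; have [c c_gt0 cG] := mean_weight_inv_bound.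
have s0 n : 0 <= s_ n by rewrite ltW// (le_lt_trans _ (s_gt n)).
have g0 n : (0 <= ((lambda * mean_weight (s_ n)) ^- 2)%:E)%E.
  by rewrite lee_fin invr_ge0 sqr_ge0.
apply: ae_nneseries_lty.
- by move=> n; apply: measurable_funeM; exact: measurable_limit_distance.
- by move=> n X; rewrite mule_ge0// limit_distance_ge0.
pose B : R := c * (C * lambda * c0 `^ (S + S)).
have B0 : 0 <= B.
  by apply: mulr_ge0; [exact: ltW|exact: mulr_ge0 (ltW (mulr_gt0 C_gt0 lambda_gt0)) (powR_ge0 _ _)].
apply: (@le_lt_trans _ _ (B%:E * \sum_(0 <= n <oo) (((s_ n - Q) ^+ 2)%:E * kernel_energy (s_ n))))%E; last first.
  by apply: lte_mul_pinfty.
rewrite -nneseriesZl; last first.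
  by move=> n _; exact: gap_energy_ge0.
apply: lee_nneseries => [n _ _|n _].
  by apply: integral_ge0 => X _; rewrite mule_ge0// limit_distance_ge0.
rewrite ge0_integralZl//; last 2 first.
- exact: measurable_limit_distance.
- by move=> X _; exact: limit_distance_ge0.
apply: le_trans (lee_wpmul2l (g0 n) (limit_distance_expectation (s_gt n))) _.
rewrite !muleA -!EFinM lee_wpmul2r ?kernel_energy_ge0// lee_fin.
have [_ cn] := cG n; have Cl : 0 <= C * lambda := ltW (mulr_gt0 C_gt0 lambda_gt0).
have -> : B * (s_ n - Q) ^+ 2 = c * (s_ n - Q) ^+ 2 * (C * lambda * c0 `^ (S + S)).
  by rewrite /B mulrAC.
rewrite -[leLHS]mulrA; apply: ler_pM => //.
- by rewrite invr_ge0 sqr_ge0.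
- exact: mulr_ge0 Cl (powR_ge0 _ _).
- by apply: ler_wpM2l => //; apply: ler_powR; [exact: c0_ge1|exact: lerD].
Qed.

(** The variance is bounded, and the squared mean is at least of order
    (s_n - Q)^(-2). *)
Lemma relative_variance : exists2 c : R, 0 <= c & forall n,
  (\int[Pi]_X ((fine (poincare (s_ n) a X) - lambda * mean_weight (s_ n)) ^+ 2 *
     (lambda * mean_weight (s_ n)) ^- 2)%:E <= (c * (s_ n - Q) ^+ 2)%:E)%E.
Proof.
have [c c_gt0 cG] := mean_weight_inv_bound.
have Q2 : Q < k.+2%:R by rewrite ltr_nat.
have i2 := integrable_weight Q2.
exists (C * lambda * mean_weight k.+2%:R * c).
  apply: mulr_ge0 (ltW c_gt0); apply: mulr_ge0 (ltW (mulr_gt0 C_gt0 lambda_gt0)) _.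
  by apply: Rintegral_ge0 => x _; exact: weight_ge0.
move=> n; have [mP _ vP] := poincare_variance (s_gt n).
have [lG0 cn] := cG n.
under eq_integral do rewrite EFinM.
rewrite ge0_integralZr//; last 3 first.
- apply/measurable_EFinP; apply: measurable_funX; exact: measurable_funB.
- by move=> X _; rewrite lee_fin sqr_ge0.
- by rewrite lee_fin invr_ge0 sqr_ge0.
rewrite -mulrA EFinM; apply: lee_pmul => //.
- by apply: integral_ge0 => X _; rewrite lee_fin sqr_ge0.
- by rewrite lee_fin invr_ge0 sqr_ge0.
apply: le_trans vP _; rewrite [leRHS]EFinM lee_wpmul2l ?lee_fin ?(ltW (mulr_gt0 C_gt0 lambda_gt0))//.
rewrite /mean_weight /Rintegral fineK; last exact: integrable_fin_num i2.
apply: ge0_le_integral => //.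
- by move=> x _; rewrite lee_fin sqr_ge0.
- by apply/measurable_EFinP; apply: measurable_funX; exact: measurable_weight.
- by apply/measurable_EFinP; exact: measurable_weight.
move=> x _; rewrite lee_fin expr2 /weight -expRD ler_expR -mulrDl ler_wpM2r ?dh_ge0//.
have := s_gt n; have : k.+2%:R <= Q + Q :> R by rewrite -natrD ler_nat addSn addnS ltnS ltnS leq_addr.
by lra.
Qed.

Lemma poincare_eq0 s s' X : poincare s a X = 0%E -> poincare s' a X = 0%E.
Proof.
move=> P0; apply: esum1 => x _; have [->|Xx] := eqVneq (X x) 0%N; first by rewrite mul0r.
have : (((X x)%:R * weight s a x)%:E <= poincare s a X)%E.
  by apply: esum_ge; exists [set x]; [split|rewrite fsbig_set1].
by rewrite P0 lee_fin leNgt mulr_gt0 ?weight_gt0// ltr0n lt0n.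
Qed.

(** An empty configuration would contribute 1 to the relative variance. *)
Lemma ae_poincare_gt0 : {ae Pi, forall X, forall n, (0 < poincare (s_ n) a X)%E}.
Proof.
have [c c0' vc] := relative_variance; have [c1 _ lG] := mean_weight_inv_bound.
have [mP _] := campbell_ball (@measurable_weight R k a (s_ 0)) (weight_ge0 (s_ 0)).
pose Z := [set X : Conf (uball R m) | poincare (s_ 0) a X = 0%E].
have mZ : measurable Z by rewrite -[Z]setTI; exact: (mP measurableT _ (emeasurable_set1 0%E)).
have ZE n : (Pi Z <= (c * (s_ n - Q) ^+ 2)%:E)%E.
  have [mPn _ _] := poincare_variance (s_gt n); have [lG0 _] := lG n.
  apply: le_trans (vc n); rewrite -[Z]setIT -integral_indic//.
  apply: ge0_le_integral => //.
  - exact/measurable_EFinP/measurable_indic.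
  - apply/measurable_EFinP; apply: measurable_funM => //.
    by apply: measurable_funX; exact: measurable_funB.
  move=> X _; rewrite lee_fin indicE; case: (boolP (X \in Z)) => [/set_mem XZ|_].
    by rewrite (poincare_eq0 (s_ n) XZ) /= sub0r sqrrN divff// expf_neq0// gt_eqF.
  by rewrite mulr_ge0 ?invr_ge0 ?sqr_ge0.
have Z0 : Pi Z = 0%E.
  apply/eqP; rewrite eq_le measure_ge0 andbT.
  have lim0 : (c * (s_ n - Q) ^+ 2)%:E @[n --> \oo] --> 0%:E.
    have d0 : s_ n - Q @[n --> \oo] --> 0.
      by rewrite -[X in _ --> X](subrr Q); apply: cvgB => //; exact: cvg_cst.
    apply: cvg_EFin; first exact: nearW.
    rewrite -[X in _ --> X](mulr0 c); apply: cvgMr.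
    by rewrite -[X in _ --> X](mulr0 0); exact: (cvgM d0 d0).
  by apply: (cvge_ge _ lim0); exact: nearW.
exists Z; split=> // X /= /existsNP[n /negP]; rewrite -leNgt => Pn0.
apply: (@poincare_eq0 (s_ n)); apply/eqP; rewrite eq_le Pn0.
by apply: nnsum_ge0; exact: weight_ge0.
Qed.

(** Unless the kernel vanishes, its energies are bounded below, so that the
    summability hypothesis makes the squared gaps to the critical exponent
    summable. *)
Lemma ae_ratio_summable : (exists x, complex.Re (K x x) != 0) ->
  {ae Pi, forall X, (\sum_(0 <= n <oo)
    ((fine (poincare (s_ n) a X) - lambda * mean_weight (s_ n)) ^+ 2 *
     (lambda * mean_weight (s_ n)) ^- 2)%:E < +oo)%E}.
Proof.
move=> K0; have [S QS sS] := exponents_bounded; have [c c0' vc] := relative_variance.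
have Q1 : 1 <= Q by rewrite ler1n.
have S1 : 1 <= S by rewrite (le_trans Q1)// ltW.
have EnS n : (kernel_energy S <= kernel_energy (s_ n))%E.
  have my : measurable_fun setT (fun x : uB => 1 - sqnorm (\val x)).
    by apply: (uball_continuous_measurable (g := fun v => 1 - sqnorm v)) => v _; exact: continuous_1Bsqnorm.
  have mE s : measurable_fun setT (fun x : uB => (complex.Re (K x x) * (1 - sqnorm (\val x)) `^ (s - 1))%:E).
    apply/measurable_EFinP; apply: measurable_funM => //.
    by apply: (@measurableT_comp _ _ _ _ _ _ (fun t : R => t `^ (s - 1))) => //; exact: measurable_powR.
  apply: ge0_le_integral => //.
    by move=> x _; rewrite lee_fin; exact: mulr_ge0 (ReK_ge0 x) (powR_ge0 _ _).
  move=> x _; rewrite lee_fin ler_wpM2l//; apply: ger_powR; last exact: lerB.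
  by rewrite uball_1Bsqnorm_gt0 gerBl sqnorm_ge0.
have E0 := kernel_energy_gt0 S1 K0.
have Eoo : kernel_energy S \is a fin_num.
  by rewrite ge0_fin_numE ?ltW// (le_lt_trans (EnS 0)) ?kernel_energy_lty.
pose E := fine (kernel_energy S); have E0' : 0 < E by rewrite fine_gt0// E0 ltey_eq Eoo.
have EE : kernel_energy S = E%:E by rewrite fineK.
apply: ae_nneseries_lty.
- move=> n; have [mPn _ _] := poincare_variance (s_gt n).
  apply/measurable_EFinP; apply: measurable_funM => //.
  by apply: measurable_funX; exact: measurable_funB.
- by move=> n X; rewrite lee_fin mulr_ge0 ?invr_ge0 ?sqr_ge0.
apply: (@le_lt_trans _ _ ((c / E)%:E * \sum_(0 <= n <oo) (((s_ n - Q) ^+ 2)%:E * kernel_energy (s_ n))))%E; last first.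
  by apply: lte_mul_pinfty => //; rewrite lee_fin divr_ge0// ltW.
rewrite -nneseriesZl; last first.
  by move=> n _; exact: gap_energy_ge0.
apply: lee_nneseries => [n _ _|n _].
  by apply: integral_ge0 => X _; rewrite lee_fin mulr_ge0 ?invr_ge0 ?sqr_ge0.
apply: le_trans (vc n) _.
have -> : c * (s_ n - Q) ^+ 2 = c / E * ((s_ n - Q) ^+ 2 * E) by field; rewrite gt_eqF.
rewrite EFinM lee_wpmul2l ?lee_fin ?divr_ge0// ?(ltW E0')//.
rewrite EFinM -EE; apply: lee_wpmul2l; last exact: EnS.
by rewrite lee_fin sqr_ge0.
Qed.

(** With P the Poincare series and L its mean, F / P - K_a is the sum of
    (L / P) (F - L K_a) / L and (L / P - 1) K_a. If the kernel vanishes, so does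
    the whole space. *)
Lemma reconstruction X (F : nat -> uball R m -> R[i]) :
  (forall n, (0 < poincare (s_ n) a X < +oo)%E) ->
  (forall n, H (F n) /\ hseries dot (kernel_shell_sum K (s_ n) a X) (F n)) ->
  (\sum_(0 <= n <oo) ((lambda * mean_weight (s_ n)) ^- 2)%:E * limit_distance (s_ n) X < +oo)%E ->
  ((exists x, complex.Re (K x x) != 0) -> (\sum_(0 <= n <oo)
    ((fine (poincare (s_ n) a X) - lambda * mean_weight (s_ n)) ^+ 2 *
     (lambda * mean_weight (s_ n)) ^- 2)%:E < +oo)%E) ->
  `N (scalef ((fine (poincare (s_ n) a X))^-1)%:C (F n) - ksection K a) @[n --> \oo] --> 0.
Proof.
move=> P0 HF; set P := fun n => fine (poincare (s_ n) a X) => Doo rhooo.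
have HK : H (ksection K a) by exact: (rkhs_section rkhsH).
have HFn n : H (F n) by have [] := HF n.
have HG n : H (scalef (P n)^-1%:C (F n) - ksection K a).
  by apply: (hilbert_spaceB hH) => //; exact: (hilbert_spaceZ hH).
have [K0|K0] := pselect (exists x, complex.Re (K x x) != 0); last first.
  have KE x : complex.Re (K x x) = 0 by apply/eqP/negPn/negP => Kx; apply: K0; exists x.
  rewrite (_ : (fun n => _) = fun=> 0); first exact: cvg_cst.
  by apply/funext => n; rewrite (kernel_diag_eq0 KE (HG n)) (hnorm0 hH).
have [c1 _ lG] := mean_weight_inv_bound.
pose L n := lambda * mean_weight (s_ n); have L0 n : 0 < L n by have [] := lG n.
have PP n : 0 < P n by rewrite /P fine_gt0.
have rho1 : P n / L n @[n --> \oo] --> (1 : R).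
  have -> : (fun n => P n / L n) = fun n => (P n / L n - 1) + 1 by apply/funext => n; rewrite subrK.
  rewrite -[X in _ --> X]add0r; apply: cvgD; last exact: cvg_cst.
  apply: sqrt_cvg0; rewrite (_ : (fun n => _) = fun n => (P n - L n) ^+ 2 * L n ^- 2).
    apply: (nneseries_lty_cvg0 _ (rhooo K0)) => n.
    by rewrite mulr_ge0 ?invr_ge0 ?sqr_ge0.
  apply/funext => n; rewrite -[1](divff (lt0r_neq0 (L0 n))) -mulrBl exprMn exprVn.
  by [].
have irho1 : L n / P n @[n --> \oo] --> (1 : R).
  have -> : (fun n => L n / P n) = fun n => (P n / L n)^-1 by apply/funext => n; rewrite invf_div.
  by rewrite -[X in _ --> X]invr1; apply: cvgV => //; exact: oner_neq0.
pose D n := F n - scalef (L n)%:C (ksection K a).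
have HD' n : H (D n) by apply: (hilbert_spaceB hH) => //; exact: (hilbert_spaceZ hH).
have u0 : `N (D n) / L n @[n --> \oo] --> 0.
  apply: sqrt_cvg0; rewrite (_ : (fun n => _) = fun n => L n ^- 2 * `N (D n) ^+ 2); last first.
    by apply/funext => n; rewrite exprMn exprVn mulrC.
  apply: nneseries_lty_cvg0 => [n|]; first by rewrite mulr_ge0 ?invr_ge0 ?sqr_ge0.
  move: Doo; congr (_ < _)%E; apply: eq_eseriesr => n _.
  by have [_ cF] := HF n; rewrite (limit_distanceE (s_gt n) (HFn n) cF).
pose z n := L n / P n * (`N (D n) / L n) + `|L n / P n - 1| * `N (ksection K a).
have z0 : z n @[n --> \oo] --> 0.
  rewrite -[X in _ --> X]addr0; apply: cvgD.
    by rewrite -[X in _ --> X](mulr0 1); exact: cvgM.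
  rewrite -[X in _ --> X](mul0r (`N (ksection K a))); apply: cvgMl.
  by apply/norm_cvg0P; rewrite -[X in _ --> X](subrr 1); apply: cvgB => //; exact: cvg_cst.
apply/cvgrPdist_le => e e0; move/cvgrPdist_le : z0 => /(_ _ e0); apply: filterS => n.
rewrite !sub0r !normrN (ger0_norm (hnorm_ge0 _ _)); apply: le_trans.
apply: le_trans (ler_norm _).
have -> : scalef (P n)^-1%:C (F n) - ksection K a =
    scalef (P n)^-1%:C (D n) + scalef (L n / P n - 1)%:C (ksection K a).
  apply/funext => y; rewrite /D /scalef /= !fctE.
  by rewrite rmorphB (rmorphM (real_complex R) (L n)) rmorph1 /=; ring.
apply: le_trans (hnormD hH _ _) _; [exact: (hilbert_spaceZ hH)|exact: (hilbert_spaceZ hH)|].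
rewrite !(hnormZ hH)// !modulus_real /z; apply: lerD => //.
rewrite ger0_norm ?invr_ge0 ?(ltW (PP n))// le_eqVlt; apply/orP; left; apply/eqP.
by field; rewrite !gt_eqF.
Qed.

Lemma ae_poincare_lty : {ae Pi, forall X, forall n, (poincare (s_ n) a X < +oo)%E}.
Proof. by apply/ae_foralln => n; have [] := poincare_variance (s_gt n). Qed.

Lemma ae_reconstruction : {ae Pi, forall X : Conf (uball R m),
  [/\ forall n, (0 < poincare (s_ n) a X < +oo)%E,
      forall n, (\sum_(0 <= j <oo) (`N (kernel_shell_sum K (s_ n) a X j))%:E < +oo)%E,
      exists2 F : nat -> uball R m -> R[i],
        forall n, H (F n) /\ hseries dot (kernel_shell_sum K (s_ n) a X) (F n)
        & `N (fun y => F n y / (fine (poincare (s_ n) a X))%:C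
              - ksection K a y) @[n --> \oo] --> (0 : R)
    & forall f, H f ->
      exists2 w : nat -> R[i]^o,
        forall n, \sum_(0 <= j < N) shell_sum (s_ n) a X j f @[N --> \oo] --> w n
        & w n / (fine (poincare (s_ n) a X))%:C @[n --> \oo] --> (f a : R[i]^o)]}.
Proof.
have aeK : {ae Pi, forall X, (exists x, complex.Re (K x x) != 0) -> (\sum_(0 <= n <oo)
    ((fine (poincare (s_ n) a X) - lambda * mean_weight (s_ n)) ^+ 2 *
     (lambda * mean_weight (s_ n)) ^- 2)%:E < +oo)%E}.
  have [K0|K0] := pselect (exists x, complex.Re (K x x) != 0).
    by apply: filterS (ae_ratio_summable K0) => X.
  by apply: aeW => X /K0.
have aeS : {ae Pi, forall X, forall n,
    (\sum_(0 <= j <oo) (`N (kernel_shell_sum K (s_ n) a X j))%:E < +oo)%E}.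
  by apply/ae_foralln => n; apply: ae_shell_norms_summable => //; exact: kernel_energy_lty.
have aeP : {ae Pi, forall X, forall n, (0 < poincare (s_ n) a X < +oo)%E}.
  by move: ae_poincare_gt0 ae_poincare_lty; apply: filterS2 => X P0 Poo n; rewrite P0 Poo.
have aeSP : {ae Pi, forall X, (forall n, (0 < poincare (s_ n) a X < +oo)%E) /\ forall n,
    (\sum_(0 <= j <oo) (`N (kernel_shell_sum K (s_ n) a X j))%:E < +oo)%E}.
  by move: aeP aeS; apply: filterS2 => X.
move: aeSP ae_limit_distance_summable aeK; apply: filterS3 => X [PP Soo] Doo rhooo.
have HS n j : H (kernel_shell_sum K (s_ n) a X j) by rewrite kernel_shell_sumE; exact: H_vsum.
have /choice[F HF] n : exists F, H F /\ hseries dot (kernel_shell_sum K (s_ n) a X) F.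
  by have [F HF cF] := hseries_cvg hH (HS n) (Soo n); exists F.
have HFn n : H (F n) by have [] := HF n.
have HK : H (ksection K a) by exact: (rkhs_section rkhsH).
have cF := reconstruction PP HF Doo rhooo.
have scE n : scalef ((fine (poincare (s_ n) a X))^-1)%:C (F n) - ksection K a =
    fun y => F n y / (fine (poincare (s_ n) a X))%:C - ksection K a y.
  by apply/funext => y; rewrite /scalef !fctE fmorphV mulrC.
split=> //.
  by exists F => //; under eq_fun do rewrite -scE.
move=> f Hf; exists (fun n => dot f (F n)) => [n|].
  apply: cvg_modulus; have [_ cFn] := HF n.
  apply/cvgrPdist_le => e e0.
  have /cvgrPdist_le/(_ _ e0) : `N f * hnorm dot (\sum_(0 <= j < N) kernel_shell_sum K (s_ n) a X j - F n)
      @[N --> \oo] --> 0.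
    by rewrite -[X in _ --> X](mulr0 (`N f)); apply: cvgMr; exact: cFn.
  apply: filterS => N; rewrite !sub0r !normrN; apply: le_trans.
  rewrite (ger0_norm (modulus_ge0 _)); apply: le_trans (ler_norm _).
  have HSN : H (\sum_(0 <= j < N) kernel_shell_sum K (s_ n) a X j) by exact: (hilbert_space_sum hH).
  have -> : \sum_(0 <= j < N) shell_sum (s_ n) a X j f =
      dot f (\sum_(0 <= j < N) kernel_shell_sum K (s_ n) a X j).
    rewrite (hilbert_conj hH HSN Hf) (dot_suml hH)// (raddf_sum (@conjc R)).
    by apply: eq_bigr => j _; rewrite shell_sum_dot// (hilbert_conj hH (HS n j) Hf).
  rewrite -(dotBr hH)//; apply: (cauchy_schwarz hH) => //; exact: (hilbert_spaceB hH).
apply: cvg_modulus; apply/cvgrPdist_le => e e0.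
have /cvgrPdist_le/(_ _ e0) : `N f * `N (scalef ((fine (poincare (s_ n) a X))^-1)%:C (F n) - ksection K a)
    @[n --> \oo] --> 0.
  by rewrite -[X in _ --> X](mulr0 (`N f)); apply: cvgMr; exact: cF.
apply: filterS => n; rewrite !sub0r !normrN; apply: le_trans.
rewrite (ger0_norm (modulus_ge0 _)); apply: le_trans (ler_norm _).
have HP : H (scalef ((fine (poincare (s_ n) a X))^-1)%:C (F n)) by exact: (hilbert_spaceZ hH).
have -> : dot f (F n) / (fine (poincare (s_ n) a X))%:C =
    dot f (scalef ((fine (poincare (s_ n) a X))^-1)%:C (F n)).
  rewrite (dotZr hH)// mulrC; congr (_ * _); rewrite -fmorphV; exact/esym/conjc_real.
rewrite (rkhs_reproducing rkhsH a Hf) -(dotBr hH)//.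
by apply: (cauchy_schwarz hH) => //; exact: (hilbert_spaceB hH).
Qed.

End constant_intensity.

Theorem theorem6p1 (R : realType) (m : nat) (m_ge2 : (2 <= m)%N)
  (H : set (uball R m -> R[i]))
  (dot : (uball R m -> R[i]) -> (uball R m -> R[i]) -> R[i])
  (K : uball R m -> uball R m -> R[i])
  (rkhsH : is_rkhs H dot K)
  (harmonicH : H `<=` H_harmonic)
  (growthK : exists Lambda : nat -> R,
    [/\ forall k, 0 <= Lambda k,
        {homo Lambda : j k / (j <= k)%N >-> j <= k},
        subexponential Lambda &
        forall k : nat,
          (\int[mu_ball]_(x in [set x : uball R m |
               (k%:R <= dh (\val x) 0 < k.+1%:R)%R]) (complex.Re (K x x))%:E
           <= (Lambda k * expR (2 * (m%:R - 1) * k%:R))%:E)%E])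
  (limK : ((alpha ^+ 2)%:E *
            \int[Vm]_x (complex.Re (K x x) *
              (1 - sqnorm (\val x)) `^ (alpha + m%:R - 2))%:E)%E
          @[alpha --> (0 : R)^'+] --> (0%E : \bar R))
  (a : uball R m) (s : nat -> R)
  (s_gt : forall n, m%:R - 1 < s n)
  (s_cvg : s n @[n --> \oo] --> (m%:R - 1 : R))
  (sumK : (\sum_(0 <= n <oo) (((s n - m%:R + 1) ^+ 2)%:E *
            \int[Vm]_x (complex.Re (K x x) *
              (1 - sqnorm (\val x)) `^ (s n - 1))%:E) < +oo)%E)
  (Pi : probability (Conf (uball R m)) R)
  (small_variancePi : small_variance Pi)
  (lambda : R) (lambda_gt0 : 0 < lambda)
  (intensityPi : forall B : set (borel (uball R m)), measurable B ->
    first_intensity Pi B = (lambda%:E * mu_ball B)%E) :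
  {ae Pi, forall X : Conf (uball R m),
    [/\ forall n, (0 < poincare (s n) a X < +oo)%E,
        forall n, (\sum_(0 <= k <oo)
          (hnorm dot (kernel_shell_sum K (s n) a X k))%:E < +oo)%E,
        exists2 F : nat -> uball R m -> R[i],
          forall n, H (F n) /\ hseries dot (kernel_shell_sum K (s n) a X) (F n)
          & hnorm dot (fun y => F n y / (fine (poincare (s n) a X))%:C
                                - ksection K a y) @[n --> \oo] --> (0 : R)
      & forall f, H f ->
        exists2 w : nat -> R[i]^o,
          forall n, \sum_(0 <= k < N) shell_sum (s n) a X k f
                      @[N --> \oo] --> w n
          & w n / (fine (poincare (s n) a X))%:C @[n --> \oo] --> (f a : R[i]^o)]}.
Proof.
destruct m as [|[|k]]; [by []|by []|].
have QE : k.+2%:R - 1 = k.+1%:R :> R by rewrite -[k.+2]addn1 natrD addrK.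
have [C C_gt0 small_var] := small_variancePi.
have s_gt' n : k.+1%:R < s n by rewrite -QE.
have s_cvg' : s n @[n --> \oo] --> (k.+1%:R : R) by rewrite -QE.
have sumK' : (\sum_(0 <= n <oo) (((s n - k.+1%:R) ^+ 2)%:E * kernel_energy K (s n)) < +oo)%E.
  move: sumK; congr (_ < _)%E; apply: eq_eseriesr => n _.
  by rewrite -QE opprB addrCA addrC -addrA [- _ + _]addrC addrA addrAC.
exact: (ae_reconstruction a lambda_gt0 intensityPi C_gt0 small_var rkhsH harmonicH s_gt' s_cvg' sumK').
Qed.
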